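(* Let $\mathcal P$ be an operad in bicomplexes over a field $\mathbf k$ of characteristic zero such that $\mathcal P(0)=0$ and $\mathcal P(1)=\mathbf k$. Then there exist a minimal operad $\mathcal M$ and a pluripotential weak equivalence of operads $\mathcal M\xrightarrow{\ \sim\ }\mathcal P$.
   Context: $\mathbf k$ is a field of characteristic zero. A bicomplex is a bigraded $\mathbf k$-vector space $A=\bigoplus_{p,q\in\mathbb Z}A^{p,q}$ with linear maps $\partial$ of bidegree $(1,0)$ and $\bar\partial$ of bidegree $(0,1)$ with $\partial^2=\bar\partial^2=\partial\bar\partial+\bar\partial\partial=0$; morphisms are bidegree-preserving linear maps commuting with $\partial$ and $\bar\partial$. Bicomplexes form a symmetric monoidal category under $\otimes$ over $\mathbf k$ (differentials by the Leibniz rule, Koszul signs with respect to total degree $p+q$). Bott-Chern and Aeppli cohomology are $H_{BC}(A)=\frac{\ker\partial\cap\ker\bar\partial}{\operatorname{Im}\partial\bar\partial}$ and $H_{A}(A)=\frac{\ker\partial\bar\partial}{\operatorname{Im}\partial+\operatorname{Im}\bar\partial}$. A morphism of bicomplexes is a pluripotential weak equivalence if it induces isomorphisms on both $H_{BC}$ and $H_A$. A bb-$\mathbb S$-module is a sequence $M=\{M(n)\}_{n\ge 0}$ of bicomplexes with right $\mathbb S_n$-actions. An operad in bicomplexes is a (symmetric, unital) operad in this symmetric monoidal category; a morphism of operads is a pluripotential weak equivalence if it is one in each arity. $\mathrm I=(0,\mathbf k,0,\dots)$ is the initial operad. $\mathbb T(M)$ denotes the free operad on $M$, graded by weight (number of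 generators in $M$ composed, i.e. number of vertices of the tree; the identity has weight $0$, elements of $M$ weight $1$); $\mathbb T(M)^{(r)}$ is the weight $r$ part. An operad is quasi-free if, forgetting the differentials, it is a free operad on a bigraded $\mathbb S$-module. Principal extension: let $n\ge 2$ and let $(\mathcal Q,\partial_{\mathcal Q},\bar\partial_{\mathcal Q})$ be a quasi-free operad, $\mathcal Q=\mathbb T(M)$ with $M(0)=M(1)=0$. An arity $n$ principal extension of $\mathcal Q$ is the quasi-free operad $\mathcal Q\sqcup_d\mathbb T(E):=\mathbb T(M\oplus E)$, where $E$ is a bigraded $\mathbb S$-module concentrated in arity $n$ and $d\colon E\to\ker(\partial_{\mathcal Q}+\bar\partial_{\mathcal Q})\subseteq\mathcal Q(n)$ is an equivariant map which is the sum of a component of bidegree $(1,0)$ and a component of bidegree $(0,1)$; the differentials are determined by those of $\mathcal Q$, by the two components of $d$ on $E$ (giving $\partial$ and $\bar\partial$ respectively), and by the Leibniz rule. An operad is cofibrant if it is the colimit of a sequence of principal extensions starting from $\mathrm I$. A minimal operad is a cofibrant operad $\mathcal M$ such that $\partial\bar\partial(\mathcal M)\subseteq\mathcal M^{(\ge 2)}$, where $\mathcal M^{(\ge 2)}$ is the part of weight at least $2$. *)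

(* Defs.v *)
From mathcomp Require Import all_boot all_order all_fingroup all_algebra.
From mathcomp Require Import zify.

Set Implicit Arguments.
Unset Strict Implicit.
Unset Printing Implicit Defensive.

Import GRing.Theory.
Local Open Scope ring_scope.

Notation bideg := (int * int)%type.

Definition totdeg (d : bideg) : int := d.1 + d.2.

Definition ksign (k : fieldType) (a : int) : k := (-1) ^ a.

Definition is_zero (k : fieldType) (V : lmodType k) : Prop :=
  forall x : V, x = 0.

(** * Bigraded vector spaces and bicomplexes *)

(* A bigraded vector space is a vector space with an internal direct sum
   decomposition indexed by Z x Z. The decomposition is given by its family of
   projections [bg_proj d] onto the summands A^d: orthogonal idempotents, only
   finitely many of which are nonzero on a given vector, and which sum up to
   the identity. *)
Record bgvect (k : fieldType) := BgVect {
  bg_sort :> lmodType k;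
  bg_proj : bideg -> {linear bg_sort -> bg_sort};
  bg_projK : forall (d e : bideg) (x : bg_sort),
    bg_proj d (bg_proj e x) = if d == e then bg_proj e x else 0;
  bg_sum : forall x : bg_sort,
    exists2 s : seq bideg, uniq s & x = \sum_(d <- s) bg_proj d x }.

Definition homog (k : fieldType) (A : bgvect k) (d : bideg) (x : A) : Prop :=
  bg_proj A d x = x.

Definition has_bideg (k : fieldType) (A B : bgvect k) (c : bideg)
    (f : A -> B) : Prop :=
  forall (d : bideg) (x : A), homog d x -> homog (d + c) (f x).

Record is_bicomplex (k : fieldType) (A : bgvect k)
    (del delbar : {linear A -> A}) : Prop := IsBicomplex {
  bc_del_bideg : has_bideg (1, 0) del;
  bc_delbar_bideg : has_bideg (0, 1) delbar;
  bc_del_del : forall x, del (del x) = 0;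
  bc_delbar_delbar : forall x, delbar (delbar x) = 0;
  bc_anticomm : forall x, del (delbar x) + delbar (del x) = 0 }.

Record bicomplex (k : fieldType) := Bicomplex {
  bc_und :> bgvect k;
  bc_del : {linear bc_und -> bc_und};
  bc_delbar : {linear bc_und -> bc_und};
  bc_axioms : is_bicomplex bc_del bc_delbar }.

Record bcmorph (k : fieldType) (A B : bicomplex k) := BcMorph {
  bcm_fun :> {linear A -> B};
  bcm_bideg : has_bideg 0 bcm_fun;
  bcm_del : forall x, bcm_fun (bc_del A x) = bc_del B (bcm_fun x);
  bcm_delbar : forall x, bcm_fun (bc_delbar A x) = bc_delbar B (bcm_fun x) }.

(* The subquotient cyc/bnd of A, presented by its cycles and its boundaries:
   a class is represented by a cycle, and two cycles represent the same class
   when their difference is a boundary. *)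
Record subquot (k : fieldType) (A : lmodType k) := SubQuot {
  cyc : A -> Prop;
  bnd : A -> Prop }.

Definition same_class (k : fieldType) (A : lmodType k) (H : subquot A)
    (x y : A) : Prop := bnd H (x - y).

(* f induces a well-defined, injective and surjective map of subquotients. *)
Record induces_iso (k : fieldType) (A B : lmodType k) (H : subquot A)
    (H' : subquot B) (f : A -> B) : Prop := InducesIso {
  ii_cyc : forall x, cyc H x -> cyc H' (f x);
  ii_wd : forall x y, cyc H x -> cyc H y ->
    same_class H x y -> same_class H' (f x) (f y);
  ii_inj : forall x y, cyc H x -> cyc H y ->
    same_class H' (f x) (f y) -> same_class H x y;
  ii_surj : forall y, cyc H' y ->
    exists2 x, cyc H x & same_class H' (f x) y }.

Definition H_BC (k : fieldType) (A : bicomplex k) : subquot A :=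
  SubQuot (fun x => bc_del A x = 0 /\ bc_delbar A x = 0)
          (fun x => exists z, x = bc_del A (bc_delbar A z)).

Definition H_A (k : fieldType) (A : bicomplex k) : subquot A :=
  SubQuot (fun x => bc_del A (bc_delbar A x) = 0)
          (fun x => exists y z, x = bc_del A y + bc_delbar A z).

Definition pluripotential_weq (k : fieldType) (A B : bicomplex k)
    (f : bcmorph A B) : Prop :=
  induces_iso (H_BC A) (H_BC B) f /\ induces_iso (H_A A) (H_A B) f.

(** * Bigraded S-modules *)

(* In MathComp (s * t) is "first s, then t", so [sm_actM] is the law of a
   right action for that product. The action should be read as a relabelling
   of inputs: input a of x becomes input (s a) of (x . s). For the product
   "first t, then s", the corresponding right action is that of s^-1. *)
Record bgsmod (k : fieldType) := BgSMod {
  sm_ar :> nat -> bgvect k;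
  sm_act : forall n : nat, 'S_n -> {linear sm_ar n -> sm_ar n};
  sm_act_bideg : forall (n : nat) (s : 'S_n), has_bideg 0 (sm_act s);
  sm_act1 : forall (n : nat) (x : sm_ar n), sm_act 1%g x = x;
  sm_actM : forall (n : nat) (s t : 'S_n) (x : sm_ar n),
    sm_act (s * t)%g x = sm_act t (sm_act s x) }.

Arguments sm_act {k} _ {n} _.

Record smmorph (k : fieldType) (M N : bgsmod k) := SmMorph {
  smm_fun :> forall n : nat, {linear M n -> N n};
  smm_bideg : forall n : nat, has_bideg 0 (smm_fun n);
  smm_act : forall (n : nat) (s : 'S_n) (x : M n),
    smm_fun n (sm_act M s x) = sm_act N s (smm_fun n x) }.

(** * Operads *)

(* Positions (from 0) of the inputs of x o_i y, for y of arity n: the input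
   a <> i of x sits at [outer_pos n i a], the input b of y at
   [inner_pos i b]. *)
Definition outer_pos (n i a : nat) : nat :=
  if (a < i)%N then a else (a + n).-1.

Definition inner_pos (i b : nat) : nat := (i + b)%N.

(* r is the permutation of the inputs of x o_i y that results from permuting
   the inputs of x by s and those of y by t. *)
Definition block_perm (m n l : nat) (i : 'I_m) (s : 'S_m) (t : 'S_n)
    (r : 'S_l) : Prop :=
  (forall (a : 'I_m) (c : 'I_l), a != i -> c = outer_pos n i a :> nat ->
     r c = outer_pos n (s i) (s a) :> nat) /\
  (forall (b : 'I_n) (c : 'I_l), c = inner_pos i b :> nat ->
     r c = inner_pos (s i) (t b) :> nat).

Lemma block_perm_exists (m n l : nat) (i : 'I_m) (s : 'S_m) (t : 'S_n) :
  l.+1 = (m + n)%N -> exists r : 'S_l, block_perm i s t r.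
Proof.
move=> e; pose sN a := nat_of_ord (s (insubd i a)).
have sE (a : 'I_m) : sN a = s a by rewrite /sN valKd.
have sN_lt a : (sN a < m)%N by exact: ltn_ord.
have sN_inj a b : (a < m -> b < m -> sN a = sN b -> a = b)%N.
  move=> am bm /val_inj /perm_inj /(congr1 val).
  by rewrite /= !val_insubd am bm.
pose tN b := if insub b is Some b' then nat_of_ord (t b') else 0%N.
have tE (b : 'I_n) : tN b = t b by rewrite /tN valK.
have tN_lt b : (b < n -> tN b < n)%N by move=> bn; rewrite -[b]/(val (Ordinal bn)) tE.
have tN_inj a b : (a < n -> b < n -> tN a = tN b -> a = b)%N.
  move=> an bn; rewrite -[a]/(val (Ordinal an)) -[b]/(val (Ordinal bn)) !tE.
  by move=> /val_inj /perm_inj ->.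
have im := ltn_ord i.
pose F c := if (c < i)%N then outer_pos n (sN i) (sN c)
            else if (c < i + n)%N then inner_pos (sN i) (tN (c - i)%N)
            else outer_pos n (sN i) (sN (c - n).+1).
have ne a : (a < m -> a <> i -> sN a <> sN i)%N.
  by move=> am ai E; apply: ai; exact: (sN_inj a i am im E).
have F_lt c : (c < l -> F c < l)%N.
  move=> cl; rewrite /F /outer_pos /inner_pos.
  have i_lt := sN_lt i.
  case: (ltnP c) => ci; last case: (ltnP c) => cn.
  - have := sN_lt c; have := ne c; case: (ltnP (sN c) (sN i)) => *; lia.
  - have := tN_lt (c - i)%N; lia.
  - have := sN_lt (c - n).+1; have := ne (c - n).+1.
    case: (ltnP (sN _) (sN i)) => *; lia.
have o_inj a b : (sN a <> sN i -> sN b <> sN i ->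
    outer_pos n (sN i) (sN a) = outer_pos n (sN i) (sN b) -> sN a = sN b)%N.
  rewrite /outer_pos.
  by case: (ltnP (sN a) (sN i)); case: (ltnP (sN b) (sN i)); lia.
have oi_disj a b : (sN a <> sN i -> b < n ->
    outer_pos n (sN i) (sN a) <> inner_pos (sN i) b)%N.
  by rewrite /outer_pos /inner_pos; case: (ltnP (sN a) (sN i)); lia.
have F_inj c d : (c < l -> d < l -> F c = F d -> c = d)%N.
  have P (x : nat) : (x < l ->
      (exists a, [/\ a < m, a <> i, x = outer_pos n i a &
                     F x = outer_pos n (sN i) (sN a)]) \/
      (exists b, [/\ b < n, x = inner_pos i b &
                     F x = inner_pos (sN i) (tN b)]))%N.
    move=> xl; rewrite /F; case: (ltnP x i) => xi.
      by left; exists x; rewrite /outer_pos xi; split=> //; lia.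
    case: (ltnP x (i + n)) => xn.
      by right; exists (x - i)%N; rewrite /inner_pos; split=> //; lia.
    left; exists (x - n).+1; split=> //; try lia.
    by rewrite /outer_pos; case: ltnP; lia.
  move=> /P[[a [am ai -> ->]]|[a [an -> ->]]] /P[[b [bm bi -> ->]]|[b [bn -> ->]]].
  - by move=> /(o_inj _ _ (ne _ am ai) (ne _ bm bi)) /(sN_inj _ _ am bm) ->.
  - by move=> /(oi_disj _ _ (ne _ am ai) (tN_lt _ bn)).
  - by move=> /esym/(oi_disj _ _ (ne _ bm bi) (tN_lt _ an)).
  - by move=> /addnI /(tN_inj _ _ an bn) ->.
pose f (c : 'I_l) := Ordinal (F_lt c (ltn_ord c)).
have f_inj : injective f.
  by move=> c d /(congr1 val) /= /F_inj cd; apply/val_inj/cd.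
exists (perm f_inj); split=> [a c ai cE | b c cE]; rewrite permE /=.
  have {}ai : nat_of_ord a <> i by move=> /val_inj; apply/eqP.
  have am := ltn_ord a; rewrite /F -!sE cE.
  have [lai|lai] := ltnP a i.
    have -> : outer_pos n i a = a by rewrite /outer_pos lai.
    by rewrite lai.
  have -> : outer_pos n i a = (a + n).-1 by rewrite /outer_pos ltnNge lai.
  have -> : ((a + n).-1 < i)%N = false by lia.
  have -> : ((a + n).-1 < i + n)%N = false by lia.
  by have -> : ((a + n).-1 - n).+1 = a by lia.
rewrite /F -tE -sE cE /inner_pos; have bn := ltn_ord b.
have -> : (i + b < i)%N = false by lia.
have -> : (i + b < i + n)%N by lia.
by have -> : (i + b - i)%N = b by lia.
Qed.

(* Bigraded symmetric unital operads (without differentials), given by partial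
   compositions. The partial composition is typed with an equation l + 1 =
   m + n on arities, so that no axiom involves a transport. *)
Record bgoperad (k : fieldType) := BgOperad {
  og_mod :> bgsmod k;
  og_id : og_mod 1%N;
  og_pcomp : forall m n l : nat, l.+1 = (m + n)%N -> 'I_m ->
    og_mod m -> og_mod n -> og_mod l;
  og_linearl : forall (m n l : nat) (e : l.+1 = (m + n)%N) (i : 'I_m)
    (y : og_mod n), linear (fun x => og_pcomp e i x y);
  og_linearr : forall (m n l : nat) (e : l.+1 = (m + n)%N) (i : 'I_m)
    (x : og_mod m), linear (og_pcomp e i x);
  og_id_homog : homog 0 og_id;
  og_pcomp_homog : forall (m n l : nat) (e : l.+1 = (m + n)%N) (i : 'I_m)
    (c d : bideg) (x : og_mod m) (y : og_mod n),
    homog c x -> homog d y -> homog (c + d) (og_pcomp e i x y);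
  og_idl : forall (n : nat) (e : n.+1 = (1 + n)%N) (i : 'I_1) (y : og_mod n),
    og_pcomp e i og_id y = y;
  og_idr : forall (m : nat) (e : m.+1 = (m + 1)%N) (i : 'I_m) (x : og_mod m),
    og_pcomp e i x og_id = x;
  (* (x o_i y) o_(i+j) z = x o_i (y o_j z) *)
  og_seq : forall (m n p mn np l : nat)
    (e : mn.+1 = (m + n)%N) (e' : l.+1 = (mn + p)%N)
    (g : np.+1 = (n + p)%N) (g' : l.+1 = (m + np)%N)
    (i : 'I_m) (j : 'I_n) (ij : 'I_mn),
    ij = inner_pos i j :> nat ->
    forall (x : og_mod m) (y : og_mod n) (z : og_mod p),
    og_pcomp e' ij (og_pcomp e i x y) z = og_pcomp g' i x (og_pcomp g j y z);
  (* (x o_i y) o_(h+n-1) z = (-1)^(|y||z|) (x o_h z) o_i y  for i < h *)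
  og_par : forall (m n p mn mp l : nat)
    (e : mn.+1 = (m + n)%N) (e' : l.+1 = (mn + p)%N)
    (g : mp.+1 = (m + p)%N) (g' : l.+1 = (mp + n)%N)
    (i h : 'I_m) (i' : 'I_mp) (h' : 'I_mn),
    (i < h)%N ->
    h' = outer_pos n i h :> nat -> i' = outer_pos p h i :> nat ->
    forall (c d : bideg) (x : og_mod m) (y : og_mod n) (z : og_mod p),
    homog c y -> homog d z ->
    og_pcomp e' h' (og_pcomp e i x y) z =
      ksign k (totdeg c * totdeg d) *: og_pcomp g' i' (og_pcomp g h x z) y;
  og_equiv : forall (m n l : nat) (e : l.+1 = (m + n)%N) (i : 'I_m)
    (s : 'S_m) (t : 'S_n) (r : 'S_l), block_perm i s t r ->
    forall (x : og_mod m) (y : og_mod n),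
    sm_act og_mod r (og_pcomp e i x y) =
      og_pcomp e (s i) (sm_act og_mod s x) (sm_act og_mod t y) }.

Arguments og_pcomp {k} _ {m n l} _ _ _ _.

Record bgopmorph (k : fieldType) (P Q : bgoperad k) := BgOpMorph {
  bom_fun :> smmorph P Q;
  bom_id : bom_fun 1%N (og_id P) = og_id Q;
  bom_pcomp : forall (m n l : nat) (e : l.+1 = (m + n)%N) (i : 'I_m)
    (x : P m) (y : P n),
    bom_fun l (og_pcomp P e i x y) =
      og_pcomp Q e i (bom_fun m x) (bom_fun n y) }.

(* Operads in bicomplexes: the symmetric group actions, the unit k -> P(1) and
   the partial compositions P(m) (x) P(n) -> P(l) are morphisms of bicomplexes,
   the tensor product carrying the Leibniz differentials with Koszul signs. *)
Record operad (k : fieldType) := Operad {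
  op_und :> bgoperad k;
  op_del : forall n : nat, {linear op_und n -> op_und n};
  op_delbar : forall n : nat, {linear op_und n -> op_und n};
  op_bicomplex : forall n : nat, is_bicomplex (op_del n) (op_delbar n);
  op_act_del : forall (n : nat) (s : 'S_n) (x : op_und n),
    op_del n (sm_act op_und s x) = sm_act op_und s (op_del n x);
  op_act_delbar : forall (n : nat) (s : 'S_n) (x : op_und n),
    op_delbar n (sm_act op_und s x) = sm_act op_und s (op_delbar n x);
  op_id_del : op_del 1%N (og_id op_und) = 0;
  op_id_delbar : op_delbar 1%N (og_id op_und) = 0;
  op_leibniz_del : forall (m n l : nat) (e : l.+1 = (m + n)%N) (i : 'I_m)
    (d : bideg) (x : op_und m) (y : op_und n), homog d x ->
    op_del l (og_pcomp op_und e i x y) =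
      og_pcomp op_und e i (op_del m x) y
      + ksign k (totdeg d) *: og_pcomp op_und e i x (op_del n y);
  op_leibniz_delbar : forall (m n l : nat) (e : l.+1 = (m + n)%N) (i : 'I_m)
    (d : bideg) (x : op_und m) (y : op_und n), homog d x ->
    op_delbar l (og_pcomp op_und e i x y) =
      og_pcomp op_und e i (op_delbar m x) y
      + ksign k (totdeg d) *: og_pcomp op_und e i x (op_delbar n y) }.

Definition op_ar (k : fieldType) (P : operad k) (n : nat) : bicomplex k :=
  Bicomplex (op_bicomplex P n).

Record opmorph (k : fieldType) (P Q : operad k) := OpMorph {
  om_fun :> bgopmorph P Q;
  om_del : forall (n : nat) (x : P n),
    om_fun n (op_del P n x) = op_del Q n (om_fun n x);
  om_delbar : forall (n : nat) (x : P n),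
    om_fun n (op_delbar P n x) = op_delbar Q n (om_fun n x) }.

Definition om_ar (k : fieldType) (P Q : operad k) (f : opmorph P Q) (n : nat) :
    bcmorph (op_ar P n) (op_ar Q n) :=
  @BcMorph k (op_ar P n) (op_ar Q n) (f n) (smm_bideg f (n := n))
    (om_del f (n := n)) (om_delbar f (n := n)).

Definition operad_weq (k : fieldType) (P Q : operad k) (f : opmorph P Q) :
    Prop :=
  forall n : nat, pluripotential_weq (om_ar f n).

(* P(1) = k: the unit k -> P(1) is an isomorphism. *)
Definition unit_arity1 (k : fieldType) (P : bgoperad k) : Prop :=
  forall x : P 1%N, exists! a : k, x = a *: og_id P.

(* I = (0, k, 0, 0, ...), up to its unique isomorphism. *)
Definition is_initial (k : fieldType) (P : bgoperad k) : Prop :=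
  unit_arity1 P /\ forall n : nat, n <> 1%N -> is_zero (P n).

(** * Free operads, weight, quasi-free operads *)

(* iota exhibits Q as the free (bigraded) operad T(M). *)
Definition is_free (k : fieldType) (M : bgsmod k) (Q : bgoperad k)
    (iota : smmorph M Q) : Prop :=
  forall (R : bgoperad k) (phi : smmorph M R),
    (exists f : bgopmorph Q R,
       forall (n : nat) (x : M n), f n (iota n x) = phi n x) /\
    (forall f g : bgopmorph Q R,
       (forall (n : nat) (x : M n), f n (iota n x) = phi n x) ->
       (forall (n : nat) (x : M n), g n (iota n x) = phi n x) ->
       forall (n : nat) (y : Q n), f n y = g n y).

(* [weight G r y]: y is a linear combination of composites of r elements
   of G. For Q = T(M) and G = M this is the subspace T(M)^(r). *)
Inductive weight (k : fieldType) (Q : bgoperad k)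
    (G : forall n : nat, Q n -> Prop) : nat -> forall n : nat, Q n -> Prop :=
| weight_id : weight G 0 (og_id Q)
| weight_gen (n : nat) (x : Q n) : G n x -> weight G 1 x
| weight_act (r n : nat) (s : 'S_n) (x : Q n) :
    weight G r x -> weight G r (sm_act Q s x)
| weight_pcomp (r s m n l : nat) (e : l.+1 = (m + n)%N) (i : 'I_m)
    (x : Q m) (y : Q n) :
    weight G r x -> weight G s y -> weight G (r + s) (og_pcomp Q e i x y)
| weight_0 (r n : nat) : weight G r (0 : Q n)
| weight_lin (r n : nat) (a : k) (x y : Q n) :
    weight G r x -> weight G r y -> weight G r (a *: x + y).

Inductive weight_ge (k : fieldType) (Q : bgoperad k)
    (G : forall n : nat, Q n -> Prop) (r n : nat) : Q n -> Prop :=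
| weight_ge_0 : weight_ge G r (0 : Q n)
| weight_ge_add (s : nat) (x y : Q n) : (r <= s)%N ->
    weight G s x -> weight_ge G r y -> weight_ge G r (x + y).

(* An operad together with an S-module M such that, forgetting the
   differentials, the operad is T(M). *)
Record quasifree (k : fieldType) := QuasiFree {
  qf_op :> operad k;
  qf_gen : bgsmod k;
  qf_iota : smmorph qf_gen qf_op;
  qf_free : is_free qf_iota }.

(** * Principal extensions, cofibrant and minimal operads *)

(* The data (E, d) for an arity n principal extension of Q, where d is the sum
   of its components at_d10 and at_d01. *)
Record attaching (k : fieldType) (n : nat) (Q : operad k) := Attaching {
  at_E :> bgsmod k;
  at_conc : forall m : nat, m <> n -> is_zero (at_E m);
  at_d10 : forall m : nat, {linear at_E m -> Q m};
  at_d01 : forall m : nat, {linear at_E m -> Q m};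
  at_d10_bideg : forall m : nat, has_bideg (1, 0) (at_d10 m);
  at_d01_bideg : forall m : nat, has_bideg (0, 1) (at_d01 m);
  at_equiv : forall (m : nat) (s : 'S_m) (x : at_E m),
    at_d10 m (sm_act at_E s x) + at_d01 m (sm_act at_E s x) =
      sm_act Q s (at_d10 m x + at_d01 m x);
  at_closed : forall (m : nat) (x : at_E m),
    let dx := at_d10 m x + at_d01 m x in
    op_del Q m dx + op_delbar Q m dx = 0 }.

(* j : X -> Y is the arity n principal extension X -> X \sqcup_d T(E):
   X = T(M) with M(0) = M(1) = 0, Y = T(M (+) E) where u and v are the two
   inclusions of the direct sum, j is induced by u, and the differentials of Y
   on E are the components of d. *)
Record is_principal_ext (k : fieldType) (n : nat) (X Y : quasifree k)
    (j : opmorph X Y) (E : attaching n X)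
    (u : smmorph (qf_gen X) (qf_gen Y)) (v : smmorph E (qf_gen Y)) : Prop :=
  IsPrincipalExt {
  pe_arity : (2 <= n)%N;
  pe_gen0 : is_zero (qf_gen X 0%N);
  pe_gen1 : is_zero (qf_gen X 1%N);
  pe_sum : forall (m : nat) (y : qf_gen Y m),
    exists! xz : qf_gen X m * E m, y = u m xz.1 + v m xz.2;
  pe_j : forall (m : nat) (x : qf_gen X m),
    j m (qf_iota X m x) = qf_iota Y m (u m x);
  pe_del : forall (m : nat) (z : E m),
    op_del Y m (qf_iota Y m (v m z)) = j m (at_d10 E m z);
  pe_delbar : forall (m : nat) (z : E m),
    op_delbar Y m (qf_iota Y m (v m z)) = j m (at_d01 E m z) }.

Definition principal_ext (k : fieldType) (X Y : quasifree k)
    (j : opmorph X Y) : Prop :=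
  exists (n : nat) (E : attaching n X)
    (u : smmorph (qf_gen X) (qf_gen Y)) (v : smmorph E (qf_gen Y)),
    is_principal_ext j u v.

Section Colimit.
Variables (k : fieldType) (X : nat -> operad k).
Variable j : forall r : nat, opmorph (X r) (X r.+1).

Definition is_cocone (C : operad k) (leg : forall r : nat, opmorph (X r) C) :
    Prop :=
  forall (r n : nat) (x : X r n), leg r.+1 n (j r n x) = leg r n x.

Definition is_colimit (C : operad k) (leg : forall r : nat, opmorph (X r) C) :
    Prop :=
  is_cocone leg /\
  forall (D : operad k) (leg' : forall r : nat, opmorph (X r) D),
    is_cocone leg' ->
    (exists f : opmorph C D,
       forall (r n : nat) (x : X r n), f n (leg r n x) = leg' r n x) /\
    (forall f g : opmorph C D,
       (forall (r n : nat) (x : X r n), f n (leg r n x) = leg' r n x) ->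
       (forall (r n : nat) (x : X r n), g n (leg r n x) = leg' r n x) ->
       forall (n : nat) (y : C n), f n y = g n y).

End Colimit.

(* A presentation of C as the colimit of a sequence of principal extensions starting from I. *)
Record cofibrant (k : fieldType) (C : operad k) := Cofibrant {
  cof_op : nat -> quasifree k;
  cof_map : forall r : nat, opmorph (cof_op r) (cof_op r.+1);
  cof_initial : is_initial (cof_op 0%N);
  cof_principal : forall r : nat, principal_ext (cof_map r);
  cof_leg : forall r : nat, opmorph (cof_op r) C;
  cof_colimit : is_colimit cof_map cof_leg }.

(* The generators of C: forgetting the differentials, C is the free operad on
   the union of the generators of the stages of the sequence. *)
Definition cof_gen (k : fieldType) (C : operad k) (c : cofibrant C) (n : nat)
    (y : C n) : Prop :=
  exists (r : nat) (x : qf_gen (cof_op c r) n),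
    y = cof_leg c r n (qf_iota (cof_op c r) n x).

Definition minimal (k : fieldType) (M : operad k) : Prop :=
  exists c : cofibrant M, forall (n : nat) (x : M n),
    weight_ge (cof_gen c) 2 (op_del M n (op_delbar M n x)).

(* Main.v *)
(* The model is built one arity at a time. Suppose that f : A -> B is the map
   in arity n of a morphism Q -> P whose source has no generators of arity n or
   more. Let J be the injective hull of the bicomplex A, a sum of squares, and
   let C be the quotient of B + J by A. By Maschke's theorem C splits
   equivariantly into squares and a part C' on which the composite of the two
   differentials vanishes. The preimage A + C' of C' in B + J is equivalent to
   B + J, hence to B, and it is what Q becomes in arity n when C' is attached.
   This takes two principal extensions: first the image of the two
   differentials of C', then a complement of that image.

   The free operad on M is the quotient of the formal combinations of operadic
   monomials in M by the identities valid in all operads under M, so that no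
   trees are needed. Its derivations are morphisms to dual numbers, and that the
   free operad on M + E is the one on M plus E in the arity of E is detected by
   a morphism to a square-zero extension. *)

Require Import Defs.
From HB Require Import structures.
From mathcomp Require Import all_boot all_order all_fingroup all_algebra.
From mathcomp Require Import generic_quotient boolp classical_sets zify.

Set Implicit Arguments.
Unset Strict Implicit.
Unset Printing Implicit Defensive.

Import GRing.Theory.
Local Open Scope quotient_scope.
Local Open Scope ring_scope.

(** * Bigraded vector spaces and S-modules *)

(** In a principal extension the differential of a new generator has values in the old operad, so
    generators attached together cannot hit one another. This is the obstacle, since $C'$ has
    nonzero differentials; but $\partial\bar\partial$ vanishes on $C'$, so both differentials vanish
    on their image, and two layers suffice. Squares are discarded for the sake of minimality:
    without them $\partial\bar\partial$ of a new generator has no component along new generators and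
    lies in $Q(n)$. As $Q$ has no generators of arity $n$, every element there is a combination of
    composites of elements of arity at least two, hence of weight at least two. Injectivity of
    squares is what makes discarding them harmless in cohomology. A composite of a generator of
    arity $n$ with anything of arity at least two has arity above $n$: arity $n$ of the new operad
    is therefore just $Q(n)\oplus C'$, lower arities do not change, the cohomological statement
    becomes linear algebra in one arity, and the colimit can be read off in each arity at a finite
    stage. *)

Definition lin_of (k : fieldType) (U V : lmodType k) (f : U -> V)
  (fL : linear f) : U -> V := f.
HB.instance Definition _ (k : fieldType) (U V : lmodType k) (f : U -> V)
  (fL : linear f) := GRing.isLinear.Build k U V *:%R (lin_of fL) fL.

Arguments lin_of {k U V f} fL x /.

(** The linearity proof is an argument of the wrapper [lin_of], so that functions defined in the
    middle of a proof can be packed without declaring an instance for each. *)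
Definition linpack (k : fieldType) (U V : lmodType k) (f : U -> V)
  (fL : linear f) : {linear U -> V} := lin_of fL.

Section Bigraded.
Variables (k : fieldType).
Implicit Types (A B : bgvect k) (d e : bideg).

Lemma proj_homog A d (x : A) : homog d (bg_proj A d x).
Proof. by rewrite /homog bg_projK eqxx. Qed.

Lemma homog0 A d : homog d (0 : A).
Proof. exact: linear0. Qed.

Lemma homogD A d (x y : A) : homog d x -> homog d y -> homog d (x + y).
Proof. by rewrite /homog linearD => -> ->. Qed.

Lemma homogZ A d a (x : A) : homog d x -> homog d (a *: x).
Proof. by rewrite /homog linearZ => ->. Qed.

Lemma proj_homogE A d e (x : A) :
  homog d x -> bg_proj A e x = if e == d then x else 0.
Proof. by move=> <-; rewrite bg_projK. Qed.

Lemma bg_sum_out A (s : seq bideg) (x : A) :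
  x = \sum_(d <- s) bg_proj A d x -> forall d, d \notin s -> bg_proj A d x = 0.
Proof.
move=> xE d ds; rewrite xE linear_sum big_seq big1 // => e es.
by rewrite bg_projK; case: eqP es ds => // -> ->.
Qed.

Definition bg_supp A (x : A) : seq bideg := s2val (cid2 (bg_sum x)).

Lemma bg_supp_uniq A (x : A) : uniq (bg_supp x).
Proof. exact: s2valP (cid2 (bg_sum x)). Qed.

Lemma bg_suppE A (x : A) : x = \sum_(d <- bg_supp x) bg_proj A d x.
Proof. exact: s2valP' (cid2 (bg_sum x)). Qed.

Lemma bg_supp_out A (x : A) d : d \notin bg_supp x -> bg_proj A d x = 0.
Proof. exact/bg_sum_out/bg_suppE. Qed.

Lemma bg_ind A (S : A -> Prop) : S 0 -> (forall x y, S x -> S y -> S (x + y)) ->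
  (forall d x, homog d x -> S x) -> forall x, S x.
Proof.
move=> S0 SD Sh x; rewrite [x]bg_suppE; elim: (bg_supp x) => [|d s IH].
  by rewrite big_nil.
by rewrite big_cons; apply: SD => //; exact/Sh/proj_homog.
Qed.

(* The sum of F d (x_d) over all d: only finitely many x_d are nonzero. *)
Definition bg_gsum A (V : lmodType k) (F : bideg -> A -> V) (x : A) : V :=
  \sum_(d <- bg_supp x) F d (bg_proj A d x).

Lemma bg_gsumE A (V : lmodType k) (F : bideg -> {linear A -> V}) (s : seq bideg) x :
  uniq s -> (forall d, d \notin s -> bg_proj A d x = 0) ->
  bg_gsum F x = \sum_(d <- s) F d (bg_proj A d x).
Proof.
move=> us out; rewrite /bg_gsum.
(* Enlarging the index set adds only zero terms; the two index sets are then compared through their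
   union. *)
have G (s1 s2 : seq bideg) : uniq s1 -> uniq s2 -> {subset s1 <= s2} ->
   (forall d, d \notin s1 -> bg_proj A d x = 0) ->
   \sum_(d <- s1) F d (bg_proj A d x) = \sum_(d <- s2) F d (bg_proj A d x).
  move=> u1 u2 s12 o1; rewrite [RHS](bigID (mem s1)) /= [X in _ + X]big1 ?addr0.
    rewrite -[in RHS]big_filter; apply/perm_big/uniq_perm => //.
      exact: filter_uniq.
    by move=> d; rewrite mem_filter; case: (boolP (d \in s1)) => // /s12 ->.
  by move=> d /o1 ->; rewrite linear0.
pose s3 := undup (bg_supp x ++ s).
transitivity (\sum_(d <- s3) F d (bg_proj A d x)).
  apply: G; rewrite ?undup_uniq ?bg_supp_uniq //.
    by move=> d ds; rewrite mem_undup mem_cat ds.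
  by move=> d; exact: bg_supp_out.
symmetry; apply: G; rewrite ?undup_uniq //.
by move=> d ds; rewrite mem_undup mem_cat ds orbT.
Qed.

Lemma bg_gsum_linear A (V : lmodType k) (F : bideg -> {linear A -> V}) :
  linear (bg_gsum F).
Proof.
move=> a x y; pose s := undup (bg_supp x ++ bg_supp y).
have out d : d \notin s -> bg_proj A d x = 0 /\ bg_proj A d y = 0.
  rewrite mem_undup mem_cat negb_or => /andP[dx dy].
  by split; exact: bg_supp_out.
rewrite !(@bg_gsumE _ _ _ s) ?undup_uniq //; try by move=> d /out[].
  rewrite scaler_sumr -big_split; apply: eq_bigr => d _ /=.
  by rewrite !linearP.
by move=> d /out[dx dy]; rewrite linearP /= dx dy scaler0 addr0.
Qed.

Lemma bg_gsum_homog A (V : lmodType k) (F : bideg -> {linear A -> V}) d x :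
  homog d x -> bg_gsum F x = F d x.
Proof.
move=> xd; rewrite (@bg_gsumE _ _ _ [:: d]) ?big_seq1 ?xd //.
by move=> e; rewrite inE => ed; rewrite (proj_homogE _ xd) (negbTE ed).
Qed.

Lemma has_bideg_proj A B c (f : {linear A -> B}) :
  has_bideg c f <-> forall d x, f (bg_proj A d x) = bg_proj B (d + c) (f x).
Proof.
split=> [fc d x | E d x xd]; last by rewrite /homog -E xd.
elim/(@bg_ind A): x; first by rewrite !linear0.
  by move=> x y Ex Ey; rewrite !linearD Ex Ey.
move=> e x xe; rewrite (proj_homogE _ xe) (proj_homogE _ (fc _ _ xe)).
by rewrite (inj_eq (addIr c)); case: eqP => // _; rewrite linear0.
Qed.

Lemma has_bideg0_proj A B (f : {linear A -> B}) :
  has_bideg 0 f <-> forall d x, f (bg_proj A d x) = bg_proj B d (f x).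
Proof. by rewrite has_bideg_proj; split=> E d x; rewrite E addr0. Qed.

Lemma bg_sum_in A (s : seq bideg) (x : A) : uniq s ->
  (forall d, d \notin s -> bg_proj A d x = 0) -> x = \sum_(d <- s) bg_proj A d x.
Proof. by move=> us out; rewrite -(@bg_gsumE A A (fun=> idfun)) //; exact: bg_suppE. Qed.

Lemma bg_sum_sub A (s : seq bideg) (x : A) : uniq s -> {subset bg_supp x <= s} ->
  x = \sum_(d <- s) bg_proj A d x.
Proof.
move=> us sub; apply: bg_sum_in => // d ds.
by apply: bg_supp_out; apply: contra ds; exact: sub.
Qed.

End Bigraded.

(** * Sums, shifts and subobjects *)

Section Constructions.
Variable k : fieldType.

Section BgSum.
Variables A B : bgvect k.
Definition bgsum_proj_fun d (x : (A * B)%type) : (A * B)%type := (bg_proj A d x.1, bg_proj B d x.2).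
Lemma bgsum_proj_linear d : linear (bgsum_proj_fun d).
Proof. by move=> a x y; rewrite /bgsum_proj_fun /= !linearP. Qed.
Definition bgsum_proj d : {linear (A * B)%type -> (A * B)%type} := linpack (bgsum_proj_linear d).
Lemma bgsum_projK d e x :
  bgsum_proj d (bgsum_proj e x) = if d == e then bgsum_proj e x else 0.
Proof. by rewrite /= /bgsum_proj_fun /= !bg_projK; case: eqP. Qed.
Lemma bgsum_sum x : exists2 s : seq bideg, uniq s & x = \sum_(d <- s) bgsum_proj d x.
Proof.
exists (undup (bg_supp x.1 ++ bg_supp x.2)); first exact: undup_uniq.
case: x => x y; rewrite [RHS]surjective_pairing (raddf_sum fst) (raddf_sum snd) /=.
congr pair; apply: bg_sum_sub; rewrite ?undup_uniq // => d ds;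
  by rewrite mem_undup mem_cat ds ?orbT.
Qed.
Definition bgsum := BgVect bgsum_projK bgsum_sum.
End BgSum.

Section BgShift.
Variables (c : bideg) (A : bgvect k).
Lemma bgshift_projK d e (x : A) :
  bg_proj A (d + c) (bg_proj A (e + c) x) = if d == e then bg_proj A (e + c) x else 0.
Proof. by rewrite bg_projK (inj_eq (addIr c)). Qed.
Lemma bgshift_sum (x : A) :
  exists2 s : seq bideg, uniq s & x = \sum_(d <- s) bg_proj A (d + c) x.
Proof.
exists [seq d - c | d <- bg_supp x].
  by rewrite map_inj_uniq ?bg_supp_uniq //; exact: addIr.
rewrite big_map [LHS]bg_suppE; apply: eq_bigr => d _.
by rewrite subrK.
Qed.
(* The copy of A whose degree d part is A^(d + c). *)
Definition bgshift := BgVect bgshift_projK bgshift_sum.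
End BgShift.

(** Membership is a [Prop], because the subspaces needed later are images and sums of images;
    excluded middle turns it into a boolean predicate for the subtype structures. *)
Record subspace (V : lmodType k) := Subspace {
  ssp_mem :> V -> Prop;
  ssp_0 : ssp_mem 0;
  ssp_lin : forall a x y, ssp_mem x -> ssp_mem y -> ssp_mem (a *: x + y) }.

Definition ssp_pred (V : lmodType k) (W : subspace V) : {pred V} :=
  [pred x | `[< W x >]].

Lemma ssp_submod (V : lmodType k) (W : subspace V) : submod_closed (ssp_pred W).
Proof.
split; first exact/asboolP/ssp_0.
by move=> a x y /asboolP Wx /asboolP Wy; apply/asboolP/ssp_lin.
Qed.

HB.instance Definition _ (V : lmodType k) (W : subspace V) :=
  GRing.isSubmodClosed.Build k V (ssp_pred W) (ssp_submod W).

Record ssp_sort (V : lmodType k) (W : subspace V) :=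
  SspSort { ssp_val : V; _ : ssp_val \in ssp_pred W }.

HB.instance Definition _ (V : lmodType k) (W : subspace V) :=
  [isSub for @ssp_val V W].
HB.instance Definition _ (V : lmodType k) (W : subspace V) :=
  [Choice of ssp_sort W by <:].
HB.instance Definition _ (V : lmodType k) (W : subspace V) :=
  [SubChoice_isSubLmodule of ssp_sort W by <:].

Section Ssp.
Variables (V : lmodType k) (W : subspace V).
Lemma ssp_valP (x : ssp_sort W) : W (val x).
Proof. by case: x => x Wx; apply/asboolP. Qed.
Definition ssp_sub x (Wx : W x) : ssp_sort W := SspSort (asboolT Wx : x \in ssp_pred W).
Lemma ssp_opp x : W x -> W (- x).
Proof. by move=> Wx; rewrite -[- x]addr0 -scaleN1r; apply: ssp_lin => //; exact: ssp_0. Qed.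
Lemma ssp_add x y : W x -> W y -> W (x + y).
Proof. by move=> Wx Wy; rewrite -[x]scale1r; apply: ssp_lin. Qed.
Lemma ssp_scale a x : W x -> W (a *: x).
Proof. by move=> Wx; rewrite -[_ *: _]addr0; apply: ssp_lin => //; exact: ssp_0. Qed.
Lemma ssp_sum (I : Type) (r : seq I) (F : I -> V) :
  (forall i, W (F i)) -> W (\sum_(i <- r) F i).
Proof. by move=> WF; apply: big_ind => //; [exact: ssp_0|exact: ssp_add]. Qed.
End Ssp.

Section RestrictLinear.
Variables (U V : lmodType k) (W : subspace U) (W' : subspace V).
Variables (f : {linear U -> V}) (fW : forall x, W x -> W' (f x)).
Definition ssp_restr_fun (x : ssp_sort W) : ssp_sort W' := ssp_sub (fW (ssp_valP x)).
Lemma ssp_restr_linear : linear ssp_restr_fun.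
Proof. by move=> a x y; apply: val_inj; rewrite /= !linearP. Qed.
Definition ssp_restr : {linear ssp_sort W -> ssp_sort W'} := linpack ssp_restr_linear.
End RestrictLinear.

Section BgSub.
Variables (A : bgvect k) (W : subspace A) (WP : forall d x, W x -> W (bg_proj A d x)).
Definition bgsub_proj d := ssp_restr (WP d).
Lemma bgsub_projK d e x :
  bgsub_proj d (bgsub_proj e x) = if d == e then bgsub_proj e x else 0.
Proof. by apply: val_inj; rewrite /= bg_projK; case: eqP. Qed.
Lemma bgsub_sum x : exists2 s : seq bideg, uniq s & x = \sum_(d <- s) bgsub_proj d x.
Proof.
exists (bg_supp (val x)); first exact: bg_supp_uniq.
by apply: val_inj; rewrite raddf_sum /= -bg_suppE.
Qed.
Definition bgsub := BgVect bgsub_projK bgsub_sum.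
End BgSub.

Section SmSum.
Variables M N : bgsmod k.
Section Act.
Variables (n : nat) (s : 'S_n).
Definition smsum_act_fun (x : bgsum (M n) (N n)) : bgsum (M n) (N n) :=
  (sm_act M s x.1, sm_act N s x.2).
Lemma smsum_act_linear : linear smsum_act_fun.
Proof. by move=> a x y; rewrite /smsum_act_fun /= !linearP. Qed.
Definition smsum_act := linpack smsum_act_linear.
End Act.
Lemma homog_pair (A B : bgvect k) d (x : bgsum A B) :
  homog d x <-> homog d x.1 /\ homog d x.2.
Proof.
by case: x => x y; rewrite /homog /= /bgsum_proj_fun /=; split=> [[-> ->]|[-> ->]].
Qed.
Lemma smsum_act_bideg n (s : 'S_n) : has_bideg 0 (smsum_act s).
Proof.
move=> d x /homog_pair[x1 x2]; apply/homog_pair.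
by split; exact: sm_act_bideg.
Qed.
Lemma smsum_act1 n (x : bgsum (M n) (N n)) : smsum_act 1%g x = x.
Proof. by case: x => x y; rewrite /= /smsum_act_fun /= !sm_act1. Qed.
Lemma smsum_actM n (s t : 'S_n) (x : bgsum (M n) (N n)) :
  smsum_act (s * t)%g x = smsum_act t (smsum_act s x).
Proof. by case: x => x y; rewrite /= /smsum_act_fun /= !sm_actM. Qed.
Definition smsum : bgsmod k := BgSMod smsum_act_bideg smsum_act1 smsum_actM.
End SmSum.

Section SmShift.
Variables (c : bideg) (M : bgsmod k).
Lemma smshift_act_bideg n (s : 'S_n) :
  @has_bideg _ (bgshift c (M n)) (bgshift c (M n)) 0 (sm_act M s).
Proof.
move=> d x; rewrite /homog /= addr0 => xd.
by have := sm_act_bideg s xd; rewrite addr0.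
Qed.
Definition smshift : bgsmod k :=
  BgSMod (sm_ar := fun n => bgshift c (M n))
    smshift_act_bideg (@sm_act1 _ M) (@sm_actM _ M).
End SmShift.

Section SmSub.
Variables (M : bgsmod k) (W : forall n, subspace (M n)).
Hypothesis WP : forall n d x, W n x -> W n (bg_proj (M n) d x).
Hypothesis Wact : forall n (s : 'S_n) x, W n x -> W n (sm_act M s x).
Definition smsub_act n (s : 'S_n) : {linear bgsub (@WP n) -> bgsub (@WP n)} :=
  ssp_restr (@Wact n s).
Lemma homog_sub (A : bgvect k) (S : subspace A) (SP : forall d x, S x -> S (bg_proj A d x))
  d (x : bgsub SP) : homog d x <-> homog d (val x : A).
Proof.
rewrite /homog /=; split=> [E|E]; first by rewrite -[in RHS]E.
exact: val_inj.
Qed.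
Lemma smsub_act_bideg n (s : 'S_n) : has_bideg 0 (smsub_act s).
Proof. by move=> d x /homog_sub xd; apply/homog_sub/sm_act_bideg. Qed.
Lemma smsub_act1 n (x : bgsub (@WP n)) : smsub_act 1%g x = x.
Proof. by apply: val_inj; rewrite /= sm_act1. Qed.
Lemma smsub_actM n (s t : 'S_n) (x : bgsub (@WP n)) :
  smsub_act (s * t)%g x = smsub_act t (smsub_act s x).
Proof. by apply: val_inj; rewrite /= sm_actM. Qed.
Definition smsub : bgsmod k := BgSMod smsub_act_bideg smsub_act1 smsub_actM.
End SmSub.

End Constructions.

(** * Free operads *)

Section PcompLinear.
Variables (k : fieldType) (Q : bgoperad k).
Variables (m n l : nat) (e : l.+1 = (m + n)%N) (i : 'I_m).
Implicit Types (x : Q m) (y : Q n).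

Lemma pcompDl x x' y : og_pcomp Q e i (x + x') y = og_pcomp Q e i x y + og_pcomp Q e i x' y.
Proof. by have := og_linearl e i y 1 x x'; rewrite !scale1r. Qed.
Lemma pcompDr x y y' : og_pcomp Q e i x (y + y') = og_pcomp Q e i x y + og_pcomp Q e i x y'.
Proof. by have := og_linearr e i x 1 y y'; rewrite !scale1r. Qed.
Lemma pcomp0l y : og_pcomp Q e i 0 y = 0.
Proof. by apply: (addIr (og_pcomp Q e i 0 y)); rewrite -pcompDl !add0r. Qed.
Lemma pcomp0r x : og_pcomp Q e i x 0 = 0.
Proof. by apply: (addIr (og_pcomp Q e i x 0)); rewrite -pcompDr !add0r. Qed.
Lemma pcompZl a x y : og_pcomp Q e i (a *: x) y = a *: og_pcomp Q e i x y.
Proof. by have := og_linearl e i y a x 0; rewrite !addr0 pcomp0l addr0. Qed.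
Lemma pcompZr a x y : og_pcomp Q e i x (a *: y) = a *: og_pcomp Q e i x y.
Proof. by have := og_linearr e i x a y 0; rewrite !addr0 pcomp0r addr0. Qed.
Lemma pcomp_suml (I : Type) (r : seq I) (F : I -> Q m) y :
  og_pcomp Q e i (\sum_(j <- r) F j) y = \sum_(j <- r) og_pcomp Q e i (F j) y.
Proof. by elim/big_rec2: _ => [|j a b _ <-]; rewrite ?pcomp0l ?pcompDl. Qed.
Lemma pcomp_sumr (I : Type) (r : seq I) x (F : I -> Q n) :
  og_pcomp Q e i x (\sum_(j <- r) F j) = \sum_(j <- r) og_pcomp Q e i x (F j).
Proof. by elim/big_rec2: _ => [|j a b _ <-]; rewrite ?pcomp0r ?pcompDr. Qed.
End PcompLinear.

(* The homogeneous spanning sets are enough for induction because the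
   generators, hence all composites of generators, are homogeneous. *)
Definition op_generated (k : fieldType) (M : bgsmod k) (Q : bgoperad k)
    (iota : smmorph M Q) : Prop :=
  forall S : forall n, Q n -> Prop,
  (forall n, S n 0) ->
  (forall n a (x y : Q n), S n x -> S n y -> S n (a *: x + y)) ->
  S 1%N (og_id Q) ->
  (forall n d (x : M n), homog d x -> S n (iota n x)) ->
  (forall n (s : 'S_n) (x : Q n), S n x -> S n (sm_act Q s x)) ->
  (forall m n l (e : l.+1 = (m + n)%N) (i : 'I_m) c d (x : Q m) (y : Q n),
     homog c x -> homog d y -> S m x -> S n y -> S l (og_pcomp Q e i x y)) ->
  forall n x, S n x.

Section Free.
Variables (k : fieldType) (M : bgsmod k).

(* [tm_gen d x] stands for the degree d component of x, so that every term is
   homogeneous. *)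
Inductive term : nat -> Type :=
| tm_id : term 1
| tm_gen n (d : bideg) (x : M n) : term n
| tm_act n (s : 'S_n) (t : term n) : term n
| tm_pcomp m n l (e : l.+1 = (m + n)%N) (i : 'I_m) (t : term m) (u : term n) : term l.

Fixpoint tm_deg n (t : term n) : bideg :=
  match t with
  | tm_id => 0
  | tm_gen _ d _ => d
  | tm_act _ _ t => tm_deg t
  | tm_pcomp _ _ _ _ _ t u => tm_deg t + tm_deg u
  end.

Fixpoint tm_eval (R : bgoperad k) (phi : smmorph M R) n (t : term n) : R n :=
  match t in term n return R n with
  | tm_id => og_id R
  | tm_gen n d x => phi n (bg_proj (M n) d x)
  | tm_act n s t => sm_act R s (tm_eval phi t)
  | tm_pcomp m n l e i t u => og_pcomp R e i (tm_eval phi t) (tm_eval phi u)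
  end.

Lemma tm_eval_homog (R : bgoperad k) (phi : smmorph M R) n (t : term n) :
  homog (tm_deg t) (tm_eval phi t).
Proof.
elim: {n} t => [|n d x|n s t IH|m n l e i t IHt u IHu] /=.
- exact: og_id_homog.
- by have := smm_bideg phi (proj_homog d x); rewrite addr0.
- by have := sm_act_bideg s IH; rewrite addr0.
- exact: og_pcomp_homog.
Qed.

Definition pre n := seq (k * term n).
HB.instance Definition _ n := gen_eqMixin (pre n).
HB.instance Definition _ n := gen_choiceMixin (pre n).

Definition pre_eval (R : bgoperad k) (phi : smmorph M R) n (p : pre n) : R n :=
  \sum_(at_ <- p) at_.1 *: tm_eval phi at_.2.

(* Two formal combinations are identified when they agree in every operad:
   every identity valid in all operads then holds in the quotient. *)
Definition pre_rel n : rel (pre n) := fun p q =>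
  `[< forall (R : bgoperad k) (phi : smmorph M R), pre_eval phi p = pre_eval phi q >].

Lemma pre_rel_refl n : reflexive (@pre_rel n).
Proof. by move=> p; exact/asboolP. Qed.
Lemma pre_rel_sym n : symmetric (@pre_rel n).
Proof. by move=> p q; apply/asboolP/asboolP => E R phi; rewrite E. Qed.
Lemma pre_rel_trans n : transitive (@pre_rel n).
Proof.
by move=> q p r /asboolP E /asboolP F; apply/asboolP => R phi; rewrite E F.
Qed.
Canonical pre_equiv n :=
  EquivRel (@pre_rel n) (@pre_rel_refl n) (@pre_rel_sym n) (@pre_rel_trans n).

(** The quantification over all operads in [pre_rel] takes place in [Prop], so the quotient is no
    larger than the formal combinations and the free operad is itself one of the operads quantified
    over. *)
Definition fr n := {eq_quot (@pre_rel n)}.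
HB.instance Definition _ n : EqQuotient _ (@pre_rel n) (fr n) := EqQuotient.on (fr n).
HB.instance Definition _ n := Choice.on (fr n).

Definition fr_mk n (p : pre n) : fr n := \pi_(fr n) p.

Definition fr_eval (R : bgoperad k) (phi : smmorph M R) n (x : fr n) : R n :=
  pre_eval phi (repr x).

Lemma fr_evalE (R : bgoperad k) (phi : smmorph M R) n (p : pre n) :
  fr_eval phi (fr_mk p) = pre_eval phi p.
Proof.
rewrite /fr_eval /fr_mk.
have /eqmodP/asboolP-> // : repr (\pi_(fr n) p) = p %[mod fr n] by rewrite reprK.
Qed.

Lemma fr_ext n (x y : fr n) :
  (forall (R : bgoperad k) (phi : smmorph M R), fr_eval phi x = fr_eval phi y) -> x = y.
Proof.
by move=> E; rewrite -[x]reprK -[y]reprK; apply/eqmodP/asboolP.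
Qed.

Definition fr_zero n : fr n := fr_mk [::].
Definition fr_scale n a (x : fr n) : fr n :=
  fr_mk [seq (a * at_.1, at_.2) | at_ <- (repr x : seq _)].
Definition fr_opp n (x : fr n) : fr n := fr_scale (-1) x.
Definition fr_add n (x y : fr n) : fr n :=
  fr_mk ((repr x : seq _) ++ (repr y : seq _)).

Section Eval.
Variables (R : bgoperad k) (phi : smmorph M R).
Lemma fr_eval_zero n : fr_eval phi (fr_zero n) = 0.
Proof. by rewrite fr_evalE /pre_eval big_nil. Qed.
Lemma fr_eval_scale n a (x : fr n) : fr_eval phi (fr_scale a x) = a *: fr_eval phi x.
Proof.
rewrite fr_evalE /pre_eval big_map scaler_sumr.
by apply: eq_bigr => at_ _; rewrite scalerA.
Qed.
Lemma fr_eval_opp n (x : fr n) : fr_eval phi (fr_opp x) = - fr_eval phi x.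
Proof. by rewrite fr_eval_scale scaleN1r. Qed.
Lemma fr_eval_add n (x y : fr n) :
  fr_eval phi (fr_add x y) = fr_eval phi x + fr_eval phi y.
Proof. by rewrite fr_evalE /pre_eval big_cat. Qed.
End Eval.

Lemma fr_addA n : associative (@fr_add n).
Proof. by move=> x y z; apply: fr_ext => R phi; rewrite !fr_eval_add addrA. Qed.
Lemma fr_addC n : commutative (@fr_add n).
Proof. by move=> x y; apply: fr_ext => R phi; rewrite !fr_eval_add addrC. Qed.
Lemma fr_add0 n : left_id (fr_zero n) (@fr_add n).
Proof. by move=> x; apply: fr_ext => R phi; rewrite fr_eval_add fr_eval_zero add0r. Qed.
Lemma fr_addN n : left_inverse (fr_zero n) (@fr_opp n) (@fr_add n).
Proof.
by move=> x; apply: fr_ext => R phi; rewrite fr_eval_add fr_eval_zero fr_eval_opp addNr.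
Qed.
HB.instance Definition _ n := GRing.isZmodule.Build (fr n)
  (@fr_addA n) (@fr_addC n) (@fr_add0 n) (@fr_addN n).

Lemma fr_scaleA n a b (x : fr n) : fr_scale a (fr_scale b x) = fr_scale (a * b) x.
Proof. by apply: fr_ext => R phi; rewrite !fr_eval_scale scalerA. Qed.
Lemma fr_scale1 n : left_id 1 (@fr_scale n).
Proof. by move=> x; apply: fr_ext => R phi; rewrite fr_eval_scale scale1r. Qed.
Lemma fr_scaleDr n : right_distributive (@fr_scale n) +%R.
Proof.
by move=> a x y; apply: fr_ext => R phi;
  rewrite fr_eval_scale !fr_eval_add !fr_eval_scale scalerDr.
Qed.
Lemma fr_scaleDl n (x : fr n) : {morph (@fr_scale n)^~ x : a b / a + b}.
Proof.
by move=> a b; apply: fr_ext => R phi;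
  rewrite fr_eval_scale fr_eval_add !fr_eval_scale scalerDl.
Qed.
HB.instance Definition _ n := GRing.Zmodule_isLmodule.Build k (fr n)
  (@fr_scaleA n) (@fr_scale1 n) (@fr_scaleDr n) (@fr_scaleDl n).

Lemma fr_eval_linear (R : bgoperad k) (phi : smmorph M R) n :
  linear (@fr_eval R phi n).
Proof. by move=> a x y; rewrite fr_eval_add fr_eval_scale. Qed.
Definition fr_evalL (R : bgoperad k) (phi : smmorph M R) n : {linear fr n -> R n} :=
  linpack (@fr_eval_linear R phi n).

Definition fr_proj_fun n d (x : fr n) : fr n :=
  fr_mk [seq at_ <- (repr x : seq _) | tm_deg at_.2 == d].
(** Every term evaluates to a homogeneous element of its formal degree, so selecting terms by
    [tm_deg] computes the projection in every operad at once. *)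
Lemma fr_eval_proj (R : bgoperad k) (phi : smmorph M R) n d (x : fr n) :
  fr_eval phi (fr_proj_fun d x) = bg_proj (R n) d (fr_eval phi x).
Proof.
rewrite fr_evalE /fr_eval /pre_eval big_filter big_mkcond linear_sum.
apply: eq_bigr => at_ _; rewrite linearZ /=.
rewrite (proj_homogE _ (tm_eval_homog phi at_.2)) eq_sym.
by case: eqP => // _; rewrite scaler0.
Qed.
Lemma fr_proj_linear n d : linear (@fr_proj_fun n d).
Proof.
move=> a x y; apply: fr_ext => R phi.
by rewrite fr_eval_proj !fr_eval_linear !fr_eval_proj linearP.
Qed.
Definition fr_proj n d : {linear fr n -> fr n} := linpack (@fr_proj_linear n d).
Lemma fr_projK n d e (x : fr n) :
  fr_proj n d (fr_proj n e x) = if d == e then fr_proj n e x else 0.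
Proof.
apply: fr_ext => R phi; rewrite /= !fr_eval_proj bg_projK.
by case: eqP => _; rewrite ?fr_eval_proj //; exact: esym (linear0 (fr_evalL phi n)).
Qed.
Lemma fr_sum n (x : fr n) :
  exists2 s : seq bideg, uniq s & x = \sum_(d <- s) fr_proj n d x.
Proof.
pose s := undup [seq tm_deg at_.2 | at_ <- (repr x : seq (k * term n))].
exists s; first exact: undup_uniq.
apply: fr_ext => R phi.
rewrite [RHS](linear_sum (fr_evalL phi n)) /=.
rewrite [LHS](@bg_sum_in _ _ s) ?undup_uniq //.
  by apply: eq_bigr => d _; rewrite fr_eval_proj.
move=> d; rewrite mem_undup /fr_eval /pre_eval; elim: (repr x : seq _) => [|at_ p IH].
  by rewrite big_nil linear0.
rewrite inE negb_or => /andP[dt dp]; rewrite big_cons linearD /= IH // addr0.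
by rewrite linearZ /= (proj_homogE _ (tm_eval_homog phi at_.2)) (negbTE dt) scaler0.
Qed.
Definition fr_bg n : bgvect k := BgVect (@fr_projK n) (@fr_sum n).

Lemma fr_eval_homog (R : bgoperad k) (phi : smmorph M R) n d (x : fr_bg n) :
  homog d x -> homog d (fr_eval phi x).
Proof. by move=> xd; rewrite /homog -fr_eval_proj [fr_proj_fun d x]xd. Qed.
Lemma fr_homog_ext n d (x : fr_bg n) :
  (forall (R : bgoperad k) (phi : smmorph M R), homog d (fr_eval phi x)) -> homog d x.
Proof. by move=> H; apply: fr_ext => R phi; rewrite [LHS]fr_eval_proj H. Qed.

Definition fr_act_fun n (s : 'S_n) (x : fr_bg n) : fr_bg n :=
  fr_mk [seq (at_.1, tm_act s at_.2) | at_ <- (repr x : seq _)].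
Lemma fr_eval_act (R : bgoperad k) (phi : smmorph M R) n (s : 'S_n) (x : fr n) :
  fr_eval phi (fr_act_fun s x) = sm_act R s (fr_eval phi x).
Proof.
rewrite fr_evalE /fr_eval /pre_eval big_map linear_sum.
by apply: eq_bigr => at_ _; rewrite linearZ.
Qed.
Lemma fr_act_linear n (s : 'S_n) : linear (fr_act_fun s).
Proof.
move=> a x y; apply: fr_ext => R phi.
by rewrite fr_eval_act !fr_eval_linear !fr_eval_act linearP.
Qed.
Definition fr_act n (s : 'S_n) : {linear fr_bg n -> fr_bg n} := linpack (fr_act_linear s).
Lemma fr_act_bideg n (s : 'S_n) : has_bideg 0 (fr_act s).
Proof.
move=> d x xd; apply: fr_homog_ext => R phi; rewrite /= fr_eval_act.
exact/sm_act_bideg/fr_eval_homog.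
Qed.
Lemma fr_act1 n (x : fr_bg n) : fr_act 1%g x = x.
Proof. by apply: fr_ext => R phi; rewrite /= fr_eval_act sm_act1. Qed.
Lemma fr_actM n (s t : 'S_n) (x : fr_bg n) : fr_act (s * t)%g x = fr_act t (fr_act s x).
Proof. by apply: fr_ext => R phi; rewrite /= !fr_eval_act sm_actM. Qed.
Definition fr_sm : bgsmod k := BgSMod fr_act_bideg fr_act1 fr_actM.

Definition fr_id : fr_sm 1%N := fr_mk [:: (1, tm_id)].
Lemma fr_eval_id (R : bgoperad k) (phi : smmorph M R) : fr_eval phi fr_id = og_id R.
Proof. by rewrite fr_evalE /pre_eval big_seq1 scale1r. Qed.

Definition fr_pcomp m n l (e : l.+1 = (m + n)%N) (i : 'I_m) (x : fr_sm m) (y : fr_sm n) :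
  fr_sm l := fr_mk [seq (at_.1 * bu.1, tm_pcomp e i at_.2 bu.2) |
    at_ <- (repr x : seq _), bu <- (repr y : seq _)].
Lemma fr_eval_pcomp (R : bgoperad k) (phi : smmorph M R) m n l (e : l.+1 = (m + n)%N)
    (i : 'I_m) (x : fr_sm m) (y : fr_sm n) :
  fr_eval phi (fr_pcomp e i x y) = og_pcomp R e i (fr_eval phi x) (fr_eval phi y).
Proof.
rewrite fr_evalE /fr_eval /pre_eval big_allpairs_dep pcomp_suml.
apply: eq_bigr => at_ _; rewrite pcomp_sumr; apply: eq_bigr => bu _.
by rewrite pcompZl pcompZr scalerA.
Qed.

Definition fr_evalS := (fr_eval_pcomp, fr_eval_act, fr_eval_linear, fr_eval_id).

Lemma fr_linearl m n l (e : l.+1 = (m + n)%N) (i : 'I_m) (y : fr_sm n) :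
  linear (fun x => fr_pcomp e i x y).
Proof. by move=> a x x'; apply: fr_ext => R phi; rewrite !fr_evalS pcompDl pcompZl. Qed.
Lemma fr_linearr m n l (e : l.+1 = (m + n)%N) (i : 'I_m) (x : fr_sm m) :
  linear (fr_pcomp e i x).
Proof. by move=> a y y'; apply: fr_ext => R phi; rewrite !fr_evalS pcompDr pcompZr. Qed.
Lemma fr_id_homog : homog 0 fr_id.
Proof. by apply: fr_homog_ext => R phi; rewrite fr_eval_id; exact: og_id_homog. Qed.
Lemma fr_pcomp_homog m n l (e : l.+1 = (m + n)%N) (i : 'I_m) c d (x : fr_sm m) (y : fr_sm n) :
  homog c x -> homog d y -> homog (c + d) (fr_pcomp e i x y).
Proof.
move=> xc yd; apply: fr_homog_ext => R phi; rewrite fr_eval_pcomp.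
by apply: og_pcomp_homog; exact: fr_eval_homog.
Qed.
Lemma fr_idl n (e : n.+1 = (1 + n)%N) (i : 'I_1) (y : fr_sm n) : fr_pcomp e i fr_id y = y.
Proof. by apply: fr_ext => R phi; rewrite !fr_evalS og_idl. Qed.
Lemma fr_idr m (e : m.+1 = (m + 1)%N) (i : 'I_m) (x : fr_sm m) : fr_pcomp e i x fr_id = x.
Proof. by apply: fr_ext => R phi; rewrite !fr_evalS og_idr. Qed.

Definition free_operad : bgoperad k.
Proof.
apply: (@BgOperad k fr_sm fr_id fr_pcomp fr_linearl fr_linearr fr_id_homog
  fr_pcomp_homog fr_idl fr_idr).
- move=> m n p mn np l e e' g g' i j ij ijE x y z; apply: fr_ext => R phi.
  by rewrite !fr_evalS (og_seq e e' g g' ijE).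
- move=> m n p mn mp l e e' g g' i h i' h' ih h'E i'E c d x y z yc zd.
  apply: fr_ext => R phi.
  rewrite !fr_evalS fr_eval_scale !fr_evalS.
  apply: (og_par e e' g g' ih h'E i'E); exact: fr_eval_homog.
- move=> m n l e i s t r rE x y; apply: fr_ext => R phi.
  by rewrite !fr_evalS (og_equiv e rE).
Defined.

Definition fr_gen_fun n (x : M n) : free_operad n :=
  fr_mk [seq (1, tm_gen d x) | d <- bg_supp x].
Lemma fr_eval_gen (R : bgoperad k) (phi : smmorph M R) n (x : M n) :
  fr_eval phi (fr_gen_fun x) = phi n x.
Proof.
rewrite fr_evalE /pre_eval big_map [in RHS](bg_suppE x) linear_sum.
by apply: eq_bigr => d _; rewrite scale1r.
Qed.
Lemma fr_gen_linear n : linear (@fr_gen_fun n).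
Proof.
by move=> a x y; apply: fr_ext => R phi; rewrite fr_eval_linear !fr_eval_gen linearP.
Qed.
Definition fr_gen n : {linear M n -> free_operad n} := linpack (@fr_gen_linear n).
Lemma fr_gen_bideg n : has_bideg 0 (fr_gen n).
Proof.
move=> d x xd; apply: fr_homog_ext => R phi; rewrite /= fr_eval_gen.
exact: smm_bideg.
Qed.
Lemma fr_gen_act n (s : 'S_n) (x : M n) :
  fr_gen n (sm_act M s x) = sm_act free_operad s (fr_gen n x).
Proof. by apply: fr_ext => R phi; rewrite /= fr_eval_act !fr_eval_gen smm_act. Qed.
Definition free_iota : smmorph M free_operad := SmMorph fr_gen_bideg fr_gen_act.

Section Eval2.
Variables (R : bgoperad k) (phi : smmorph M R).
Lemma fr_evalL_bideg n :
  @has_bideg _ (free_operad n) (R n) 0 (fr_evalL phi n).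
Proof. by move=> d x xd; rewrite addr0; exact: fr_eval_homog. Qed.
Definition fr_eval_sm : smmorph free_operad R :=
  SmMorph (N := R) fr_evalL_bideg (fun n s x => fr_eval_act phi s x).
Definition fr_eval_op : bgopmorph free_operad R :=
  @BgOpMorph k free_operad R fr_eval_sm (fr_eval_id phi)
   (fun m n l e i x y => fr_eval_pcomp phi e i x y).
End Eval2.

(** Turns an abstract class into an actual linear combination inside the free operad, on whose terms
    one can argue by induction. Only the evaluations of [tau] matter, by [fr_ext]. *)
Lemma fr_mkE n (p : pre n) (tau : forall n, term n -> free_operad n) :
  (forall n (t : term n) (R : bgoperad k) (phi : smmorph M R),
    fr_eval phi (tau n t) = tm_eval phi t) ->
  fr_mk p = \sum_(at_ <- p) at_.1 *: tau n at_.2.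
Proof.
move=> tauE; apply: fr_ext => R phi; rewrite fr_evalE.
rewrite [RHS](linear_sum (fr_evalL phi n)); apply: eq_bigr => at_ _.
by rewrite -tauE; exact: esym (fr_eval_scale phi _ _).
Qed.

Fixpoint fr_of_term n (t : term n) : free_operad n :=
  match t in term n return free_operad n with
  | tm_id => og_id free_operad
  | tm_gen n d x => free_iota n (bg_proj (M n) d x)
  | tm_act n s t => sm_act free_operad s (fr_of_term t)
  | tm_pcomp m n l e i t u => og_pcomp free_operad e i (fr_of_term t) (fr_of_term u)
  end.

Lemma fr_of_termE n (t : term n) (R : bgoperad k) (phi : smmorph M R) :
  fr_eval phi (fr_of_term t) = tm_eval phi t.
Proof.
elim: {n} t => [|n d x|n s t IH|m n l e i t IHt u IHu] /=.
- exact: fr_eval_id.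
- exact: fr_eval_gen.
- by rewrite fr_eval_act IH.
- by rewrite fr_eval_pcomp IHt IHu.
Qed.

Lemma free_generated : op_generated free_iota.
Proof.
move=> S S0 SL Sid Sgen Sact Spc n x.
have Sterm m (t : term m) : S m (fr_of_term t).
  elim: {m} t => [|m d y|m s t IH|m1 m2 l e i t IHt u IHu] //=.
  - exact/(Sgen _ d)/proj_homog.
  - exact: Sact.
  - apply: (Spc _ _ _ _ _ (tm_deg t) (tm_deg u)) => //;
      by apply: fr_homog_ext => R phi; rewrite fr_of_termE; exact: tm_eval_homog.
rewrite -[x]reprK -[\pi_ _ _]/(fr_mk _) (fr_mkE _ fr_of_termE).
by elim/big_rec: _ => // at_ y _ Sy; exact: SL.
Qed.

End Free.

Lemma generated_uniq (k : fieldType) (M : bgsmod k) (Q R : bgoperad k)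
    (iota : smmorph M Q) (f g : bgopmorph Q R) : op_generated iota ->
  (forall n x, f n (iota n x) = g n (iota n x)) -> forall n y, f n y = g n y.
Proof.
move=> gen E; apply: gen => //.
- by move=> n; rewrite !linear0.
- by move=> n a x y Ex Ey; rewrite !linearP Ex Ey.
- by rewrite !bom_id.
- by move=> n s x Ex; rewrite !smm_act Ex.
- by move=> m n l e i c d x y _ _ Ex Ey; rewrite !bom_pcomp Ex Ey.
Qed.

Lemma free_is_free (k : fieldType) (M : bgsmod k) : is_free (free_iota M).
Proof.
move=> R phi; split.
  by exists (fr_eval_op phi) => n x; exact: fr_eval_gen.
move=> f g fE gE; apply: (generated_uniq (@free_generated k M)) => n x.
by rewrite fE gE.
Qed.

(** * Derivations *)

Section Sign.
Variable k : fieldType.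

Lemma ksignD a b : ksign k (a + b) = ksign k a * ksign k b.
Proof. by rewrite /ksign expfzDr // oppr_eq0 oner_eq0. Qed.
Lemma ksign0 : ksign k 0 = 1.
Proof. by rewrite /ksign expr0z. Qed.
Lemma ksign1 : ksign k 1 = -1.
Proof. by rewrite /ksign expr1z. Qed.
Lemma ksign_sq a : ksign k a * ksign k a = 1.
Proof. by rewrite /ksign -expfzMl mulrNN mulr1 exp1rz. Qed.

Lemma totdegD c d : totdeg (c + d) = totdeg c + totdeg d.
Proof. by rewrite /totdeg /= addrACA. Qed.

(** The Koszul sign is made into a linear operator, so that the Leibniz rule and the composition of
    dual numbers can be stated for arbitrary elements. *)
Definition sgn_part (A : bgvect k) (d : bideg) : {linear A -> A} :=
  ksign k (totdeg d) \*: idfun.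

(* Locked, so that simplification does not expand the sum. *)
Definition sgn (A : bgvect k) : {linear A -> A} :=
  locked (linpack (bg_gsum_linear (@sgn_part A))).

Lemma sgn_homog (A : bgvect k) d (x : A) : homog d x -> sgn A x = ksign k (totdeg d) *: x.
Proof. by rewrite /sgn -lock; exact: bg_gsum_homog. Qed.

Lemma sgn_bideg (A : bgvect k) d (x : A) : homog d x -> homog d (sgn A x).
Proof. by move=> xd; rewrite (sgn_homog xd); exact: homogZ. Qed.

Lemma sgn_bideg_map (A B : bgvect k) c (f : {linear A -> B}) : has_bideg c f ->
  forall x, sgn B (f x) = ksign k (totdeg c) *: f (sgn A x).
Proof.
move=> fc; apply: bg_ind; first by rewrite !linear0.
  by move=> x y Ex Ey; rewrite (linearD f) (linearD (sgn B)) Ex Ey (linearD (sgn A)) (linearD f) scalerDr.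
move=> d x xd; rewrite (sgn_homog xd) (sgn_homog (fc _ _ xd)) linearZ scalerA.
by rewrite totdegD ksignD mulrC.
Qed.

Variable Q : bgoperad k.
Lemma sgn_id : sgn (Q 1%N) (og_id Q) = og_id Q.
Proof. by rewrite (sgn_homog (og_id_homog Q)) ksign0 scale1r. Qed.

Lemma sgn_act n (s : 'S_n) x : sgn (Q n) (sm_act Q s x) = sm_act Q s (sgn (Q n) x).
Proof. by rewrite (sgn_bideg_map (sm_act_bideg s)) ksign0 scale1r. Qed.

Lemma bg_ind2 (A B : bgvect k) (S : A -> B -> Prop) :
  (forall y, S 0 y) -> (forall x, S x 0) ->
  (forall x x' y, S x y -> S x' y -> S (x + x') y) ->
  (forall x y y', S x y -> S x y' -> S x (y + y')) ->
  (forall c d x y, homog c x -> homog d y -> S x y) -> forall x y, S x y.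
Proof.
move=> S0l S0r SDl SDr Sh x y; elim/(@bg_ind _ A): x => // [x x'|c x xc]; first exact: SDl.
elim/(@bg_ind _ B): y => // [y y'|d y yd]; first exact: SDr.
exact: Sh xc yd.
Qed.

Lemma sgn_pcomp m n l (e : l.+1 = (m + n)%N) (i : 'I_m) (x : Q m) (y : Q n) :
  sgn (Q l) (og_pcomp Q e i x y) = og_pcomp Q e i (sgn (Q m) x) (sgn (Q n) y).
Proof.
move: x y; apply: (@bg_ind2 (Q m) (Q n)).
- by move=> y; rewrite linear0 !pcomp0l linear0.
- by move=> x; rewrite linear0 !pcomp0r linear0.
- by move=> x x' y E E'; rewrite linearD !pcompDl linearD E E'.
- by move=> x y y' E E'; rewrite linearD !pcompDr linearD E E'.
move=> c d x y xc yd.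
rewrite (sgn_homog xc) (sgn_homog yd) (sgn_homog (og_pcomp_homog e i xc yd)).
by rewrite pcompZl pcompZr scalerA totdegD ksignD.
Qed.
End Sign.

Section Dual.
Variables (k : fieldType) (kap : bideg) (kap1 : totdeg kap = 1) (Q : bgoperad k).

(** The shift is chosen so that $q\mapsto(q,\delta q)$ has bidegree zero exactly when $\delta$ has
    bidegree [kap]. *)
Definition dual_sm : bgsmod k := smsum Q (smshift kap Q).

Definition dual_id : dual_sm 1%N := (og_id Q, 0).
Definition dual_pcomp m n l (e : l.+1 = (m + n)%N) (i : 'I_m)
  (x : dual_sm m) (y : dual_sm n) : dual_sm l :=
  (og_pcomp Q e i x.1 y.1,
   og_pcomp Q e i x.2 y.1 + og_pcomp Q e i (sgn (Q m) x.1) y.2).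

Lemma homog_dual n d (x : dual_sm n) :
  homog d x <-> homog d (x.1 : Q n) /\ homog (d + kap) (x.2 : Q n).
Proof. exact: homog_pair. Qed.

Lemma dual_eq n (x y : dual_sm n) :
  x.1 = y.1 :> Q n -> x.2 = y.2 :> Q n -> x = y.
Proof. by case: x y => [x x'] [y y'] /= -> ->. Qed.

(* The operad Q (x) k[eps] with eps odd and of square zero: a degree 0 morphism
   into it extending the identity of Q is an odd derivation of Q. *)
Definition dual_operad : bgoperad k.
Proof.
apply: (@BgOperad k dual_sm dual_id dual_pcomp).
- move=> m n l e i y a x x'; apply: dual_eq; rewrite /= ?pcompDl ?pcompZl //.
  rewrite linearP !pcompDl !pcompZl scalerDr; exact: addrACA.
- move=> m n l e i x a y y'; apply: dual_eq; rewrite /= ?pcompDr ?pcompZr //.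
  rewrite !scalerDr; exact: addrACA.
- by apply/homog_dual; split; [exact: og_id_homog|exact: homog0].
- move=> m n l e i c d x y /homog_dual[x1 x2] /homog_dual[y1 y2].
  apply/homog_dual; split; first exact: og_pcomp_homog.
  apply: homogD; first by rewrite addrAC; exact: og_pcomp_homog.
  rewrite -addrA; apply: og_pcomp_homog => //; exact: sgn_bideg.
- move=> n e i y; apply: dual_eq; rewrite /= ?og_idl //.
  by rewrite pcomp0l add0r sgn_id og_idl.
- move=> m e i x; apply: dual_eq; rewrite /= ?og_idr //.
  by rewrite pcomp0r addr0.
- move=> m n p mn np l e e' g g' i j ij ijE x y z.
  apply: dual_eq; rewrite /= ?(og_seq e e' g g' ijE) //.
  rewrite pcompDl pcompDr addrA sgn_pcomp !(og_seq e e' g g' ijE).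
  by [].
- move=> m n p mn mp l e e' g g' i h i' h' ih h'E i'E c d x y z.
  move=> /homog_dual[y1 y2] /homog_dual[z1 z2].
  have P := @og_par k Q _ _ _ _ _ _ e e' g g' _ _ _ _ ih h'E i'E.
  apply: dual_eq => /=; first exact: P.
  rewrite pcompDl sgn_pcomp (P c d) // (P _ _ _ _ _ y2 z1) (P _ _ _ _ _ (sgn_bideg y1) z2).
  rewrite sgn_pcomp pcompDl !scalerDr -!addrA; congr (_ + _).
  rewrite addrC (sgn_homog y1) (sgn_homog z1) !pcompZr !pcompZl !scalerA.
  (* As [kap] has total degree one, shifting one factor changes the Koszul exponent by the degree of
     the other, which is the sign that [sgn] contributes. *)
  have -> : totdeg c * totdeg (d + kap) = totdeg c * totdeg d + totdeg c.
    by rewrite totdegD kap1 mulrDr mulr1.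
  have -> : totdeg (c + kap) * totdeg d = totdeg c * totdeg d + totdeg d.
    by rewrite totdegD kap1 mulrDl mul1r.
  rewrite (ksignD _ _ (totdeg c)) (ksignD _ _ (totdeg d)).
  by rewrite -mulrA ksign_sq mulr1.
- move=> m n l e i s t r rE x y; apply: dual_eq; rewrite /= ?(og_equiv e rE) //.
  by rewrite linearD /= !(og_equiv e rE) sgn_act.
Defined.

Record is_deriv (del : forall n, {linear Q n -> Q n}) : Prop := IsDeriv {
  dv_bideg : forall n, has_bideg kap (del n);
  dv_act : forall n (s : 'S_n) x, del n (sm_act Q s x) = sm_act Q s (del n x);
  dv_id : del 1%N (og_id Q) = 0;
  dv_pcomp : forall m n l (e : l.+1 = (m + n)%N) (i : 'I_m) (x : Q m) (y : Q n),
    del l (og_pcomp Q e i x y) =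
    og_pcomp Q e i (del m x) y + og_pcomp Q e i (sgn (Q m) x) (del n y) }.

Lemma deriv_leibniz (del : forall n, {linear Q n -> Q n}) : is_deriv del ->
  forall (m n l : nat) (e : l.+1 = (m + n)%N) (i : 'I_m)
    (d : bideg) (x : Q m) (y : Q n), homog d x ->
    del l (og_pcomp Q e i x y) = og_pcomp Q e i (del m x) y
      + ksign k (totdeg d) *: og_pcomp Q e i x (del n y).
Proof.
move=> D m n l e i d x y xd.
by rewrite (dv_pcomp D) (sgn_homog xd) pcompZl.
Qed.

Lemma leibniz_deriv (del : forall n, {linear Q n -> Q n}) :
  (forall n, has_bideg kap (del n)) ->
  (forall n (s : 'S_n) x, del n (sm_act Q s x) = sm_act Q s (del n x)) ->
  del 1%N (og_id Q) = 0 ->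
  (forall (m n l : nat) (e : l.+1 = (m + n)%N) (i : 'I_m)
    (d : bideg) (x : Q m) (y : Q n), homog d x ->
    del l (og_pcomp Q e i x y) = og_pcomp Q e i (del m x) y
      + ksign k (totdeg d) *: og_pcomp Q e i x (del n y)) -> is_deriv del.
Proof.
move=> H1 H2 H3 L; split=> // m n l e i x y; move: x; apply: (@bg_ind _ (Q m)).
- by rewrite pcomp0l !linear0 !pcomp0l addr0.
- by move=> x x' E E'; rewrite !linearD /= !pcompDl linearD /= E E' addrACA.
- by move=> d x xd; rewrite (L _ _ _ _ _ _ _ _ xd) (sgn_homog xd) pcompZl.
Qed.

Section Extend.
Variables (M : bgsmod k) (iota : smmorph M Q).
Hypotheses (Qfree : is_free iota) (Qgen : op_generated iota).
Variable del0 : forall n, {linear M n -> Q n}.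
Hypothesis del0_bideg : forall n, has_bideg kap (del0 n).
Hypothesis del0_act : forall n (s : 'S_n) x, del0 n (sm_act M s x) = sm_act Q s (del0 n x).

(** The morphism to dual numbers extending $x\mapsto(\iota x,\delta_0x)$ has a first component that
    fixes the generators, hence is the identity; compatibility with composition is then the Leibniz
    rule for the second component. *)
Lemma deriv_extend : exists del, is_deriv del /\ forall n x, del n (iota n x) = del0 n x.
Proof.
pose f n (x : M n) : dual_operad n := (iota n x, del0 n x).
have fL n : linear (f n).
  by move=> a x y; apply: dual_eq; rewrite /= linearP.
have fB n : has_bideg 0 (linpack (fL n)).
  move=> d x xd; apply/homog_dual; split; first exact: smm_bideg.
  by rewrite addr0; exact: del0_bideg.
have fA n (s : 'S_n) x : linpack (fL n) (sm_act M s x) =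
    sm_act dual_operad s (linpack (fL n) x).
  by apply: dual_eq; rewrite /= ?smm_act ?del0_act.
have [[F FE] _] := Qfree (SmMorph fB fA).
have F1 n y : (F n y).1 = y :> Q n.
  move: n y; apply: Qgen.
  - by move=> n; rewrite linear0.
  - by move=> n a x y Ex Ey; rewrite linearP /= Ex Ey.
  - by rewrite bom_id.
  - by move=> n d x _; rewrite FE.
  - by move=> n s x Ex; rewrite smm_act /= Ex.
  - by move=> m n l e i c d x y _ _ Ex Ey; rewrite bom_pcomp /= Ex Ey.
pose del n (y : Q n) : Q n := (F n y).2.
have delL n : linear (del n) by move=> a x y; rewrite /del linearP.
exists (fun n => linpack (delL n)); split; last by move=> n x; rewrite /= /del FE.
split.
- move=> n d x xd; have /homog_dual[_] := smm_bideg F xd.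
  by rewrite addr0.
- by move=> n s x; rewrite /= /del smm_act.
- by rewrite /= /del bom_id.
- by move=> m n l e i x y; rewrite /= /del bom_pcomp /= !F1.
Qed.
End Extend.
End Dual.

(** * Square-zero extensions *)

Section SquareZero.
Variables (k : fieldType) (Q : bgoperad k) (E : bgsmod k).
Hypotheses (Q0 : is_zero (Q 0%N)) (Q1 : unit_arity1 Q).

Definition aug1 (x : Q 1%N) : k := sval (cid (Q1 x)).
Lemma aug1E x : x = aug1 x *: og_id Q.
Proof. by rewrite /aug1; case: cid => a /= []. Qed.
Lemma aug1_uniq x a : x = a *: og_id Q -> aug1 x = a.
Proof. by rewrite /aug1; case: cid => b /= [_ H] /H. Qed.

(** The augmentation $Q\to\mathrm I$, with the value of $\mathrm I$ outside arity one encoded as the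
    scalar zero. *)
Definition aug n : Q n -> k :=
  match n return Q n -> k with 1%N => aug1 | _ => fun=> 0 end.

Lemma aug_lin n a (x y : Q n) : aug (a *: x + y) = a * aug x + aug y.
Proof.
case: n x y => [|[|n]] x y /=; rewrite ?mulr0 ?addr0 //.
by apply: aug1_uniq; rewrite {1}[x]aug1E {1}[y]aug1E scalerA scalerDl.
Qed.
Lemma aug_id : aug (og_id Q) = 1.
Proof. by apply: aug1_uniq; rewrite scale1r. Qed.
Lemma aug0 n : aug (0 : Q n) = 0.
Proof. by case: n => [|[|n]] //=; apply: aug1_uniq; rewrite scale0r. Qed.
Lemma augZ n a (x : Q n) : aug (a *: x) = a * aug x.
Proof. by rewrite -[a *: x]addr0 aug_lin aug0 addr0. Qed.
Lemma aug_ne0 n (x : Q n) : aug x != 0 -> n = 1%N.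
Proof. by case: n x => [|[|n]] x //=; rewrite eqxx. Qed.
Lemma augE (x : Q 1%N) : x = aug x *: og_id Q.
Proof. exact: aug1E. Qed.
Lemma aug_homog n d (x : Q n) : homog d x -> aug x != 0 -> d = 0.
Proof.
move=> xd a0; move: (aug_ne0 a0) => n1; subst n.
have := proj_homogE 0 xd; rewrite {1}[x]augE linearZ /= (og_id_homog Q) -augE.
case: eqP => // _ x0; move: a0; by rewrite x0 aug0 eqxx.
Qed.
Lemma aug_act n (s : 'S_n) (x : Q n) : aug (sm_act Q s x) = aug x.
Proof.
case: n s x => [|[|n]] s x //.
have -> : s = 1%g by apply/permP => j; rewrite !ord1.
by rewrite sm_act1.
Qed.
(** If the outer factor has arity at least two, the composite has arity one only when the inner
    factor has arity zero, where $Q$ vanishes. *)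
Lemma aug_pcomp m n l (e : l.+1 = (m + n)%N) (i : 'I_m) (x : Q m) (y : Q n) :
  aug (og_pcomp Q e i x y) = aug x * aug y.
Proof.
case: m e i x => [|[|m]] e i x; first by case: i.
  have ln : l = n by lia.
  subst l; rewrite {1}[x]augE pcompZl og_idl augZ; congr (_ * _).
rewrite [aug x]/= mul0r.
case: n e y => [|n] e y; first by rewrite (Q0 y) pcomp0r aug0.
by case: l e => [|[|l]] e //; lia.
Qed.

(** Composing with a multiple of the identity preserves the arity, but only up to an equation
    between types. The default value zero makes the transport total, and linear and homogeneous for
    all arities. *)
Definition arcast m l (x : E m) : E l :=
  if m =P l is ReflectT h then eq_rect m (fun j => E j : Type) x l h else 0.
Lemma arcast_id m (x : E m) : arcast m x = x.
Proof. by rewrite /arcast; case: eqP => // h; rewrite eq_axiomK. Qed.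
Lemma arcast_lin m l a (x y : E m) : arcast l (a *: x + y) = a *: arcast l x + arcast l y.
Proof.
have [ml|ml] := eqVneq m l; first by subst l; rewrite !arcast_id.
rewrite /arcast; case: eqP => [h|_]; first by rewrite h eqxx in ml.
by rewrite scaler0 addr0.
Qed.
Lemma arcast0 m l : arcast l (0 : E m) = 0.
Proof.
have [ml|ml] := eqVneq m l; first by subst l; rewrite arcast_id.
by rewrite /arcast; case: eqP => // h; rewrite h eqxx in ml.
Qed.
Lemma arcastZ m l a (x : E m) : arcast l (a *: x) = a *: arcast l x.
Proof. by rewrite -[a *: x]addr0 arcast_lin arcast0 addr0. Qed.
Lemma arcastD m l (x y : E m) : arcast l (x + y) = arcast l x + arcast l y.
Proof. by rewrite -[x]scale1r arcast_lin !scale1r. Qed.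
Lemma arcast_homog m l d (x : E m) : homog d x -> homog d (arcast l x).
Proof.
have [ml|ml] := eqVneq m l; first by subst l; rewrite arcast_id.
rewrite /arcast; case: eqP => [h|_ _]; first by rewrite h eqxx in ml.
exact: homog0.
Qed.

(** Reduces an equation to the case of a nonzero augmentation; the factor in question then has arity
    one and the casts collapse. *)
Lemma scale_eq (V : lmodType k) (a : k) (u v : V) : (a != 0 -> u = v) -> a *: u = a *: v.
Proof. by have [->|a0 ->] := eqVneq a 0; rewrite ?scale0r. Qed.

Definition sqz_sm : bgsmod k := smsum Q E.
Definition sqz_id : sqz_sm 1%N := (og_id Q, 0).
Definition sqz_pcomp m n l (e : l.+1 = (m + n)%N) (i : 'I_m)
  (x : sqz_sm m) (y : sqz_sm n) : sqz_sm l :=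
  (og_pcomp Q e i x.1 y.1,
   aug (y.1 : Q n) *: arcast l (x.2 : E m) + aug (x.1 : Q m) *: arcast l (y.2 : E n)).

Lemma sqz_eq n (x y : sqz_sm n) : x.1 = y.1 :> Q n -> x.2 = y.2 :> E n -> x = y.
Proof. by case: x y => [x x'] [y y'] /= -> ->. Qed.
Lemma homog_sqz n d (x : sqz_sm n) :
  homog d x <-> homog d (x.1 : Q n) /\ homog d (x.2 : E n).
Proof. exact: homog_pair. Qed.

(* Q acts on E through its augmentation Q -> I. *)
Definition sqz_operad : bgoperad k.
Proof.
apply: (@BgOperad k sqz_sm sqz_id sqz_pcomp).
- move=> m n l e i y a x x'; apply: sqz_eq; rewrite /= ?pcompDl ?pcompZl //.
  rewrite arcast_lin aug_lin !scalerDr scalerDl !scalerA mulrC.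
  by rewrite [_ * aug y.1]mulrC addrACA.
- move=> m n l e i x a y y'; apply: sqz_eq; rewrite /= ?pcompDr ?pcompZr //.
  rewrite arcast_lin aug_lin !scalerDr scalerDl !scalerA.
  by rewrite [_ * aug x.1]mulrC addrACA.
- by apply/homog_sqz; split; [exact: og_id_homog|exact: homog0].
- move=> m n l e i c d x y /homog_sqz[x1 x2] /homog_sqz[y1 y2].
  apply/homog_sqz; split; first exact: og_pcomp_homog.
  apply: homogD.
    have [->|a0] := eqVneq (aug (y.1 : Q n)) 0; first by rewrite scale0r; exact: homog0.
    by apply/homogZ/arcast_homog; rewrite (aug_homog y1 a0) addr0.
  have [->|a0] := eqVneq (aug (x.1 : Q m)) 0; first by rewrite scale0r; exact: homog0.
  by apply/homogZ/arcast_homog; rewrite (aug_homog x1 a0) add0r.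
- move=> n e i y; apply: sqz_eq; rewrite /= ?og_idl //.
  by rewrite arcast0 scaler0 add0r arcast_id (aug_id : aug1 _ = 1) scale1r.
- move=> m e i x; apply: sqz_eq; rewrite /= ?og_idr //.
  by rewrite arcast0 scaler0 addr0 arcast_id (aug_id : aug1 _ = 1) scale1r.
- move=> m n p mn np l e e' g g' i j ij ijE x y z.
  apply: sqz_eq => /=; first exact: (og_seq e e' g g' ijE).
  rewrite !arcastD !scalerDr !arcastZ !aug_pcomp !scalerA -addrA.
  congr (_ + (_ + _)).
  + rewrite mulrC; apply: scale_eq; rewrite mulf_eq0 negb_or => /andP[/aug_ne0 n1 /aug_ne0 p1].
    have ? : mn = m by lia.
    by subst mn; rewrite arcast_id.
  + rewrite [aug z.1 * _]mulrC; apply: scale_eq.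
    rewrite mulf_eq0 negb_or => /andP[/aug_ne0 m1 /aug_ne0 p1].
    have ? : mn = n by lia.
    have ? : np = n by lia.
    by subst mn np; rewrite !arcast_id.
  + apply: scale_eq; rewrite mulf_eq0 negb_or => /andP[/aug_ne0 m1 /aug_ne0 n1].
    have ? : np = p by lia.
    by subst np; rewrite arcast_id.
- move=> m n p mn mp l e e' g g' i h i' h' ih h'E i'E c d x y z.
  move=> /homog_sqz[y1 y2] /homog_sqz[z1 z2].
  apply: sqz_eq => /=; first exact: (og_par e e' g g' ih h'E i'E).
  (* Two distinct inputs [i < h] exclude arity one. Only the term in [x.2] survives, and there [y]
     and [z] have nonzero augmentation, hence bidegree zero, so that the Koszul sign is trivial. *)
  have x0 : aug (x.1 : Q m) = 0.
    apply/eqP; apply: contraT => /aug_ne0 m1; subst m.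
    by move: ih; rewrite (ord1 i) (ord1 h).
  rewrite !arcastD !scalerDr !arcastZ !aug_pcomp x0 !mul0r !scale0r !scaler0 !addr0.
  rewrite !scalerA.
  have [y0|y0] := eqVneq (aug (y.1 : Q n)) 0; first by rewrite y0 !(mul0r, mulr0) !scale0r.
  have [z0|z0] := eqVneq (aug (z.1 : Q p)) 0; first by rewrite z0 !(mul0r, mulr0) !scale0r.
  rewrite (aug_homog y1 y0) /totdeg /= addr0 mul0r ksign0 mul1r [aug z.1 * _]mulrC.
  move: (aug_ne0 y0) (aug_ne0 z0) => n1 p1.
  have ? : mn = m by lia.
  have ? : mp = m by lia.
  by subst mn mp; rewrite !arcast_id.
- move=> m n l e i s t r rE x y; apply: sqz_eq => /=; first exact: (og_equiv e rE).
  (* When one factor has arity one, the block permutation is the permutation acting on the other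
     factor. *)
  rewrite linearD !linearZ !aug_act; congr (_ + _); apply: scale_eq => /aug_ne0.
    move=> n1; subst n; have ml : l = m by lia.
    subst l; rewrite !arcast_id; congr (sm_act E _ _).
    apply/permP => c; apply: ord_inj; case: rE => rE1 rE2.
    have [->|ci] := eqVneq c i.
      rewrite (rE2 ord0) ?/inner_pos ?addn0 //.
      by rewrite [t _]ord1 addn0.
    rewrite (rE1 c c ci); last by rewrite /outer_pos; case: ifP => // _; rewrite addn1.
    by rewrite /outer_pos; case: ifP => // _; rewrite addn1.
  move=> m1; subst m; have nl : l = n by lia.
  subst l; rewrite !arcast_id; congr (sm_act E _ _).
  apply/permP => c; apply: ord_inj; case: rE => rE1 rE2.
  by rewrite (rE2 c c) /inner_pos ?[s i]ord1 ?[i]ord1.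
Defined.

End SquareZero.

(** * Arities zero and one when the generators have arity at least two *)

Section LowArity.
Variables (k : fieldType) (M : bgsmod k) (Q : bgoperad k) (iota : smmorph M Q).
Hypotheses (Qgen : op_generated iota) (M0 : is_zero (M 0%N)) (M1 : is_zero (M 1%N)).

(** A composite of arity at most one either has an inner factor of arity zero, which vanishes, or
    has two factors of arity one. The [match] lets a single induction treat both arities. *)
Lemma low_arity n (x : Q n) :
  match n return Q n -> Prop with
  | 0%N => fun x => x = 0
  | 1%N => fun x => exists a, x = a *: og_id Q
  | _ => fun=> True
  end x.
Proof.
move: n x; apply: Qgen.
- by case=> [|[|n]] //; exists 0; rewrite scale0r.
- case=> [|[|n]] a x y //; first by move=> -> ->; rewrite scaler0 addr0.
  by move=> [b ->] [c ->]; exists (a * b + c); rewrite scalerDl scalerA.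
- by exists 1; rewrite scale1r.
- case=> [|[|n]] d x _ //; first by rewrite (M0 x) linear0.
  by exists 0; rewrite (M1 x) linear0 scale0r.
- case=> [|[|n]] s x //; first by move=> ->; rewrite linear0.
  have -> : s = 1%g by apply/permP => j; rewrite !ord1.
  by rewrite sm_act1.
- move=> m n l e i c d x y _ _; case: m e i x => [|m] e i x; first by case: i.
  case: n e y => [|n] e y Sx Sy.
    rewrite Sy pcomp0r; case: l e => [|[|l]] e //.
    by exists 0; rewrite scale0r.
  case: l e => [|[|l]] e; [by lia| | by []].
  have ? : m = 0%N by lia.
  have ? : n = 0%N by lia.
  subst m n; move: Sx Sy => [a ->] [b ->]; exists (a * b).
  by rewrite pcompZl pcompZr og_idl scalerA.
Qed.

Lemma arity0 : is_zero (Q 0%N).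
Proof. by move=> x; exact: (low_arity x). Qed.

(** Generation only shows that the identity spans; that the coefficient is unique is detected by the
    morphism to [R]. *)
Lemma arity1 (R : bgoperad k) (f : bgopmorph Q R) : unit_arity1 R -> unit_arity1 Q.
Proof.
move=> R1 x; have [a xE] := low_arity x; exists a; split=> // b bE.
have [c [_ cU]] := R1 (f _ x).
have H a' : x = a' *: og_id Q -> c = a'.
  by move=> E; apply: cU; rewrite E linearZ /= bom_id.
by rewrite -(H _ xE) -(H _ bE).
Qed.
End LowArity.

(** * Identities between derivations, checked on generators *)

Section Derivations.
Variable k : fieldType.

Lemma op_del_deriv (P : operad k) : is_deriv (1, 0) (op_del P).
Proof.
apply: leibniz_deriv; first by move=> n; exact: bc_del_bideg (op_bicomplex P n).
- exact: op_act_del.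
- exact: op_id_del.
- exact: op_leibniz_del.
Qed.

Lemma op_delbar_deriv (P : operad k) : is_deriv (0, 1) (op_delbar P).
Proof.
apply: leibniz_deriv; first by move=> n; exact: bc_delbar_bideg (op_bicomplex P n).
- exact: op_act_delbar.
- exact: op_id_delbar.
- exact: op_leibniz_delbar.
Qed.

Section Intertwine.
Variables (M : bgsmod k) (Q R : bgoperad k) (iota : smmorph M Q) (f : bgopmorph Q R).
Variables (c : bideg) (dQ : forall n, {linear Q n -> Q n}) (dR : forall n, {linear R n -> R n}).
Hypotheses (Qgen : op_generated iota) (dQP : is_deriv c dQ) (dRP : is_deriv c dR).

Lemma morph_sgn n x : sgn (R n) (f n x) = f n (sgn (Q n) x).
Proof. by rewrite (sgn_bideg_map (smm_bideg f (n := n))) ksign0 scale1r. Qed.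

Lemma deriv_intertwine :
  (forall n x, f n (dQ n (iota n x)) = dR n (f n (iota n x))) ->
  forall n x, f n (dQ n x) = dR n (f n x).
Proof.
move=> E; apply: Qgen => //.
- by move=> n; rewrite !linear0.
- by move=> n a x y Ex Ey; rewrite !linearP /= Ex Ey.
- by rewrite (dv_id dQP) bom_id (dv_id dRP) linear0.
- by move=> n s x Ex; rewrite (dv_act dQP) !smm_act (dv_act dRP) Ex.
- move=> m n l e i d1 d2 x y _ _ Ex Ey.
  by rewrite (dv_pcomp dQP) linearD !bom_pcomp (dv_pcomp dRP) /= Ex Ey morph_sgn.
Qed.
End Intertwine.

Section Squares.
Variables (M : bgsmod k) (Q : bgoperad k) (iota : smmorph M Q).
Variables (c d : bideg) (c1 : totdeg c = 1) (d1 : totdeg d = 1).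
Variables (del del' : forall n, {linear Q n -> Q n}).
Hypotheses (Qgen : op_generated iota) (delP : is_deriv c del) (del'P : is_deriv d del').

Lemma sgn_deriv n (x : Q n) : sgn (Q n) (del n x) = - del n (sgn (Q n) x).
Proof. by rewrite (sgn_bideg_map (dv_bideg delP (n := n))) c1 ksign1 scaleN1r. Qed.
Lemma sgn_deriv' n (x : Q n) : sgn (Q n) (del' n x) = - del' n (sgn (Q n) x).
Proof. by rewrite (sgn_bideg_map (dv_bideg del'P (n := n))) d1 ksign1 scaleN1r. Qed.

Lemma pcompN m n l (e : l.+1 = (m + n)%N) (i : 'I_m) (x : Q m) (y : Q n) :
  og_pcomp Q e i (- x) y = - og_pcomp Q e i x y.
Proof. by rewrite -scaleN1r pcompZl scaleN1r. Qed.

(** The square of an odd derivation is again a derivation: the two cross terms cancel because [sgn]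
    anticommutes with an odd map. The same mechanism gives the anticommutator below. *)
Lemma deriv_sq : (forall n x, del n (del n (iota n x)) = 0) -> forall n x, del n (del n x) = 0.
Proof.
move=> E; apply: Qgen => //.
- by move=> n; rewrite !linear0.
- by move=> n a x y Ex Ey; rewrite !linearP /= Ex Ey scaler0 addr0.
- by rewrite (dv_id delP) linear0.
- by move=> n s x Ex; rewrite !(dv_act delP) Ex linear0.
- move=> m n l e i d2 d3 x y xd _ Ex Ey.
  rewrite (dv_pcomp delP) linearD /= !(dv_pcomp delP) Ex Ey pcomp0l pcomp0r add0r addr0.
  by rewrite sgn_deriv pcompN addNr.
Qed.

Lemma deriv_anticomm : (forall n x, del n (del' n (iota n x)) + del' n (del n (iota n x)) = 0) ->
  forall n x, del n (del' n x) + del' n (del n x) = 0.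
Proof.
move=> E; apply: Qgen => //.
- by move=> n; rewrite !linear0 addr0.
- by move=> n a x y Ex Ey; rewrite !linearP /= addrACA -scalerDr Ex Ey scaler0 addr0.
- by rewrite (dv_id delP) (dv_id del'P) !linear0 addr0.
- move=> n s x Ex; rewrite (dv_act delP) !(dv_act del'P) (dv_act delP).
  by rewrite -linearD /= Ex linear0.
- move=> m n l e i d2 d3 x y xd _ Ex Ey.
  rewrite (dv_pcomp delP) (dv_pcomp del'P) !linearD /= !(dv_pcomp delP) !(dv_pcomp del'P).
  rewrite sgn_deriv sgn_deriv' !pcompN.
  set a := og_pcomp Q e i (del m (del' m x)) y.
  set b := og_pcomp Q e i (del' m (del m x)) y.
  set p := og_pcomp Q e i (del' m _) (del n y).
  set q := og_pcomp Q e i (del m _) (del' n y).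
  set g := og_pcomp Q e i _ (del n (del' n y)).
  set h := og_pcomp Q e i _ (del' n (del n y)).
  have ab : a + b = 0 by rewrite -pcompDl Ex pcomp0l.
  have gh : g + h = 0 by rewrite -pcompDr Ey pcomp0r.
  rewrite (addrACA (a - p)) (addrACA a) (addrACA q) ab gh.
  by rewrite add0r addr0 -opprD [q + p]addrC addNr.
Qed.
End Squares.
End Derivations.

(** * Principal extensions *)

Section Copair.
Variables (k : fieldType).

Section Lin.
Variables (A B V : lmodType k) (f : {linear A -> V}) (g : {linear B -> V}).
Definition copair_fun (x : (A * B)%type) : V := f x.1 + g x.2.
Lemma copair_linear : linear copair_fun.
Proof. by move=> a x y; rewrite /copair_fun /= !linearP scalerDr addrACA. Qed.
Definition copair : {linear (A * B)%type -> V} := linpack copair_linear.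
End Lin.

Lemma copair_bideg (A B C : bgvect k) c (f : {linear A -> C}) (g : {linear B -> C}) :
  has_bideg c f -> has_bideg c g -> @has_bideg k (bgsum A B) C c (copair f g).
Proof. by move=> fc gc d x /homog_pair[x1 x2]; apply: homogD; [exact: fc|exact: gc]. Qed.

Section Sm.
Variables (M E N : bgsmod k).

Section Morph.
Variables (f : smmorph M N) (g : smmorph E N).
Lemma copair_sm_act n (s : 'S_n) (x : smsum M E n) :
  copair (f n) (g n) (sm_act (smsum M E) s x) = sm_act N s (copair (f n) (g n) x).
Proof. by rewrite /= /copair_fun /= linearD !smm_act. Qed.
Definition copair_sm : smmorph (smsum M E) N :=
  @SmMorph k (smsum M E) N (fun n => copair (f n) (g n))
    (fun n => copair_bideg (smm_bideg f (n := n)) (smm_bideg g (n := n))) copair_sm_act.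
End Morph.

Definition inl_fun n (x : M n) : smsum M E n := (x, 0).
Lemma inl_linear n : linear (@inl_fun n).
Proof. by move=> a x y; rewrite /inl_fun; congr pair; rewrite /= ?scaler0 ?addr0. Qed.
Lemma inl_bideg n : has_bideg 0 (linpack (@inl_linear n)).
Proof. by move=> d x xd; rewrite addr0; apply/homog_pair; split=> //=; exact: homog0. Qed.
Lemma inl_act n (s : 'S_n) x : linpack (@inl_linear n) (sm_act M s x) =
  sm_act (smsum M E) s (linpack (@inl_linear n) x).
Proof. by rewrite /= /inl_fun /smsum_act_fun /= linear0. Qed.
Definition sm_inl : smmorph M (smsum M E) := SmMorph inl_bideg inl_act.

Definition inr_fun n (x : E n) : smsum M E n := (0, x).
Lemma inr_linear n : linear (@inr_fun n).
Proof. by move=> a x y; rewrite /inr_fun; congr pair; rewrite /= ?scaler0 ?addr0. Qed.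
Lemma inr_bideg n : has_bideg 0 (linpack (@inr_linear n)).
Proof. by move=> d x xd; rewrite addr0; apply/homog_pair; split=> //=; exact: homog0. Qed.
Lemma inr_act n (s : 'S_n) x : linpack (@inr_linear n) (sm_act E s x) =
  sm_act (smsum M E) s (linpack (@inr_linear n) x).
Proof. by rewrite /= /inr_fun /smsum_act_fun /= linear0. Qed.
Definition sm_inr : smmorph E (smsum M E) := SmMorph inr_bideg inr_act.

Lemma sm_inlr n (x : smsum M E n) : x = sm_inl n x.1 + sm_inr n x.2.
Proof. by case: x => x e; rewrite /= /inl_fun /inr_fun; congr pair; rewrite ?addr0 ?add0r. Qed.
Lemma smsum_zero n : is_zero (M n) -> is_zero (E n) -> is_zero (smsum M E n).
Proof. by move=> M0 E0 [x e]; rewrite (M0 x) (E0 e). Qed.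
End Sm.

Section CompSm.
Variables (M N R : bgsmod k) (f : smmorph N R) (g : smmorph M N).
Definition sm_comp_fun n : {linear M n -> R n} := f n \o g n.
Lemma sm_comp_bideg n : has_bideg 0 (sm_comp_fun n).
Proof. by move=> d x xd; rewrite -[0]addr0 addrA; apply: smm_bideg; exact: smm_bideg. Qed.
Lemma sm_comp_act n (s : 'S_n) x : sm_comp_fun n (sm_act M s x) = sm_act R s (sm_comp_fun n x).
Proof. by rewrite /= !smm_act. Qed.
Definition sm_comp : smmorph M R := SmMorph sm_comp_bideg sm_comp_act.
End CompSm.
End Copair.

Section PrincipalExtension.
Variables (k : fieldType) (n : nat) (X : quasifree k) (E : attaching n X) (P : operad k).
Variables (phi : opmorph X P) (b : smmorph E P).
Hypotheses (n2 : (2 <= n)%N) (X0 : is_zero (qf_gen X 0%N)) (X1 : is_zero (qf_gen X 1%N)).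
Hypotheses (Xgen : op_generated (qf_iota X)) (P1 : unit_arity1 P).
Hypothesis d10_act : forall m (s : 'S_m) x,
  at_d10 E m (sm_act E s x) = sm_act X s (at_d10 E m x).
Hypothesis d01_act : forall m (s : 'S_m) x,
  at_d01 E m (sm_act E s x) = sm_act X s (at_d01 E m x).
Hypothesis d10_del : forall m x, op_del X m (at_d10 E m x) = 0.
Hypothesis d01_delbar : forall m x, op_delbar X m (at_d01 E m x) = 0.
Hypothesis d_mixed : forall m x,
  op_del X m (at_d01 E m x) + op_delbar X m (at_d10 E m x) = 0.
Hypothesis b_del : forall m x, phi m (at_d10 E m x) = op_del P m (b m x).
Hypothesis b_delbar : forall m x, phi m (at_d01 E m x) = op_delbar P m (b m x).

Let XU : unit_arity1 X := arity1 Xgen X0 X1 phi P1.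
Let XZ : is_zero (X 0%N) := arity0 Xgen X0 X1.
Let M : bgsmod k := smsum (qf_gen X) E.
Let F : bgoperad k := free_operad M.
Let iota : smmorph M F := free_iota M.
Let u : smmorph (qf_gen X) M := sm_inl (qf_gen X) E.
Let v : smmorph E M := sm_inr (qf_gen X) E.
Let Fgen : op_generated iota := @free_generated k M.

Lemma pext_incl : exists j : bgopmorph X F, forall m x, j m (qf_iota X m x) = iota m (u m x).
Proof. by have [] := qf_free (q := X) (sm_comp iota u). Qed.

Section Deriv.
Variables (j : bgopmorph X F) (jE : forall m x, j m (qf_iota X m x) = iota m (u m x)).
Variables (c : bideg) (c1 : totdeg c = 1).
Variables (dX : forall m, {linear X m -> X m}) (dXP : is_deriv c dX).
Variables (dE : forall m, {linear E m -> X m}) (dEc : forall m, has_bideg c (dE m)).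
Hypothesis dE_act : forall m (s : 'S_m) x, dE m (sm_act E s x) = sm_act X s (dE m x).

(** The value on old generators is transported along [j] and the value on [E] is prescribed;
    intertwining with [dX] then holds on all of [X] because it holds on generators. It serves for
    both differentials. *)
Lemma pext_deriv : exists del : forall m, {linear F m -> F m},
  [/\ is_deriv c del, forall m x, j m (dX m x) = del m (j m x) &
      forall m x, del m (iota m (v m x)) = j m (dE m x)].
Proof.
pose del0 m : {linear M m -> F m} :=
  copair (j m \o dX m \o qf_iota X m) (j m \o dE m).
have B m : has_bideg c (del0 m).
  apply: copair_bideg => d x xd; rewrite -[d + c]addr0; apply: smm_bideg.
    by apply: (dv_bideg dXP); rewrite -[d]addr0; exact: smm_bideg.
  exact: dEc.
have A m (s : 'S_m) x : del0 m (sm_act M s x) = sm_act F s (del0 m x).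
  rewrite /= /copair_fun /= smm_act (dv_act dXP) dE_act !smm_act.
  exact: esym (linearD (sm_act F s) _ _).
have [del [delP delE]] := deriv_extend c1 (@free_is_free k M) Fgen B A.
exists del; split=> //.
  apply: (deriv_intertwine Xgen dXP delP) => m x.
  by rewrite jE delE /= /copair_fun /= !linear0 addr0.
by move=> m x; rewrite delE /= /copair_fun /= !linear0 add0r.
Qed.
End Deriv.

(** The square-zero extension of [X] by [E] receives a morphism from the free operad that sends
    $j(x)+e$ to the pair $(x,e)$, so the two summands can neither collapse nor meet. *)
Lemma pext_inj (j : bgopmorph X F) (jE : forall m x, j m (qf_iota X m x) = iota m (u m x))
  m (x : X m) (e : E m) : j m x + iota m (v m e) = 0 -> x = 0 /\ e = 0.
Proof.
pose S := sqz_operad E XZ XU.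
pose ph : smmorph M S := copair_sm
  (@sm_comp k _ _ S (sm_inl X E : smmorph X S) (qf_iota X)) (sm_inr X E : smmorph E S).
have [[G GE] _] := @free_is_free k M S ph.
have Gj l y : G l (j l y) = sm_inl X E l y :> S l.
  move: l y; apply: Xgen.
  - by move=> l; rewrite !linear0.
  - by move=> l a y z Ey Ez; rewrite !linearP /= Ey Ez.
  - by rewrite !bom_id.
  - by move=> l d y _; rewrite jE GE; apply: sqz_eq; rewrite /= addr0.
  - by move=> l s y Ey; rewrite !smm_act Ey.
  - move=> m1 m2 l e1 i c d y z _ _ Ey Ez; rewrite !bom_pcomp Ey Ez.
    by apply: sqz_eq; rewrite //= !arcast0 !scaler0 addr0.
move=> /(congr1 (G m)); rewrite linearD /= Gj GE linear0 /= /copair_fun /= !linear0 add0r.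
rewrite /inl_fun /inr_fun => /(congr1 (fun p : (X m * E m)%type => (p.1, p.2))) /= [].
by rewrite addr0 add0r.
Qed.

Let E0 : is_zero (E 0%N).
Proof. by apply: at_conc => n0; move: n2; rewrite -n0. Qed.
Let E1 : is_zero (E 1%N).
Proof. by apply: at_conc => n0; move: n2; rewrite -n0. Qed.
Let F0 : is_zero (F 0%N) := arity0 Fgen (smsum_zero X0 E0) (smsum_zero X1 E1).
Let F1 (x : F 1%N) : exists a, x = a *: og_id F :=
  low_arity Fgen (smsum_zero X0 E0) (smsum_zero X1 E1) x.

(** An element of [E] composed with anything of arity at least two ends up above arity [n], and
    composites with arities zero and one are trivial; up to arity [n] the new generators occur only
    linearly. *)
Lemma pext_surj (j : bgopmorph X F) (jE : forall m x, j m (qf_iota X m x) = iota m (u m x))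
  m (y : F m) : (m <= n)%N -> exists x e, y = j m x + iota m (v m e).
Proof.
move: m y; apply: Fgen.
- by move=> m _; exists 0, 0; rewrite !linear0 addr0.
- move=> m a x y Sx Sy mn; have [x1 [x2 ->]] := Sx mn; have [y1 [y2 ->]] := Sy mn.
  exists (a *: x1 + y1), (a *: x2 + y2).
  by rewrite !linearP /= scalerDr addrACA.
- by move=> _; exists (og_id X), 0; rewrite bom_id !linear0 addr0.
- move=> m d x _ _; exists (qf_iota X m x.1), x.2.
  by rewrite {1}[x]sm_inlr linearD jE.
- move=> m s x Sx mn; have [x1 [x2 ->]] := Sx mn.
  exists (sm_act X s x1), (sm_act E s x2).
  rewrite (linearD (sm_act F s)); congr (_ + _); first by rewrite smm_act.
  by rewrite (smm_act v) (smm_act iota).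
- move=> m m' l e i c d x y _ _ Sx Sy ln.
  case: m e i x Sx => [|[|m]] e i x Sx; first by case: i.
    have ? : m' = l by lia.
    subst m'; have [x1 [x2 ->]] := Sy ln; have [a ->] := F1 x.
    by exists (a *: x1), (a *: x2); rewrite pcompZl og_idl scalerDr !linearZ.
  case: m' e y Sy => [|[|m']] e y Sy.
  + by exists 0, 0; rewrite (F0 y) pcomp0r !linear0 addr0.
  + have ? : m.+2 = l by lia.
    subst l; have [x1 [x2 ->]] := Sx ln; have [a ->] := F1 y.
    by exists (a *: x1), (a *: x2); rewrite pcompZr og_idr scalerDr !linearZ.
  + have mn : (m.+2 < n)%N by lia.
    have m'n : (m'.+2 < n)%N by lia.
    have [x1 [x2 ->]] := Sx (ltnW mn); have [y1 [y2 ->]] := Sy (ltnW m'n).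
    rewrite (at_conc (a := E) _ x2); last by move=> E'; rewrite E' ltnn in mn.
    rewrite (at_conc (a := E) _ y2); last by move=> E'; rewrite E' ltnn in m'n.
    exists (og_pcomp X e i x1 y1), 0.
    by rewrite !linear0 !addr0 bom_pcomp.
Qed.

(** The last two clauses identify $Y(m)$ with $X(m)\oplus E(m)$ for $m\le n$; through them the
    cohomology of [Y] in arity [n] becomes a question about an explicit sum. *)
Lemma principal_extension : exists (Y : quasifree k) (j : opmorph X Y)
    (u' : smmorph (qf_gen X) (qf_gen Y)) (v' : smmorph E (qf_gen Y)) (psi : opmorph Y P),
  [/\ is_principal_ext j u' v' /\ op_generated (qf_iota Y),
      forall m x, psi m (j m x) = phi m x,
      forall m e, psi m (qf_iota Y m (v' m e)) = b m e,
      forall m x e, j m x + qf_iota Y m (v' m e) = 0 -> x = 0 /\ e = 0 &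
      forall m y, (m <= n)%N -> exists x e, y = j m x + qf_iota Y m (v' m e)].
Proof.
have [j jE] := pext_incl.
have [del [delP jdel vdel]] := pext_deriv jE (erefl : totdeg (1, 0) = 1)
  (op_del_deriv X) (@at_d10_bideg k n X E) d10_act.
have [delbar [delbarP jdelbar vdelbar]] := pext_deriv jE (erefl : totdeg (0, 1) = 1)
  (op_delbar_deriv X) (@at_d01_bideg k n X E) d01_act.
have I m x : iota m x = j m (qf_iota X m x.1) + iota m (v m x.2).
  by rewrite {1}[x]sm_inlr linearD jE.
have BX l := op_bicomplex X l.
have bcF m : @is_bicomplex k (F m) (del m) (delbar m).
  split.
  - exact: (dv_bideg delP).
  - exact: (dv_bideg delbarP).
  - apply: (deriv_sq _ Fgen delP) => // l x.
    rewrite I !linearD /= -!jdel (bc_del_del (BX l)).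
    by rewrite vdel -jdel d10_del !linear0 addr0.
  - apply: (deriv_sq _ Fgen delbarP) => // l x.
    rewrite I !linearD /= -!jdelbar (bc_delbar_delbar (BX l)).
    by rewrite vdelbar -jdelbar d01_delbar !linear0 addr0.
  - apply: (deriv_anticomm _ _ Fgen delP delbarP) => // l x.
    rewrite I !linearD /= -!jdelbar -!jdel -!jdelbar vdel vdelbar -jdel -jdelbar.
    by rewrite addrACA -!linearD /= (bc_anticomm (BX l)) d_mixed addr0 linear0.
pose Yop : operad k := Operad bcF (dv_act delP) (dv_act delbarP) (dv_id delP)
  (dv_id delbarP) (deriv_leibniz delP) (deriv_leibniz delbarP).
pose Y : quasifree k := @QuasiFree k Yop M iota (@free_is_free k M).
pose jj : opmorph X Y := @OpMorph k X Y j jdel jdelbar.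
have [[ps psE] _] := @free_is_free k M P (copair_sm (sm_comp phi (qf_iota X)) b).
have psj m x : ps m (j m x) = phi m x.
  move: m x; apply: Xgen.
  - by move=> m; rewrite !linear0.
  - by move=> m a x y Ex Ey; rewrite !linearP /= Ex Ey.
  - by rewrite !bom_id.
  - by move=> m d x _; rewrite jE psE /= /copair_fun /= linear0 addr0.
  - by move=> m s x Ex; rewrite !smm_act Ex.
  - by move=> m1 m2 l e1 i c d x y _ _ Ex Ey; rewrite !bom_pcomp Ex Ey.
have psv m e : ps m (iota m (v m e)) = b m e.
  by rewrite psE /= /copair_fun /= !linear0 add0r.
have psdel m x : ps m (del m x) = op_del P m (ps m x).
  move: m x; apply: (deriv_intertwine Fgen delP (op_del_deriv P)) => m x.
  by rewrite I !linearD /= -jdel vdel !psj psv b_del om_del.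
have psdelbar m x : ps m (delbar m x) = op_delbar P m (ps m x).
  move: m x; apply: (deriv_intertwine Fgen delbarP (op_delbar_deriv P)) => m x.
  by rewrite I !linearD /= -jdelbar vdelbar !psj psv b_delbar om_delbar.
pose psi : opmorph Y P := @OpMorph k Y P ps psdel psdelbar.
exists Y, jj, u, v, psi; split=> //.
- split; last exact: Fgen.
  split=> //.
  move=> m y; exists y; split; first exact: sm_inlr.
  by move=> z ->; rewrite -sm_inlr.
- exact: pext_inj.
- exact: pext_surj.
Qed.

End PrincipalExtension.

(** * Equivariant projections *)

Section Projections.
Variable k : fieldType.

Lemma complement_exists (V : lmodType k) (W : subspace V) : exists K : subspace V,
  (forall x, K x -> W x -> x = 0) /\ (forall x, exists w c, [/\ W w, K c & x = w + c]).
Proof.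
pose P (K : set V) := (forall a x y, K x -> K y -> K (a *: x + y)) /\
  (forall x, K x -> W x -> x = 0).
have [F FP Ftot|K [[KL KW] Kmax]] := @Zorn_bigcup V P.
  split=> [a x y [A FA Ax] [B FB By]|x [A FA Ax]]; last exact: (FP _ FA).2.
  have [AB|BA] := Ftot _ _ FA FB.
    by exists B => //; apply: (FP _ FB).1 => //; exact: AB.
  by exists A => //; apply: (FP _ FA).1 => //; exact: BA.
have K0 : K 0.
  apply: contrapT => nK0; apply: (Kmax (fun x => K x \/ x = 0)).
    split; first by move=> x Kx; left.
    by move=> /(_ 0 (or_intror erefl)).
  split=> [a x y [Kx|->] [Ky|->]|x [Kx|->] //]; last exact: KW.
  - by left; exact: KL.
  - left; rewrite addr0; have := KL (a - 1) x x Kx Kx.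
    by rewrite scalerBl scale1r subrK.
  - by left; rewrite scaler0 add0r.
  - by right; rewrite scaler0 addr0.
exists (Subspace K0 KL); split=> //= x0; apply: contrapT => nx0.
have nK : ~ K x0 by move=> Kx0; apply: nx0; exists 0, x0; rewrite add0r; split=> //; exact: ssp_0.
(* Adjoining the line through [x0] contradicts maximality: an element $c+a\,x_0$ of [W] with $a\ne0$
   would put $x_0$ in [W + K]. *)
apply: (Kmax (fun x => exists c a, K c /\ x = c + a *: x0)).
  split; first by move=> x Kx; exists x, 0; rewrite scale0r addr0.
  by move=> /(_ x0) H; apply/nK/H; exists 0, 1; rewrite scale1r add0r.
split=> [a x y [c [b [Kc ->]]] [c' [b' [Kc' ->]]]|x [c [a [Kc ->]]] Wx].
  exists (a *: c + c'), (a * b + b'); split; first exact: KL.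
  by rewrite scalerDr scalerDl -scalerA addrACA.
have [a0|a0] := eqVneq a 0.
  by move: Wx; rewrite a0 scale0r addr0 => /KW; apply.
exfalso; apply: nx0; exists (a^-1 *: (c + a *: x0)), (- a^-1 *: c); split.
- exact: ssp_scale.
- by have := KL (- a^-1) c 0 Kc K0; rewrite addr0.
- by rewrite scalerDr scalerA mulVf // scale1r scaleNr addrC addKr.
Qed.

Lemma linear_projection (V : lmodType k) (W : subspace V) : exists p : {linear V -> V},
  (forall x, W (p x)) /\ (forall x, W x -> p x = x).
Proof.
have [K [KW KV]] := complement_exists W.
have D x : exists w, W w /\ K (x - w).
  by have [w [c [Ww Kc ->]]] := KV x; exists w; rewrite addrC addKr.
pose p x := sval (cid (D x)).
have pW x : W (p x) by rewrite /p; case: cid => w [].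
have pK x : K (x - p x) by rewrite /p; case: cid => w [].
have pU x w : W w -> K (x - w) -> p x = w.
  move=> Ww Kw; apply: subr0_eq; apply: KW; last first.
    by apply: ssp_add => //; exact: ssp_opp.
  have -> : p x - w = (x - w) - (x - p x) by rewrite opprB [RHS]addrC addrA subrK.
  by apply: ssp_add => //; exact: ssp_opp.
have pL : linear p.
  move=> a x y; apply: pU; first exact: ssp_lin.
  have -> : a *: x + y - (a *: p x + p y) = a *: (x - p x) + (y - p y).
    by rewrite opprD addrACA -scalerBr.
  exact: ssp_lin.
exists (linpack pL); split=> //= x Wx; apply: pU => //.
by rewrite subrr; exact: ssp_0.
Qed.

Hypothesis char0 : [pchar k] =i pred0.

(* Maschke: a linear projection is made homogeneous, then averaged. *)
Lemma equivariant_projection (N : bgsmod k) n (W : subspace (N n))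
    (WP : forall d x, W x -> W (bg_proj (N n) d x))
    (Wact : forall (s : 'S_n) x, W x -> W (sm_act N s x)) :
  exists p : {linear N n -> N n}, [/\ forall x, W (p x), forall x, W x -> p x = x,
    has_bideg 0 p & forall (s : 'S_n) x, p (sm_act N s x) = sm_act N s (p x)].
Proof.
have [p0 [p0W p0I]] := linear_projection W.
have [p1 [p1W p1I p1B]] : exists p1 : {linear N n -> N n},
    [/\ forall x, W (p1 x), forall x, W x -> p1 x = x & has_bideg 0 p1].
  pose p1 := linpack (bg_gsum_linear (fun d => bg_proj (N n) d \o p0 : {linear N n -> N n})).
  exists p1; split.
  - by move=> x; apply: ssp_sum => d; exact/WP/p0W.
  - move=> x Wx; rewrite [RHS]bg_suppE; apply: eq_bigr => d _ /=.
    by rewrite p0I ?bg_projK ?eqxx //; exact: WP.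
  - by move=> d x xd; rewrite addr0 /p1 /= (bg_gsum_homog _ xd); exact: proj_homog.
pose c : k := (#|{: 'S_n}|)%:R^-1.
have c0 : #|{: 'S_n}|%:R != 0 :> k.
  rewrite (proj1 (pcharf0P _) char0) -lt0n; apply/card_gt0P; by exists 1%g.
pose p2 x := c *: \sum_(s : 'S_n) sm_act N s^-1%g (p1 (sm_act N s x)).
have p2L : linear p2.
  move=> a x y; rewrite /p2 scalerA mulrC -scalerA -scalerDr; congr (_ *: _).
  by rewrite scaler_sumr -big_split; apply: eq_bigr => s _; rewrite /= !linearP.
exists (linpack p2L); split=> /=.
- by move=> x; apply/ssp_scale/ssp_sum => s; exact/Wact/p1W.
- move=> x Wx; rewrite /p2 (eq_bigr (fun=> x)).
    by rewrite sumr_const -[x *+ _]scaler_nat scalerA mulVf // scale1r.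
  by move=> s _; rewrite p1I; [rewrite -sm_actM mulgV sm_act1|exact: Wact].
- move=> d x xd; apply: homogZ; elim/big_rec: _ => [|s y _ yd]; first exact: homog0.
  apply: homogD => //; apply: sm_act_bideg; rewrite -[d]addr0; apply: p1B.
  by rewrite -[d]addr0; exact: sm_act_bideg.
- move=> t x; rewrite /p2 [RHS]linearZ /=; congr (_ *: _); rewrite linear_sum.
  rewrite (reindex_inj (mulgI t^-1%g)); apply: eq_bigr => s _ /=.
  by rewrite -!sm_actM mulgA mulgV mul1g invMg invgK.
Qed.
End Projections.

(** * Pluripotential equivalences of bicomplexes *)

Section Ungraded.
Variable k : fieldType.

(** Bott-Chern and Aeppli classes only see the two differentials, so the comparison arguments are
    run on bare spaces with two anticommuting differentials, and applied to bicomplexes through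
    [weq_of_dc]. *)
Record dcx := Dcx {
  dc_sort :> lmodType k;
  dc_d : {linear dc_sort -> dc_sort};
  dc_b : {linear dc_sort -> dc_sort};
  dc_dd : forall x, dc_d (dc_d x) = 0;
  dc_bb : forall x, dc_b (dc_b x) = 0;
  dc_db : forall x, dc_d (dc_b x) + dc_b (dc_d x) = 0 }.

Definition dcx_of (A : bicomplex k) : dcx :=
  Dcx (bc_del_del (bc_axioms A)) (bc_delbar_delbar (bc_axioms A))
      (bc_anticomm (bc_axioms A)).

Section DcxTheory.
Variable A : dcx.
Lemma dc_bd (x : A) : dc_b A (dc_d A x) = - dc_d A (dc_b A x).
Proof. by apply/eqP; rewrite -addr_eq0 addrC dc_db. Qed.
Lemma dc_dbd (x : A) : dc_d A (dc_b A (dc_d A x)) = 0.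
Proof. by rewrite dc_bd linearN /= dc_dd oppr0. Qed.
Lemma dc_bdb (x : A) : dc_b A (dc_d A (dc_b A x)) = 0.
Proof. by rewrite dc_bd dc_bb linear0 oppr0. Qed.
End DcxTheory.

Definition dc_morph (A B : dcx) (f : A -> B) : Prop :=
  (forall x, f (dc_d A x) = dc_d B (f x)) /\ (forall x, f (dc_b A x) = dc_b B (f x)).

Record dc_weq (A B : dcx) (f : {linear A -> B}) : Prop := DcWeq {
  bc_inj : forall x z, dc_d A x = 0 -> dc_b A x = 0 -> f x = dc_d B (dc_b B z) ->
    exists w, x = dc_d A (dc_b A w);
  bc_surj : forall y, dc_d B y = 0 -> dc_b B y = 0 ->
    exists x z, [/\ dc_d A x = 0, dc_b A x = 0 & f x - y = dc_d B (dc_b B z)];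
  ae_inj : forall x z w, dc_d A (dc_b A x) = 0 -> f x = dc_d B z + dc_b B w ->
    exists z' w', x = dc_d A z' + dc_b A w';
  ae_surj : forall y, dc_d B (dc_b B y) = 0 ->
    exists x z w, dc_d A (dc_b A x) = 0 /\ f x - y = dc_d B z + dc_b B w }.

Lemma weq_of_dc (A B : bicomplex k) (f : bcmorph A B) :
  pluripotential_weq f <-> @dc_weq (dcx_of A) (dcx_of B) f.
Proof.
have fd := bcm_del f; have fb := bcm_delbar f.
split=> [[[_ _ bi bs] [_ _ ai as_]]|[bi bs ai as_]].
  split=> /=.
  - move=> x z dx bx fx; have [||w] := bi x 0 (conj dx bx).
    + by rewrite /= !linear0.
    + by exists z; rewrite linear0 subr0.
    + by rewrite subr0 => ->; exists w.
  - by move=> y dy by_; have [x [dx bx] [z]] := bs y (conj dy by_); exists x, z.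
  - move=> x z w dx fx; have [||z' [w' ]] := ai x 0 dx.
    + by rewrite /= !linear0.
    + by exists z, w; rewrite linear0 subr0.
    + by rewrite subr0 => ->; exists z', w'.
  - by move=> y dy; have [x dx [z [w E]]] := as_ y dy; exists x, z, w.
split; split=> /=.
- by move=> x [dx bx]; rewrite -fd -fb dx bx linear0.
- by move=> x y _ _ [z E]; exists (f z); rewrite -linearB E fd fb.
- move=> x y [dx bx] [dy by_] [z E]; apply: (bi _ z).
  + by rewrite linearB /= dx dy subr0.
  + by rewrite linearB /= bx by_ subr0.
  + by rewrite linearB.
- by move=> y [dy by_]; have [x [z [dx bx E]]] := bs y dy by_; exists x => //; exists z.
- by move=> x dx; rewrite -fb -fd dx linear0.
- by move=> x y _ _ [z [w E]]; exists (f z), (f w); rewrite -linearB E linearD fd fb.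
- move=> x y dx dy [z [w E]]; apply: (ai _ z w); last by rewrite linearB.
  by rewrite !linearB /= dx dy subr0.
- by move=> y dy; have [x [z [w [dx E]]]] := as_ y dy; exists x => //; exists z, w.
Qed.

Lemma dc_weq_comp (A B C : dcx) (f : {linear A -> B}) (g : {linear B -> C}) :
  dc_morph f -> dc_morph g -> dc_weq f -> dc_weq g -> dc_weq (g \o f).
Proof.
move=> [fd fb] [gd gb] [fbi fbs fai fas] [gbi gbs gai gas]; split=> /=.
- move=> x z dx bx gx; have [|||w] := gbi (f x) z.
  + by rewrite -fd dx linear0.
  + by rewrite -fb bx linear0.
  + by [].
  + exact: fbi.
- move=> z dz bz; have [y [w [dy by_ gy]]] := gbs z dz bz.
  have [x [v [dx bx fx]]] := fbs y dy by_; exists x, (g v + w); split=> //.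
  by rewrite !linearD /= -gy -!gb -!gd -fx linearB /= addrA subrK.
- move=> x z w dx gx; have [|z' [w' fx]] := gai (f x) z w _ gx.
    by rewrite -fb -fd dx linear0.
  exact: fai fx.
- move=> z dz; have [y [w1 [w2 [dy gy]]]] := gas z dz.
  have [x [v1 [v2 [dx fx]]]] := fas y dy; exists x, (g v1 + w1), (g v2 + w2); split=> //.
  by rewrite !linearD /= addrACA -gy -gb -gd -linearD -fx linearB /= addrA subrK.
Qed.

Lemma dc_weq_ext (A B : dcx) (f g : {linear A -> B}) : f =1 g -> dc_weq f -> dc_weq g.
Proof.
move=> E [bi bs ai as_]; split.
- by move=> x z; rewrite -E; exact: bi.
- by move=> y dy by_; have := bs y dy by_; under eq_exists do under eq_exists do rewrite E.
- by move=> x z w; rewrite -E; exact: ai.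
- move=> y dy; have := as_ y dy.
  by under eq_exists do under eq_exists do under eq_exists do rewrite E.
Qed.

Lemma dc_weq_bij (A B : dcx) (f : {linear A -> B}) : dc_morph f -> injective f ->
  (forall y, exists x, f x = y) -> dc_weq f.
Proof.
move=> [fd fb] fI fS; split.
- by move=> x z _ _; have [w <-] := fS z; rewrite -fb -fd => /fI ->; exists w.
- move=> y dy by_; have [x E] := fS y; exists x, 0; split.
  + by apply: fI; rewrite fd E dy linear0.
  + by apply: fI; rewrite fb E by_ linear0.
  + by rewrite E subrr !linear0.
- move=> x z w _; have [z' <-] := fS z; have [w' <-] := fS w.
  by rewrite -fb -fd -linearD => /fI ->; exists z', w'.
- move=> y dy; have [x E] := fS y; exists x, 0, 0; split.
    by apply: fI; rewrite fd fb E dy linear0.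
  by rewrite E subrr !linear0 addr0.
Qed.

Lemma dc_weq_cancel (A B C : dcx) (f : {linear A -> B}) (g : {linear B -> C}) :
  dc_morph f -> injective f -> (forall y, exists x, f x = y) ->
  dc_weq (g \o f) -> dc_weq g.
Proof.
move=> [fd fb] fI fS [bi bs ai as_]; split=> /=.
- move=> y z; have [x <-] := fS y; rewrite -fd -fb => dx bx gx.
  have [||w ->] := bi x z _ _ gx.
  + by apply: fI; rewrite dx linear0.
  + by apply: fI; rewrite bx linear0.
  + by exists (f w); rewrite fd fb.
- move=> y dy by_; have [x [z [dx bx E]]] := bs y dy by_.
  by exists (f x), z; rewrite -fd -fb dx bx linear0.
- move=> y z w; have [x <-] := fS y; rewrite -fb -fd => dx gx.
  have [|z' [w' ->]] := ai x z w _ gx; first by apply: fI; rewrite dx linear0.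
  by exists (f z'), (f w'); rewrite linearD fd fb.
- move=> y dy; have [x [z [w [dx E]]]] := as_ y dy.
  by exists (f x), z, w; rewrite -fb -fd dx linear0.
Qed.

(* Squares are injective: the elements on which pi o (1, d, b, d b) vanishes
   form a complement of a sum of squares, and the preimage of this complement
   under a surjection has the same cohomology. *)
Section Squares.
Variables (X Y C : dcx) (i : {linear X -> Y}) (p : {linear Y -> C}) (pi : {linear C -> C}).
Hypotheses (iM : dc_morph i) (pM : dc_morph p) (iI : injective i).
Hypothesis pS : forall c, exists y, p y = c.
Hypothesis pi_im : forall c, exists z, pi c = dc_d C (dc_b C z).
Hypothesis pi_id : forall z, pi (dc_d C (dc_b C z)) = dc_d C (dc_b C z).

Definition no_squares (c : C) : Prop :=
  [/\ pi c = 0, pi (dc_d C c) = 0, pi (dc_b C c) = 0 & dc_d C (dc_b C c) = 0].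

Hypothesis iX : forall y, no_squares (p y) <-> exists x, i x = y.

Let lift_pi c : exists t, dc_d C (dc_b C (p t)) = pi c.
Proof. by have [z ->] := pi_im c; have [t <-] := pS z; exists t. Qed.

Let pd y : p (dc_d Y y) = dc_d C (p y) := pM.1 y.
Let pb y : p (dc_b Y y) = dc_b C (p y) := pM.2 y.
Let id_ x : i (dc_d X x) = dc_d Y (i x) := iM.1 x.
Let ib x : i (dc_b X x) = dc_b Y (i x) := iM.2 x.

(** An element whose image in [C] is killed by $\partial\bar\partial$ is moved into [X] by
    subtracting boundaries: [t1] and [t2] remove what [pi] detects on the two differentials of
    [p y], and [t0] then what it detects on the element itself. *)
Let correct y : dc_d C (dc_b C (p y)) = 0 -> exists x t0 t1 t2,
  y = i x + (dc_b Y t1 - dc_d Y t2 + dc_d Y (dc_b Y t0)).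
Proof.
move=> Dy.
have [t1 t1E] := lift_pi (dc_d C (p y)).
have [t2 t2E] := lift_pi (dc_b C (p y)).
pose y1 := y - (dc_b Y t1 - dc_d Y t2).
have [t0 t0E] := lift_pi (p y1).
pose y2 := y1 - dc_d Y (dc_b Y t0).
have [|x xE] := (iX y2).1; last first.
  by exists x, t0, t1, t2; rewrite xE /y2 /y1 -(addrA y) -opprD subrK.
have py1 : p y1 = p y - dc_b C (p t1) + dc_d C (p t2).
  by rewrite /y1 linearB linearB /= pb pd opprB addrA addrAC.
have py2 : p y2 = p y1 - dc_d C (dc_b C (p t0)) by rewrite /y2 linearB /= pd pb.
have dy1 : dc_d C (p y1) = dc_d C (p y) - pi (dc_d C (p y)).
  by rewrite py1 linearD linearB /= dc_dd addr0 t1E.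
have by1 : dc_b C (p y1) = dc_b C (p y) - pi (dc_b C (p y)).
  by rewrite py1 linearD linearB /= dc_bb subr0 dc_bd t2E.
have pipi c : pi (pi c) = pi c by have [z ->] := pi_im c; exact: pi_id.
split.
- by rewrite py2 t0E linearB /= pipi subrr.
- by rewrite py2 linearB /= dc_dd subr0 dy1 linearB /= pipi subrr.
- by rewrite py2 linearB /= dc_bdb subr0 by1 linearB /= pipi subrr.
- rewrite py2 (linearB (dc_b C)) /= dc_bdb subr0 by1 linearB /= Dy sub0r.
  by have [z ->] := pi_im (dc_b C (p y)); rewrite dc_dd oppr0.
Qed.

Let D_correct y : dc_d C (dc_b C (p y)) = 0 ->
  exists x, dc_d Y (dc_b Y y) = i (dc_d X (dc_b X x)).
Proof.
move=> /correct[x [t0 [t1 [t2 ->]]]]; exists x.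
rewrite id_ ib !linearD !linearN /= dc_bb dc_bdb !linear0 add0r addr0 dc_bd.
by rewrite linearN opprK dc_dd addr0.
Qed.

Let X_ns x : no_squares (p (i x)).
Proof. by apply/iX; exists x. Qed.

(** The element [p (i x)] is killed by [pi] as it has no squares, and fixed by [pi] as it lies in
    the image of $\partial\bar\partial$. It is therefore zero, and [y] can be corrected into [X]. *)
Let incl_bc_inj x y : i x = dc_d Y (dc_b Y y) -> exists w, x = dc_d X (dc_b X w).
Proof.
move=> E; have [|w wE] := D_correct (y := y); last by exists w; apply: iI; rewrite E.
by have [] := X_ns x; rewrite E pd pb pi_id.
Qed.

Lemma incl_weq : dc_weq i.
Proof.
split.
- by move=> x z _ _; exact: incl_bc_inj.
- move=> y dy by_.
  (* Both differentials of [y] vanish, so [pi (p y)] is the only obstruction to lying in [X], and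
     subtracting $\partial\bar\partial t$ does not change the Bott-Chern class. *)
  have [t tE] := lift_pi (p y).
  have [|x xE] := (iX (y - dc_d Y (dc_b Y t))).1.
    rewrite linearB /= pd pb tE; split.
    + by rewrite linearB /=; have [z ->] := pi_im (p y); rewrite pi_id subrr.
    + rewrite linearB /= -pd dy linear0 -tE dc_dd subr0; exact: linear0.
    + rewrite linearB /= -pb by_ linear0 -tE dc_bdb subr0; exact: linear0.
    + by rewrite linearB /= -pb by_ linear0 -tE dc_bdb subr0 linear0.
  exists x, (- t); split.
  + by apply: iI; rewrite id_ xE linearB /= dy dc_dd subr0 linear0.
  + by apply: iI; rewrite ib xE linearB /= by_ dc_bdb subr0 linear0.
  + by rewrite xE addrC addKr !linearN.
(* Aeppli injectivity is reduced to Bott-Chern injectivity: after correction, the boundaries of [y1]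
   and [y2] come from [X] up to elements of the form $\partial\bar\partial(t_1+s_2)$. *)
- move=> x y1 y2 _ E.
  have [_ px1 px2 _] := X_ns x.
  have D1 : dc_d C (dc_b C (p y1)) = 0.
    move: px2; rewrite E linearD /= pd pb linearD /= dc_bb addr0 dc_bd linearN /= pi_id.
    by move=> /eqP; rewrite oppr_eq0 => /eqP.
  have D2 : dc_d C (dc_b C (p y2)) = 0.
    by move: px1; rewrite E linearD /= pd pb linearD /= dc_dd add0r pi_id.
  have [x1 [t0 [t1 [t2 E1]]]] := correct D1.
  have [x2 [s0 [s1 [s2 E2]]]] := correct D2.
  have F1 : dc_d Y y1 = i (dc_d X x1) + dc_d Y (dc_b Y t1).
    by rewrite E1 !linearD !linearN /= !dc_dd id_ subr0 addr0.
  have F2 : dc_b Y y2 = i (dc_b X x2) + dc_d Y (dc_b Y s2).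
    by rewrite E2 !linearD !linearN /= dc_bb dc_bdb ib add0r addr0 dc_bd opprK.
  have [|w wE] := @incl_bc_inj (x - (dc_d X x1 + dc_b X x2)) (t1 + s2).
    rewrite linearB E F1 F2 (linearD i) (linearD (dc_b Y)) (linearD (dc_d Y)). by rewrite addrACA [LHS]addrC addKr.
  exists (x1 + dc_b X w), x2; rewrite linearD /= -wE addrAC.
  by rewrite addrC subrK.
- move=> y Dy; have [|x [t0 [t1 [t2 E]]]] := @correct y.
    by rewrite -pb -pd Dy linear0.
  exists x, (t2 - dc_b Y t0), (- t1); split.
    apply: iI; rewrite linear0 id_ ib.
    move: Dy; rewrite E !linearD !linearN /= dc_bb dc_bdb !linear0 add0r addr0 dc_bd.
    by rewrite linearN opprK dc_dd addr0.
  rewrite E opprD addrA subrr add0r !opprD opprK linearB linearN /=.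
  by rewrite addrC addrA addrAC [- _ + dc_d Y t2]addrC.
Qed.
End Squares.

(* With J(A) the injective hull of A, the cone is the quotient of B + J(A) by A,
   in coordinates where the first component of J(A) is zero; the extension of
   the cone by A is B + J(A) itself, hence equivalent to B. *)
Section Cone.
Variables (A B : dcx) (f : {linear A -> B}).
Hypothesis fM : dc_morph f.
Definition cone : lmodType k := (B * (A * (A * A)))%type.

Let fd x : f (dc_d A x) = dc_d B (f x) := fM.1 x.
Let fb x : f (dc_b A x) = dc_b B (f x) := fM.2 x.

(** An element $(\alpha,\beta,\gamma,\delta)$ of the coinduced $J(A)$ records a value and the values
    of its images under $\partial$, $\bar\partial$, $\partial\bar\partial$. So $\partial$ sends it
    to $(\beta,0,-\delta,0)$ and $\bar\partial$ sends it to $(\gamma,\delta,0,0)$. The formulas here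
    and in [cone_b_fun] result from subtracting the image of the new first component under
    $a\mapsto(fa,a,\partial a,\bar\partial a,\partial\bar\partial a)$. *)
Definition cone_d_fun (c : cone) : cone :=
  let: (b, (be, (ga, de))) := c in
  (dc_d B b - f be, (- dc_d A be, (- de - dc_b A be, - dc_d A (dc_b A be)))).
Lemma cone_d_linear : linear cone_d_fun.
Proof.
move=> a [b [be [ga de]]] [b' [be' [ga' de']]] /=; congr (_, (_, (_, _)));
  rewrite /= !linearP /= ?scalerN ?scalerDr ?scalerN ?opprD; try exact: addrACA; by [].
Qed.
Definition cone_d : {linear cone -> cone} := linpack cone_d_linear.

Definition cone_b_fun (c : cone) : cone :=
  let: (b, (be, (ga, de))) := c in
  (dc_b B b - f ga, (de - dc_d A ga, (- dc_b A ga, - dc_d A (dc_b A ga)))).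
Lemma cone_b_linear : linear cone_b_fun.
Proof.
move=> a [b [be [ga de]]] [b' [be' [ga' de']]] /=; congr (_, (_, (_, _)));
  rewrite /= !linearP /= ?scalerN ?scalerDr ?scalerN ?opprD; try exact: addrACA; by [].
Qed.
Definition cone_b : {linear cone -> cone} := linpack cone_b_linear.

Lemma cone_dd c : cone_d (cone_d c) = 0.
Proof.
case: c => b [be [ga de]]; congr (_, (_, (_, _))) => /=.
- by rewrite (linearB (dc_d B)) /= dc_dd (linearN f) /= fd opprK sub0r addNr.
- by rewrite (linearN (dc_d A)) /= dc_dd !oppr0.
- by rewrite (linearN (dc_b A)) /= dc_bd !opprK subrr.
- by rewrite !linearN /= dc_dbd !oppr0.
Qed.

Lemma cone_bb c : cone_b (cone_b c) = 0.
Proof.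
case: c => b [be [ga de]]; congr (_, (_, (_, _))) => /=.
- by rewrite (linearB (dc_b B)) /= dc_bb (linearN f) /= fb opprK sub0r addNr.
- by rewrite (linearN (dc_d A)) /= opprK addNr.
- by rewrite (linearN (dc_b A)) /= dc_bb !oppr0.
- by rewrite !linearN /= dc_bb linear0 !oppr0.
Qed.

Lemma cone_db b be ga de : cone_d (cone_b (b, (be, (ga, de)))) =
  (dc_d B (dc_b B b) - f de, (- dc_d A de, (- dc_b A de, - dc_d A (dc_b A de)))).
Proof.
rewrite /=; congr (_, (_, (_, _))).
- rewrite (linearB (dc_d B)) (linearB f) /= !fd opprB addrA.
  by rewrite subrK.
- by rewrite (linearB (dc_d A)) /= dc_dd subr0.
- rewrite opprK (linearB (dc_b A)) /= dc_bd opprK.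
  by rewrite opprD addrCA subrr addr0.
- by rewrite !(linearB (dc_b A)) /= dc_bd opprK linearD /= dc_dd addr0.
Qed.

Lemma cone_anticomm c : cone_d (cone_b c) + cone_b (cone_d c) = 0.
Proof.
case: c => b [be [ga de]]; rewrite cone_db /=; congr (_, (_, (_, _))) => /=.
- rewrite (linearB (dc_b B)) (linearB f) (linearN f) /= fb opprB opprK.
  by rewrite [in X in _ + X]addrA subrK dc_bd addrACA subrr addNr addr0.
- rewrite (linearB (dc_d A)) (linearN (dc_d A)) /= opprB opprK.
  by rewrite addKr addNr.
- by rewrite (linearB (dc_b A)) (linearN (dc_b A)) /= dc_bb subr0 opprK addNr.
- by rewrite (linearB (dc_b A)) (linearN (dc_b A)) /= dc_bb subr0 linearN opprK addNr.
Qed.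

Definition cone_dcx : dcx := Dcx cone_dd cone_bb cone_anticomm.

Definition ext_sort : lmodType k := (A * cone)%type.
Definition ext_d_fun (y : ext_sort) : ext_sort := (dc_d A y.1 + y.2.2.1, cone_d y.2).
Lemma ext_d_linear : linear ext_d_fun.
Proof.
move=> a x y; congr pair => /=; last exact: cone_d_linear.
by rewrite linearP scalerDr /= addrACA.
Qed.
Definition ext_d : {linear ext_sort -> ext_sort} := linpack ext_d_linear.
Definition ext_b_fun (y : ext_sort) : ext_sort := (dc_b A y.1 + y.2.2.2.1, cone_b y.2).
Lemma ext_b_linear : linear ext_b_fun.
Proof.
move=> a x y; congr pair => /=; last exact: cone_b_linear.
by rewrite linearP scalerDr /= addrACA.
Qed.
Definition ext_b : {linear ext_sort -> ext_sort} := linpack ext_b_linear.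

Lemma ext_dd y : ext_d (ext_d y) = 0.
Proof.
case: y => a c; congr pair; last exact: cone_dd.
by case: c => b [be [ga de]]; rewrite /= linearD /= dc_dd add0r subrr.
Qed.
Lemma ext_bb y : ext_b (ext_b y) = 0.
Proof.
case: y => a c; congr pair; last exact: cone_bb.
by case: c => b [be [ga de]]; rewrite /= linearD /= dc_bb add0r subrr.
Qed.
Lemma ext_anticomm y : ext_d (ext_b y) + ext_b (ext_d y) = 0.
Proof.
case: y => a c; congr pair; last exact: cone_anticomm.
case: c => b [be [ga de]]; rewrite /= (linearD (dc_d A)) (linearD (dc_b A)) /=.
have -> : dc_d A (dc_b A a) + dc_d A ga + (de - dc_d A ga) = dc_d A (dc_b A a) + de.
  by rewrite addrACA subrr addr0.
have -> : dc_b A (dc_d A a) + dc_b A be + (- de - dc_b A be) = dc_b A (dc_d A a) - de.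
  by rewrite addrACA subrr addr0.
by rewrite addrACA dc_db subrr addr0.
Qed.

Definition ext_dcx : dcx := Dcx ext_dd ext_bb ext_anticomm.

(** The projection $B\oplus J(A)\to B$ in these coordinates: the summand [A] sits in $B\oplus J(A)$
    with [B]-component [f]. *)
Definition ext_map_fun (y : ext_sort) : B := f y.1 + y.2.1.
Lemma ext_map_linear : linear ext_map_fun.
Proof. by move=> a x y; rewrite /ext_map_fun /= linearP scalerDr addrACA. Qed.
Definition ext_map : {linear ext_sort -> B} := linpack ext_map_linear.

Lemma ext_map_morph : @dc_morph ext_dcx B ext_map.
Proof.
split=> [[a [b [be [ga de]]]]|[a [b [be [ga de]]]]]; rewrite /= /ext_map_fun /= !linearD /=.
  by rewrite fd addrACA subrr addr0.
by rewrite fb addrACA subrr addr0.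
Qed.

Lemma ext_db a b be ga de : ext_d (ext_b (a, (b, (be, (ga, de))))) =
  (dc_d A (dc_b A a) + de, (dc_d B (dc_b B b) - f de,
    (- dc_d A de, (- dc_b A de, - dc_d A (dc_b A de))))).
Proof.
rewrite -(cone_db b be ga de); congr pair => /=; rewrite linearD /=.
by rewrite addrACA subrr addr0.
Qed.

Lemma ext_map_weq : @dc_weq ext_dcx B ext_map.
Proof.
split.
- move=> [a [b [be [ga de]]]] z yd yb E.
  have /= be_ := congr1 (fun y : ext_sort => y.1) yd.
  have /= ga_ := congr1 (fun y : ext_sort => y.1) yb.
  have /= de_ := congr1 (fun y : ext_sort => y.2.2.1) yb.
  (* When both differentials vanish, [be], [ga] and [de] are determined by [a]. Placing [a] in the
     last slot produces it under $\partial\bar\partial$, and [z] accounts for the component in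
     [B]. *)
  exists (0, (z, (0, (0, a)))); rewrite /= [RHS]ext_db.
  move: E; rewrite /= /ext_map_fun /= => <-.
  rewrite (addr0_eq be_) (addr0_eq ga_) !linear0 add0r addrC addKr.
  by move/eqP: de_; rewrite subr_eq0 => /eqP ->; rewrite -(addr0_eq ga_) linearN.
- move=> b db bb; exists (0, (b, (0, (0, 0)))), 0; split.
  + by rewrite /= /ext_d_fun /= !linear0 db ?subr0 ?oppr0 ?addr0.
  + by rewrite /= /ext_b_fun /= !linear0 bb ?subr0 ?oppr0 ?addr0.
  + by rewrite /= /ext_map_fun /= !linear0 add0r subrr.
- move=> [a [b [be [ga de]]]] z w; rewrite /= [X in X = _ -> _]ext_db => yD E.
  have /= de_ := congr1 (fun y : ext_sort => y.1) yD.
  (* The slot [be] of the first witness produces [a] under $\partial$; the last slots of the two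
     witnesses restore [ga] and [be], and the equation for [de] is the vanishing of
     $\partial\bar\partial$. *)
  exists (0, (z, (a, (0, - (ga + dc_b A a))))), (0, (w, (0, (0, be + dc_d A a)))).
  move: E; rewrite /= /ext_map_fun /= => E.
  congr (_, (_, (_, (_, _)))); rewrite /= !linear0 ?oppr0 ?subr0 ?addr0 ?add0r //.
  + by rewrite addrAC -E addrC addKr.
  + by rewrite addrCA addNr addr0.
  + by rewrite opprK addrK.
  + by rewrite -(addr0_eq de_).
- move=> b Db; exists (0, (b, (0, (0, 0)))), 0, 0; split.
    by rewrite /= [LHS]ext_db !linear0 Db ?subr0 ?oppr0 ?addr0.
  by rewrite /= /ext_map_fun /= !linear0 add0r addr0 subrr.
Qed.
End Cone.
End Ungraded.

(** * Weights *)

Section Weight.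
Variables (k : fieldType) (Q : bgoperad k) (G : forall n, Q n -> Prop).

Lemma weight_geW r n (x : Q n) : weight G r x -> weight_ge G r x.
Proof. by move=> wx; rewrite -[x]addr0; apply: weight_ge_add wx _ => //; exact: weight_ge_0. Qed.

Lemma weight_ge_le r s n (x : Q n) : (s <= r)%N -> weight_ge G r x -> weight_ge G s x.
Proof.
move=> sr; elim=> [|t y z rt wy _ IH]; first exact: weight_ge_0.
by apply: weight_ge_add wy IH; exact: leq_trans rt.
Qed.

Lemma weight_geD r n (x y : Q n) : weight_ge G r x -> weight_ge G r y -> weight_ge G r (x + y).
Proof.
move=> wx wy; elim: wx => [|t z u rt wz _ IH]; first by rewrite add0r.
by rewrite -addrA; exact: weight_ge_add rt wz IH.
Qed.

Lemma weightZ r n a (x : Q n) : weight G r x -> weight G r (a *: x).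
Proof. by move=> wx; rewrite -[a *: x]addr0; apply: weight_lin => //; exact: weight_0. Qed.

Lemma weight_geZ r n a (x : Q n) : weight_ge G r x -> weight_ge G r (a *: x).
Proof.
elim=> [|t z u rt wz _ IH]; first by rewrite scaler0; exact: weight_ge_0.
by rewrite scalerDr; exact: weight_ge_add rt (weightZ a wz) IH.
Qed.

Lemma weight_ge_act r n (s : 'S_n) (x : Q n) : weight_ge G r x -> weight_ge G r (sm_act Q s x).
Proof.
elim=> [|t z u rt wz _ IH]; first by rewrite linear0; exact: weight_ge_0.
by rewrite linearD; exact: weight_ge_add rt (weight_act s wz) IH.
Qed.

Lemma weight_ge_pcomp r s m n l (e : l.+1 = (m + n)%N) (i : 'I_m) (x : Q m) (y : Q n) :
  weight_ge G r x -> weight_ge G s y -> weight_ge G (r + s) (og_pcomp Q e i x y).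
Proof.
move=> wx wy; elim: wx => [|t z u rt wz _ IH]; first by rewrite pcomp0l; exact: weight_ge_0.
rewrite pcompDl; apply: weight_geD IH.
elim: wy => [|t' z' u' rt' wz' _ IH]; first by rewrite pcomp0r; exact: weight_ge_0.
rewrite pcompDr; apply: weight_ge_add IH; first exact: leq_add rt rt'.
exact: weight_pcomp.
Qed.
End Weight.

Lemma weight_ge_map (k : fieldType) (Q R : bgoperad k) (G : forall n, Q n -> Prop)
    (H : forall n, R n -> Prop) (f : bgopmorph Q R) :
  (forall n x, G n x -> H n (f n x)) ->
  forall r n x, weight_ge G r x -> weight_ge H r (f n x).
Proof.
move=> GH; have wH r n x : weight G r x -> weight H r (f n x).
  elim=> {r n x} [|n x Gx|t n s x _ IH|t s m n l e i x y _ IHx _ IHy|t n|t n a x y _ IHx _ IHy].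
  - rewrite bom_id; exact: weight_id.
  - exact/weight_gen/GH.
  - rewrite smm_act; exact: weight_act.
  - rewrite bom_pcomp; exact: weight_pcomp.
  - rewrite linear0; exact: weight_0.
  - rewrite linearP; exact: weight_lin.
move=> r n x; elim=> [|t z u rt wz _ IH]; first by rewrite linear0; exact: weight_ge_0.
by rewrite linearD; exact: weight_ge_add rt (wH _ _ _ wz) IH.
Qed.

Definition gens (k : fieldType) (M : bgsmod k) (Q : bgoperad k) (iota : smmorph M Q)
  n (x : Q n) : Prop := exists g, x = iota n g.

Section Decomposable.
Variables (k : fieldType) (M : bgsmod k) (Q : bgoperad k) (iota : smmorph M Q).
Hypotheses (Qgen : op_generated iota) (M0 : is_zero (M 0%N)) (M1 : is_zero (M 1%N)).

Let Q0 : is_zero (Q 0%N) := arity0 Qgen M0 M1.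
Let Q1 (x : Q 1%N) : exists a, x = a *: og_id Q := low_arity Qgen M0 M1 x.

(* Composites with elements of arity 0 or 1 are trivial, which leaves the
   composites of two elements of arity at least 2. *)
Lemma reduced_ind (S : forall n, Q n -> Prop) :
  (forall n, S n 0) ->
  (forall n a (x y : Q n), S n x -> S n y -> S n (a *: x + y)) ->
  S 1%N (og_id Q) ->
  (forall n (x : M n), S n (iota n x)) ->
  (forall n (s : 'S_n) (x : Q n), S n x -> S n (sm_act Q s x)) ->
  (forall m n l (e : l.+1 = (m + n)%N) (i : 'I_m) (x : Q m) (y : Q n),
     (2 <= m)%N -> (2 <= n)%N -> S m x -> S n y -> S l (og_pcomp Q e i x y)) ->
  forall n x, S n x.
Proof.
move=> S0 SL Sid Sgen Sact Spc; apply: Qgen => // m n l e i c d x y _ _ Sx Sy.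
have SZ q a (z : Q q) : S q z -> S q (a *: z).
  by move=> Sz; rewrite -[_ *: _]addr0; exact: SL.
case: m e i x Sx => [|[|m]] e i x Sx; first by case: i.
  have ? : n = l by lia.
  by subst n; have [a ->] := Q1 x; rewrite pcompZl og_idl; exact: SZ.
case: n e y Sy => [|[|n]] e y Sy; first by rewrite (Q0 y) pcomp0r.
  have ? : m.+2 = l by lia.
  by subst l; have [a ->] := Q1 y; rewrite pcompZr og_idr; exact: SZ.
exact: Spc.
Qed.

(** A nontrivial composite has two factors of arity at least two, each of weight at least one. In an
    arity without generators everything is thus decomposable, which is the source of minimality. *)
Lemma weight_ge12 n (x : Q n) : (2 <= n)%N ->
  weight_ge (gens iota) 1 x /\ (is_zero (M n) -> weight_ge (gens iota) 2 x).
Proof.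
move: n x; apply: reduced_ind => //.
- by move=> n _; split=> [|_]; exact: weight_ge_0.
- move=> n a x y Sx Sy n2; have [x1 x2] := Sx n2; have [y1 y2] := Sy n2.
  split=> [|Mn]; first exact: weight_geD (weight_geZ a x1) y1.
  exact: weight_geD (weight_geZ a (x2 Mn)) (y2 Mn).
- move=> n x n2; split; first by apply/weight_geW/weight_gen; exists x.
  by move=> Mn; rewrite (Mn x) linear0; exact: weight_ge_0.
- move=> n s x Sx n2; have [x1 x2] := Sx n2; split=> [|Mn]; apply: weight_ge_act => //.
  exact: x2.
- move=> m n l e i x y m2 n2 /(_ m2)[x1 _] /(_ n2)[y1 _] _.
  have H := weight_ge_pcomp e i x1 y1.
  by split=> [|_] //; exact: weight_ge_le H.
Qed.

Lemma pcomp_weight_ge2 m n l (e : l.+1 = (m + n)%N) (i : 'I_m) (x : Q m) (y : Q n) :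
  (2 <= m)%N -> (2 <= n)%N -> weight_ge (gens iota) 2 (og_pcomp Q e i x y).
Proof.
move=> m2 n2; have [x1 _] := weight_ge12 x m2; have [y1 _] := weight_ge12 y n2.
exact: weight_ge_pcomp x1 y1.
Qed.

(** Two derivations turn a composite of elements of arity at least two into a sum of such
    composites, all of weight at least two; only generators remain to be tested. *)
Lemma deriv2_weight_ge2 c d (del del' : forall n, {linear Q n -> Q n}) :
  is_deriv c del -> is_deriv d del' ->
  (forall n (x : M n), weight_ge (gens iota) 2 (del n (del' n (iota n x)))) ->
  forall n x, weight_ge (gens iota) 2 (del n (del' n x)).
Proof.
move=> dP dP' H; apply: reduced_ind => //.
- by move=> n; rewrite !linear0; exact: weight_ge_0.
- by move=> n a x y Sx Sy; rewrite !linearP; apply/weight_geD/Sy/weight_geZ.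
- by rewrite (dv_id dP') linear0; exact: weight_ge_0.
- by move=> n s x Sx; rewrite (dv_act dP') (dv_act dP); exact: weight_ge_act.
- move=> m n l e i x y m2 n2 _ _.
  rewrite (dv_pcomp dP') linearD /= !(dv_pcomp dP).
  by do !apply: weight_geD; exact: pcomp_weight_ge2.
Qed.
End Decomposable.

(** * The cone of a morphism *)

Section ConeModule.
Variables (k : fieldType) (X P : operad k) (phi : opmorph X P).

Definition dcx_ar (Q : operad k) m : dcx k := dcx_of (op_ar Q m).

Lemma phi_morph m : @dc_morph k (dcx_ar X m) (dcx_ar P m) (phi m).
Proof. by split=> x /=; rewrite ?om_del ?om_delbar. Qed.

(** The shifts are the bidegrees of $\partial$, $\bar\partial$ and $\partial\bar\partial$, whose
    values the last three slots record. *)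
Definition cone_sm : bgsmod k :=
  smsum P (smsum (smshift (1, 0) X) (smsum (smshift (0, 1) X) (smshift (1, 1) X))).

Definition csm_d m : {linear cone_sm m -> cone_sm m} :=
  @cone_d k (dcx_ar X m) (dcx_ar P m) (phi m).
Definition csm_b m : {linear cone_sm m -> cone_sm m} :=
  @cone_b k (dcx_ar X m) (dcx_ar P m) (phi m).

Lemma homogN (A : bgvect k) d (x : A) : homog d x -> homog d (- x).
Proof. by move=> xd; rewrite -scaleN1r; exact: homogZ. Qed.

Lemma homog_cone m d b be ga de : homog d ((b, (be, (ga, de))) : cone_sm m) <->
  [/\ homog d (b : P m), homog (d + (1, 0)) (be : X m), homog (d + (0, 1)) (ga : X m) &
      homog (d + (1, 1)) (de : X m)].
Proof.
split; first by move=> /homog_pair[? /homog_pair[? /homog_pair[? ?]]].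
by move=> [? ? ? ?]; apply/homog_pair; split=> //; apply/homog_pair; split=> //;
  apply/homog_pair.
Qed.

Let h10 (Q : operad k) m d (x : Q m) : homog d x -> homog (d + (1, 0)) (op_del Q m x).
Proof. exact: (bc_del_bideg (op_bicomplex Q m)). Qed.
Let h01 (Q : operad k) m d (x : Q m) : homog d x -> homog (d + (0, 1)) (op_delbar Q m x).
Proof. exact: (bc_delbar_bideg (op_bicomplex Q m)). Qed.
Let hphi m d (x : X m) : homog d x -> homog d (phi m x).
Proof. by move=> xd; rewrite -[d]addr0; exact: smm_bideg. Qed.

Lemma bideg11 d : d + (1, 1) = d + (1, 0) + (0, 1) :> bideg.
Proof. by rewrite -addrA. Qed.
Lemma bideg11' d : d + (1, 1) = d + (0, 1) + (1, 0) :> bideg.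
Proof. by rewrite -addrA. Qed.

Lemma csm_d_bideg m : has_bideg (1, 0) (csm_d m).
Proof.
move=> d [b [be [ga de]]] /homog_cone[hb hbe hga hde]; apply/homog_cone; split.
- by apply: homogD; [exact: h10|apply: homogN; exact: hphi].
- by apply: homogN; exact: h10.
- by apply: homogD; apply: homogN; [rewrite -bideg11|exact: h01].
- by apply: homogN; rewrite bideg11'; apply: h10; exact: h01.
Qed.

Lemma csm_b_bideg m : has_bideg (0, 1) (csm_b m).
Proof.
move=> d [b [be [ga de]]] /homog_cone[hb hbe hga hde]; apply/homog_cone; split.
- by apply: homogD; [exact: h01|apply: homogN; exact: hphi].
- by apply: homogD; [rewrite -bideg11'|apply: homogN; exact: h10].
- by apply: homogN; exact: h01.
- by apply: homogN; rewrite bideg11'; apply: h10; exact: h01.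
Qed.

Lemma csm_d_act m (s : 'S_m) x : csm_d m (sm_act cone_sm s x) = sm_act cone_sm s (csm_d m x).
Proof.
case: x => b [be [ga de]].
congr (_, (_, (_, _))) => /=; rewrite ?smm_act ?op_act_delbar ?op_act_del ?op_act_delbar.
- by rewrite linearB.
- by rewrite linearN.
- by rewrite linearB linearN.
- by rewrite linearN.
Qed.

Lemma csm_b_act m (s : 'S_m) x : csm_b m (sm_act cone_sm s x) = sm_act cone_sm s (csm_b m x).
Proof.
case: x => b [be [ga de]].
congr (_, (_, (_, _))) => /=; rewrite ?smm_act ?op_act_delbar ?op_act_del ?op_act_delbar.
- by rewrite linearB.
- by rewrite linearB.
- by rewrite linearN.
- by rewrite linearN.
Qed.

Definition cdcx m : dcx k := @cone_dcx k (dcx_ar X m) (dcx_ar P m) (phi m) (phi_morph m).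

Lemma csm_dd m x : csm_d m (csm_d m x) = 0.
Proof. exact: (@dc_dd _ (cdcx m)). Qed.
Lemma csm_bb m x : csm_b m (csm_b m x) = 0.
Proof. exact: (@dc_bb _ (cdcx m)). Qed.
Lemma csm_bd m x : csm_b m (csm_d m x) = - csm_d m (csm_b m x).
Proof. exact: (@dc_bd _ (cdcx m)). Qed.

Definition cpr_b m (x : cone_sm m) : P m := x.1.
Definition cpr_be m (x : cone_sm m) : X m := x.2.1.
Definition cpr_ga m (x : cone_sm m) : X m := x.2.2.1.
Lemma cpr_b_lin m : linear (@cpr_b m). Proof. by []. Qed.
Lemma cpr_be_lin m : linear (@cpr_be m). Proof. by []. Qed.
Lemma cpr_ga_lin m : linear (@cpr_ga m). Proof. by []. Qed.
End ConeModule.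

Section Subspaces.
Variable k : fieldType.
Definition im_ssp (U V : lmodType k) (f : {linear U -> V}) : subspace V.
Proof.
apply: (@Subspace k V (fun x => exists z, x = f z)); first by exists 0; rewrite linear0.
by move=> a x y [z ->] [w ->]; exists (a *: z + w); rewrite linearP.
Defined.

Definition sspI (V : lmodType k) (W W' : subspace V) : subspace V.
Proof.
apply: (@Subspace k V (fun x => W x /\ W' x)); first by split; exact: ssp_0.
by move=> a x y [? ?] [? ?]; split; exact: ssp_lin.
Defined.

Definition ker_ssp (U V : lmodType k) (f : {linear U -> V}) : subspace U.
Proof.
apply: (@Subspace k U (fun x => f x = 0)); first by rewrite linear0.
by move=> a x y fx fy; rewrite linearP /= fx fy scaler0 addr0.
Defined.

Definition if_ssp (V : lmodType k) (Q : Prop) : subspace V.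
Proof.
apply: (@Subspace k V (fun x => ~ Q -> x = 0)) => // a x y xQ yQ nQ.
by rewrite xQ // yQ // scaler0 addr0.
Defined.

Definition sum_im_ssp (U V : lmodType k) (f g : {linear U -> V}) (W : subspace U) : subspace V.
Proof.
apply: (@Subspace k V (fun x => exists y z, [/\ W y, W z & x = f y + g z])).
  by exists 0, 0; split; rewrite ?linear0 ?addr0 //; exact: ssp_0.
move=> a x y [y1 [z1 [? ? ->]]] [y2 [z2 [? ? ->]]].
exists (a *: y1 + y2), (a *: z1 + z2); split; try exact: ssp_lin.
by rewrite !linearP /= scalerDr addrACA.
Defined.

Definition sspval (V : lmodType k) (W : subspace V) (x : ssp_sort W) : V := val x.
Lemma sspval_linear (V : lmodType k) (W : subspace V) : linear (@sspval V W).
Proof. by []. Qed.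
Definition ssp_valL (V : lmodType k) (W : subspace V) : {linear ssp_sort W -> V} :=
  linpack (@sspval_linear V W).
End Subspaces.

(** * Equivariant splitting of the cone *)

Section Splitting.
Variables (k : fieldType) (char0 : [pchar k] =i pred0).
Variables (N : bgsmod k) (d b : forall m, {linear N m -> N m}).
Hypotheses (d_bideg : forall m, has_bideg (1, 0) (d m)) (b_bideg : forall m, has_bideg (0, 1) (b m)).
Hypotheses (d_act : forall m (s : 'S_m) x, d m (sm_act N s x) = sm_act N s (d m x))
  (b_act : forall m (s : 'S_m) x, b m (sm_act N s x) = sm_act N s (b m x)).
Hypotheses (dd : forall m x, d m (d m x) = 0) (bb : forall m x, b m (b m x) = 0)
  (bd : forall m x, b m (d m x) = - d m (b m x)).

Lemma has_bideg_out (U V : bgvect k) c (f : {linear U -> V}) : has_bideg c f ->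
  forall e x, bg_proj V e (f x) = f (bg_proj U (e - c) x).
Proof. by move=> /has_bideg_proj fc e x; rewrite fc subrK. Qed.

Lemma has_bideg0_stable (U : bgvect k) (p : {linear U -> U}) : has_bideg 0 p ->
  forall e x, p (bg_proj U e x) = bg_proj U e (p x).
Proof. by move=> /has_bideg0_proj. Qed.

Section NoSquares.
Variable pi : forall m, {linear N m -> N m}.
Definition nsq m : subspace (N m) :=
  sspI (sspI (ker_ssp (pi m)) (ker_ssp (pi m \o d m)))
       (sspI (ker_ssp (pi m \o b m)) (ker_ssp (d m \o b m))).
End NoSquares.

(** [sp_pi] projects onto the image of $\partial\bar\partial$, [sp_E] is the part $C'$ without
    squares, and [sp_V] is spanned by the images of its two differentials. The kernel of [sp_rho] in
    [sp_E] is a complement of [sp_V], and will be the second layer of generators. *)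
Record splitting := Splitting {
  sp_pi : forall m, {linear N m -> N m};
  sp_im : forall m c, exists z, sp_pi m c = d m (b m z);
  sp_id : forall m z, sp_pi m (d m (b m z)) = d m (b m z);
  sp_E := nsq sp_pi;
  sp_V := fun m => sum_im_ssp (d m) (b m) (sp_E m);
  sp_rho : forall m, {linear N m -> N m};
  sp_rhoV : forall m x, sp_V m (sp_rho m x);
  sp_rhoid : forall m x, sp_V m x -> sp_rho m x = x;
  sp_Eproj : forall m e x, sp_E m x -> sp_E m (bg_proj (N m) e x);
  sp_Eact : forall m (s : 'S_m) x, sp_E m x -> sp_E m (sm_act N s x);
  sp_Vproj : forall m e x, sp_V m x -> sp_V m (bg_proj (N m) e x);
  sp_Vact : forall m (s : 'S_m) x, sp_V m x -> sp_V m (sm_act N s x);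
  sp_rho_proj : forall m e x, sp_rho m (bg_proj (N m) e x) = bg_proj (N m) e (sp_rho m x);
  sp_rho_act : forall m (s : 'S_m) x, sp_rho m (sm_act N s x) = sm_act N s (sp_rho m x) }.

(** Maschke's theorem is applied twice: the first projection has to be homogeneous and equivariant
    before [E], and with it [V], is a sub-S-module to which the second can be applied. *)
Lemma splitting_exists : inhabited splitting.
Proof.
pose W m : subspace (N m) := im_ssp (d m \o b m).
have WP m e x : W m x -> W m (bg_proj (N m) e x).
  move=> [z ->] /=; exists (bg_proj (N m) (e - (1, 0) - (0, 1)) z) => /=.
  by rewrite (has_bideg_out (d_bideg (m := m))) (has_bideg_out (b_bideg (m := m))).
have Wact m (s : 'S_m) x : W m x -> W m (sm_act N s x).
  by move=> [z ->] /=; exists (sm_act N s z); rewrite /= b_act d_act.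
have HW m := equivariant_projection char0 (WP m) (Wact m).
pose pi m := sval (cid (HW m)).
have piP m : [/\ forall x, W m (pi m x), forall x, W m x -> pi m x = x,
  has_bideg 0 (pi m) & forall (s : 'S_m) x, pi m (sm_act N s x) = sm_act N s (pi m x)].
  by rewrite /pi; case: cid.
clearbody pi.
have piB m e x : pi m (bg_proj (N m) e x) = bg_proj (N m) e (pi m x).
  by have [_ _ /has_bideg0_proj ->] := piP m.
have dP m e x : d m (bg_proj (N m) e x) = bg_proj (N m) (e + (1, 0)) (d m x).
  by have /has_bideg_proj -> := d_bideg (m := m).
have bP m e x : b m (bg_proj (N m) e x) = bg_proj (N m) (e + (0, 1)) (b m x).
  by have /has_bideg_proj -> := b_bideg (m := m).
have EP m e x : nsq pi m x -> nsq pi m (bg_proj (N m) e x).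
  by move=> [[/= x1 x2] [/= x3 x4]]; (do 2!split);
    rewrite /= ?bP ?dP ?piB ?(x1, x2, x3, x4) linear0.
have piA m (s : 'S_m) x : pi m (sm_act N s x) = sm_act N s (pi m x).
  by have [_ _ _ ->] := piP m.
have EA m (s : 'S_m) x : nsq pi m x -> nsq pi m (sm_act N s x).
  by move=> [[/= x1 x2] [/= x3 x4]]; (do 2!split);
    rewrite /= ?b_act ?d_act ?piA ?(x1, x2, x3, x4) linear0.
pose V m := sum_im_ssp (d m) (b m) (nsq pi m).
have VP m e x : V m x -> V m (bg_proj (N m) e x).
  move=> [y [z [Ey Ez ->]]].
  exists (bg_proj (N m) (e - (1, 0)) y), (bg_proj (N m) (e - (0, 1)) z).
  by split; [exact: EP|exact: EP|rewrite dP bP !subrK linearD].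
have VA m (s : 'S_m) x : V m x -> V m (sm_act N s x).
  move=> [y [z [Ey Ez ->]]]; exists (sm_act N s y), (sm_act N s z).
  by split; [exact: EA|exact: EA|rewrite d_act b_act linearD].
have HV m := equivariant_projection char0 (VP m) (VA m).
pose rho m := sval (cid (HV m)).
have rhoP m : [/\ forall x, V m (rho m x), forall x, V m x -> rho m x = x,
  has_bideg 0 (rho m) & forall (s : 'S_m) x, rho m (sm_act N s x) = sm_act N s (rho m x)].
  by rewrite /rho; case: cid.
clearbody rho.
constructor; apply: (@Splitting pi _ _ rho) => //; try by move=> m; have [] := rhoP m.
- by move=> m; have [] := piP m.
- by move=> m z; have [_ H _ _] := piP m; apply: H; exists z.
- by move=> m e x; have [_ _ /has_bideg0_stable ->] := rhoP m.
Qed.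

Section SplittingTheory.
Variable sp : splitting.
Lemma sp_EE m x : sp_E sp m x <-> [/\ sp_pi sp m x = 0, sp_pi sp m (d m x) = 0,
  sp_pi sp m (b m x) = 0 & d m (b m x) = 0].
Proof. by split=> [[[? ?] [? ?]]|[? ? ? ?]]. Qed.
Lemma sp_db0 m x : sp_E sp m x -> d m (b m x) = 0.
Proof. by move=> /sp_EE[]. Qed.
Lemma sp_dE m x : sp_E sp m x -> sp_V sp m (d m x).
Proof. by move=> Ex; exists x, 0; split; rewrite ?linear0 ?addr0 //; exact: ssp_0. Qed.
Lemma sp_bE m x : sp_E sp m x -> sp_V sp m (b m x).
Proof. by move=> Ex; exists 0, x; split; rewrite ?linear0 ?add0r //; exact: ssp_0. Qed.
Lemma sp_dV m x : sp_V sp m x -> d m x = 0.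
Proof. by move=> [y [z [Ey Ez ->]]]; rewrite linearD /= dd sp_db0 // addr0. Qed.
Lemma sp_bV m x : sp_V sp m x -> b m x = 0.
Proof. by move=> [y [z [Ey Ez ->]]]; rewrite linearD /= bb bd sp_db0 // oppr0 addr0. Qed.
(** Both differentials vanish on [V], and [pi] vanishes there because of the conditions on $\partial
    x$ and $\bar\partial x$ in the definition of [E]. Hence [V] can be attached first. *)
Lemma sp_VE m x : sp_V sp m x -> sp_E sp m x.
Proof.
move=> Vx; have dx := sp_dV Vx; have bx := sp_bV Vx.
apply/sp_EE; rewrite dx bx !linear0; split=> //.
move: Vx => [y [z [/sp_EE[_ y2 _ _] /sp_EE[_ _ z3 _] ->]]].
by rewrite linearD /= y2 z3 addr0.
Qed.
End SplittingTheory.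
End Splitting.

(** * Two successive principal extensions *)

Lemma pe_gen_zero (k : fieldType) n (X Y : quasifree k) (j : opmorph X Y) (E : attaching n X)
    (u : smmorph (qf_gen X) (qf_gen Y)) (v : smmorph E (qf_gen Y)) :
  is_principal_ext j u v -> forall m, is_zero (qf_gen X m) -> is_zero (E m) ->
  is_zero (qf_gen Y m).
Proof.
move=> pe m X0 E0 y; have [[x e] [-> _]] := pe_sum pe y.
by rewrite /= (X0 x) (E0 e) !linear0 addr0.
Qed.

Definition bijective_map (A B : Type) (f : A -> B) : Prop :=
  injective f /\ forall y, exists x, f x = y.

Lemma pext_low_bij (k : fieldType) n (X Y : quasifree k) (j : opmorph X Y) (E : attaching n X)
    (v : smmorph E (qf_gen Y)) :
  (forall m x e, j m x + qf_iota Y m (v m e) = 0 -> x = 0 /\ e = 0) ->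
  (forall m y, (m <= n)%N -> exists x e, y = j m x + qf_iota Y m (v m e)) ->
  forall m, (m < n)%N -> bijective_map (j m).
Proof.
move=> jinj jsurj m mn; split.
  move=> x y E'; apply: subr0_eq.
  by have [] := jinj m (x - y) 0; rewrite // !linear0 addr0 linearB E' subrr.
move=> y; have [x [e ->]] := jsurj m y (ltnW mn).
exists x; rewrite (at_conc (a := E) _ e) ?linear0 ?addr0 // => E'.
by rewrite E' ltnn in mn.
Qed.

Section PairLinear.
Variables (k : fieldType) (U V W : lmodType k).
Lemma pair_lin_linear (f : {linear U -> V}) (g : {linear U -> W}) :
  linear (fun x => (f x, g x) : (V * W)%type).
Proof. by move=> a x y; congr pair; rewrite linearP. Qed.
Definition pair_lin f g : {linear U -> (V * W)%type} := linpack (pair_lin_linear f g).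
Lemma fst_linear : linear (fun x : (V * W)%type => x.1). Proof. by []. Qed.
Definition fst_lin : {linear (V * W)%type -> V} := linpack fst_linear.
Lemma snd_linear : linear (fun x : (V * W)%type => x.2). Proof. by []. Qed.
Definition snd_lin : {linear (V * W)%type -> W} := linpack snd_linear.
End PairLinear.

Lemma addrACA3 (V : zmodType) (a b c a' b' c' : V) :
  (a + a') + (b + b') + (c + c') = (a + b + c) + (a' + b' + c').
Proof. by rewrite [RHS]addrACA; congr (_ + _); exact: addrACA. Qed.

Section Step.
Variables (k : fieldType) (P : operad k).
Hypothesis (P1 : unit_arity1 P).

(** The invariant of the induction. Having no generators of arity [n] makes all of $X(n)$
    decomposable, so that attaching in arity [n] preserves the last clause. *)
Definition good (n : nat) (X : quasifree k) (phi : opmorph X P) : Prop :=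
  [/\ forall m, (m < 2)%N || (n <= m)%N -> is_zero (qf_gen X m),
      op_generated (qf_iota X),
      forall m, (m < n)%N -> @dc_weq k (dcx_ar X m) (dcx_ar P m) (phi m) &
      forall m x, weight_ge (gens (qf_iota X)) 2 (op_del X m (op_delbar X m x))].

Section TwoSteps.
Variables (n : nat) (X : quasifree k) (phi : opmorph X P).

(* Two successive extensions by S1 and S2: the differentials of S1 are
   (d10, d01) with values in X, and those of S2 are (c10 + sd, c01 + sb) with
   values in X + S1. *)
Section Twisted.
Variables (S1 S2 : bgsmod k).
Variables (d10 d01 : forall m, {linear S1 m -> X m}).
Variables (c10 c01 : forall m, {linear S2 m -> X m}).
Variables (sd sb : forall m, {linear S2 m -> S1 m}).
Variables (b1 : smmorph S1 P) (b2 : smmorph S2 P).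

(** An explicit model of arity [n] of the twice extended operad. The equivalence with $P(n)$ is
    assumed for this model, so it can be verified before the operads are constructed. *)
Definition tw_sort : lmodType k := (X n * (S1 n * S2 n))%type.
Definition tw_d_fun (y : tw_sort) : tw_sort :=
  (op_del X n y.1 + d10 n y.2.1 + c10 n y.2.2, (sd n y.2.2, 0)).
Lemma tw_d_linear : linear tw_d_fun.
Proof.
move=> a [x [s t]] [x' [s' t']]; congr (_, (_, _)); rewrite /= ?scaler0 ?addr0 //.
  by rewrite !linearP !scalerDr; exact: addrACA3.
exact: linearP.
Qed.
Definition tw_d : {linear tw_sort -> tw_sort} := linpack tw_d_linear.
Definition tw_b_fun (y : tw_sort) : tw_sort :=
  (op_delbar X n y.1 + d01 n y.2.1 + c01 n y.2.2, (sb n y.2.2, 0)).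
Lemma tw_b_linear : linear tw_b_fun.
Proof.
move=> a [x [s t]] [x' [s' t']]; congr (_, (_, _)); rewrite /= ?scaler0 ?addr0 //.
  by rewrite !linearP !scalerDr; exact: addrACA3.
exact: linearP.
Qed.
Definition tw_b : {linear tw_sort -> tw_sort} := linpack tw_b_linear.
Definition tw_map_fun (y : tw_sort) : P n := phi n y.1 + b1 n y.2.1 + b2 n y.2.2.
Lemma tw_map_linear : linear tw_map_fun.
Proof.
move=> a [x [s t]] [x' [s' t']]; rewrite /tw_map_fun /=.
by rewrite !linearP !scalerDr; exact: addrACA3.
Qed.
Definition tw_map : {linear tw_sort -> P n} := linpack tw_map_linear.

Lemma tw_dE x s t : tw_d (x, (s, t)) = (op_del X n x + d10 n s + c10 n t, (sd n t, 0)).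
Proof. by []. Qed.
Lemma tw_bE x s t : tw_b (x, (s, t)) = (op_delbar X n x + d01 n s + c01 n t, (sb n t, 0)).
Proof. by []. Qed.

Hypotheses (n2 : (2 <= n)%N) (Xgood : good n phi).
Hypotheses (S1_conc : forall m, m <> n -> is_zero (S1 m))
           (S2_conc : forall m, m <> n -> is_zero (S2 m)).
Hypotheses (d10_bideg : forall m, has_bideg (1, 0) (d10 m))
           (d01_bideg : forall m, has_bideg (0, 1) (d01 m))
           (c10_bideg : forall m, has_bideg (1, 0) (c10 m))
           (c01_bideg : forall m, has_bideg (0, 1) (c01 m))
           (sd_bideg : forall m, has_bideg (1, 0) (sd m))
           (sb_bideg : forall m, has_bideg (0, 1) (sb m)).
Hypotheses
  (d10_act : forall m (s : 'S_m) x, d10 m (sm_act S1 s x) = sm_act X s (d10 m x))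
  (d01_act : forall m (s : 'S_m) x, d01 m (sm_act S1 s x) = sm_act X s (d01 m x))
  (c10_act : forall m (s : 'S_m) x, c10 m (sm_act S2 s x) = sm_act X s (c10 m x))
  (c01_act : forall m (s : 'S_m) x, c01 m (sm_act S2 s x) = sm_act X s (c01 m x))
  (sd_act : forall m (s : 'S_m) x, sd m (sm_act S2 s x) = sm_act S1 s (sd m x))
  (sb_act : forall m (s : 'S_m) x, sb m (sm_act S2 s x) = sm_act S1 s (sb m x)).
Hypotheses (d10_del : forall m x, op_del X m (d10 m x) = 0)
  (d01_delbar : forall m x, op_delbar X m (d01 m x) = 0)
  (d_mixed : forall m x, op_del X m (d01 m x) + op_delbar X m (d10 m x) = 0)
  (b1_del : forall m x, phi m (d10 m x) = op_del P m (b1 m x))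
  (b1_delbar : forall m x, phi m (d01 m x) = op_delbar P m (b1 m x)).
Hypotheses (c10_del : forall m x, op_del X m (c10 m x) + d10 m (sd m x) = 0)
  (c01_delbar : forall m x, op_delbar X m (c01 m x) + d01 m (sb m x) = 0)
  (c_mixed : forall m x, (op_del X m (c01 m x) + d10 m (sb m x)) +
                         (op_delbar X m (c10 m x) + d01 m (sd m x)) = 0)
  (b2_del : forall m x, phi m (c10 m x) + b1 m (sd m x) = op_del P m (b2 m x))
  (b2_delbar : forall m x, phi m (c01 m x) + b1 m (sb m x) = op_delbar P m (b2 m x)).
Hypotheses (tw_dd : forall y, tw_d (tw_d y) = 0) (tw_bb : forall y, tw_b (tw_b y) = 0)
  (tw_db : forall y, tw_d (tw_b y) + tw_b (tw_d y) = 0).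
Definition tw_dcx : dcx k := Dcx tw_dd tw_bb tw_db.
Hypothesis tw_weq : @dc_weq k tw_dcx (dcx_ar P n) tw_map.

Let X0 : is_zero (qf_gen X 0%N). Proof. by case: Xgood => H _ _ _; exact: H. Qed.
Let X1 : is_zero (qf_gen X 1%N). Proof. by case: Xgood => H _ _ _; exact: H. Qed.
Let Xgen : op_generated (qf_iota X). Proof. by case: Xgood. Qed.

Let A1_equiv m (s : 'S_m) x :
  d10 m (sm_act S1 s x) + d01 m (sm_act S1 s x) = sm_act X s (d10 m x + d01 m x).
Proof. by rewrite d10_act d01_act linearD. Qed.
Let A1_closed m (x : S1 m) : let dx := d10 m x + d01 m x in
  op_del X m dx + op_delbar X m dx = 0.
Proof.
move=> dx; rewrite /dx (linearD (op_del X m)) (linearD (op_delbar X m)).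
by rewrite d10_del d01_delbar add0r addr0.
Qed.
Let A1 : attaching n X :=
  @Attaching k n X S1 S1_conc d10 d01 d10_bideg d01_bideg A1_equiv A1_closed.

Section Second.
Variables (Y1 : quasifree k) (j1 : opmorph X Y1) (u1 : smmorph (qf_gen X) (qf_gen Y1)).
Variables (w1 : smmorph S1 (qf_gen Y1)) (phi1 : opmorph Y1 P).
Hypotheses (pe1 : @is_principal_ext k n X Y1 j1 A1 u1 w1) (gen1 : op_generated (qf_iota Y1)).
Hypothesis phi1j : forall m x, phi1 m (j1 m x) = phi m x.
Hypothesis phi1w : forall m e, phi1 m (qf_iota Y1 m (w1 m e)) = b1 m e.
Hypothesis inj1 : forall m x e, j1 m x + qf_iota Y1 m (w1 m e) = 0 -> x = 0 /\ e = 0.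
Hypothesis surj1 : forall m y, (m <= n)%N -> exists x e, y = j1 m x + qf_iota Y1 m (w1 m e).

Let i1 m : {linear S1 m -> Y1 m} := qf_iota Y1 m \o w1 m.
Let i1_del m x : op_del Y1 m (i1 m x) = j1 m (d10 m x).
Proof. exact: (pe_del pe1). Qed.
Let i1_delbar m x : op_delbar Y1 m (i1 m x) = j1 m (d01 m x).
Proof. exact: (pe_delbar pe1). Qed.
Let i1_bideg m e (x : S1 m) : homog e x -> homog e (i1 m x).
Proof. by move=> xe; rewrite -[e]addr0; apply: smm_bideg; rewrite -[e]addr0; exact: smm_bideg. Qed.
Let j1_bideg m e (x : X m) : homog e x -> homog e (j1 m x).
Proof. by move=> xe; rewrite -[e]addr0; exact: smm_bideg. Qed.
Let i1_act m (s : 'S_m) x : i1 m (sm_act S1 s x) = sm_act Y1 s (i1 m x).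
Proof. by rewrite /= (smm_act w1) smm_act. Qed.

Let e10 m : {linear S2 m -> Y1 m} := (j1 m \o c10 m) \+ (i1 m \o sd m).
Let e01 m : {linear S2 m -> Y1 m} := (j1 m \o c01 m) \+ (i1 m \o sb m).
Let e10E m x : e10 m x = j1 m (c10 m x) + i1 m (sd m x). Proof. by []. Qed.
Let e01E m x : e01 m x = j1 m (c01 m x) + i1 m (sb m x). Proof. by []. Qed.

Let e10_act m (s : 'S_m) x : e10 m (sm_act S2 s x) = sm_act Y1 s (e10 m x).
Proof. by rewrite !e10E sd_act i1_act c10_act smm_act -linearD. Qed.
Let e01_act m (s : 'S_m) x : e01 m (sm_act S2 s x) = sm_act Y1 s (e01 m x).
Proof. by rewrite !e01E sb_act i1_act c01_act smm_act -linearD. Qed.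

Let e10_del m x : op_del Y1 m (e10 m x) = 0.
Proof. by rewrite e10E (linearD (op_del Y1 m)) i1_del -om_del -linearD c10_del linear0. Qed.
Let e01_delbar m x : op_delbar Y1 m (e01 m x) = 0.
Proof. by rewrite e01E (linearD (op_delbar Y1 m)) i1_delbar -om_delbar -linearD c01_delbar linear0. Qed.
(** The differentials of [S1] take values in [X], so $\partial\bar\partial$ of a generator from [S2]
    has no component along [S1]; the weight estimate depends on this. *)
Let e01_del m x : op_del Y1 m (e01 m x) = j1 m (op_del X m (c01 m x) + d10 m (sb m x)).
Proof. by rewrite e01E (linearD (op_del Y1 m)) i1_del -om_del -linearD. Qed.
Let e_mixed m x : op_del Y1 m (e01 m x) + op_delbar Y1 m (e10 m x) = 0.
Proof.
rewrite e01_del e10E (linearD (op_delbar Y1 m)) i1_delbar -om_delbar -(linearD (j1 m)).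
by rewrite -(linearD (j1 m)) c_mixed linear0.
Qed.

Let A2_equiv m (s : 'S_m) x :
  e10 m (sm_act S2 s x) + e01 m (sm_act S2 s x) = sm_act Y1 s (e10 m x + e01 m x).
Proof. rewrite e10_act e01_act; exact: esym (linearD (sm_act Y1 s) _ _). Qed.
Let A2_closed m (x : S2 m) : let dx := e10 m x + e01 m x in
  op_del Y1 m dx + op_delbar Y1 m dx = 0.
Proof.
move=> dx; rewrite /dx (linearD (op_del Y1 m)) (linearD (op_delbar Y1 m)).
by rewrite e10_del e01_delbar add0r addr0 e_mixed.
Qed.
Let e10_bideg m : has_bideg (1, 0) (e10 m).
Proof.
move=> e x xe; apply: homogD; first exact/j1_bideg/c10_bideg.
exact/i1_bideg/sd_bideg.
Qed.
Let e01_bideg m : has_bideg (0, 1) (e01 m).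
Proof.
move=> e x xe; apply: homogD; first exact/j1_bideg/c01_bideg.
exact/i1_bideg/sb_bideg.
Qed.
Let A2 : attaching n Y1 :=
  @Attaching k n Y1 S2 S2_conc e10 e01 e10_bideg e01_bideg A2_equiv A2_closed.

Let b2_del1 m x : phi1 m (e10 m x) = op_del P m (b2 m x).
Proof. by rewrite e10E (linearD (phi1 m)) phi1j [phi1 m (i1 m _)]phi1w b2_del. Qed.
Let b2_delbar1 m x : phi1 m (e01 m x) = op_delbar P m (b2 m x).
Proof. by rewrite e01E (linearD (phi1 m)) phi1j [phi1 m (i1 m _)]phi1w b2_delbar. Qed.

Let Y10 : is_zero (qf_gen Y1 0%N).
Proof. by apply: (pe_gen_zero pe1) => //; apply: S1_conc => n0; move: n2; rewrite -n0. Qed.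
Let Y11 : is_zero (qf_gen Y1 1%N).
Proof. by apply: (pe_gen_zero pe1) => //; apply: S1_conc => n0; move: n2; rewrite -n0. Qed.

Section Third.
Variables (Y2 : quasifree k) (j2 : opmorph Y1 Y2) (u2 : smmorph (qf_gen Y1) (qf_gen Y2)).
Variables (w2 : smmorph S2 (qf_gen Y2)) (phi2 : opmorph Y2 P).
Hypotheses (pe2 : @is_principal_ext k n Y1 Y2 j2 A2 u2 w2) (gen2 : op_generated (qf_iota Y2)).
Hypothesis phi2j : forall m x, phi2 m (j2 m x) = phi1 m x.
Hypothesis phi2w : forall m e, phi2 m (qf_iota Y2 m (w2 m e)) = b2 m e.
Hypothesis inj2 : forall m x e, j2 m x + qf_iota Y2 m (w2 m e) = 0 -> x = 0 /\ e = 0.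
Hypothesis surj2 : forall m y, (m <= n)%N -> exists x e, y = j2 m x + qf_iota Y2 m (w2 m e).

Let i2 m : {linear S2 m -> Y2 m} := qf_iota Y2 m \o w2 m.
Let i2_del m x : op_del Y2 m (i2 m x) = j2 m (e10 m x).
Proof. exact: (pe_del pe2). Qed.
Let i2_delbar m x : op_delbar Y2 m (i2 m x) = j2 m (e01 m x).
Proof. exact: (pe_delbar pe2). Qed.

(** The isomorphism from the model to arity [n] of [Y2], along which the assumed equivalence is
    transported. *)
Let theta_fun (y : tw_sort) : Y2 n := j2 n (j1 n y.1) + j2 n (i1 n y.2.1) + i2 n y.2.2.
Let theta_linear : linear theta_fun.
Proof.
move=> a [x [s t]] [x' [s' t']]; rewrite /theta_fun [_.1]/= [_.2.1]/= [_.2.2]/=.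
rewrite (linearP (j1 n)) !(linearP (i1 n)) !(linearP (j2 n)) (linearP (i2 n)) !scalerDr.
exact: addrACA3.
Qed.
Let theta : {linear tw_sort -> Y2 n} := linpack theta_linear.
Let thetaE x s t : theta (x, (s, t)) = j2 n (j1 n x) + j2 n (i1 n s) + i2 n t.
Proof. by []. Qed.

Let theta_inj : injective theta.
Proof.
move=> x y E'; apply: subr0_eq; have : theta (x - y) = 0 by rewrite linearB E' subrr.
by case: (x - y) => a [s t]; rewrite thetaE -linearD => /inj2[/inj1[-> ->] ->].
Qed.

Let theta_surj y : exists x, theta x = y.
Proof.
have [y1 [e2 ->]] := surj2 y (leqnn n); have [a [e1 ->]] := surj1 y1 (leqnn n).
by exists (a, (e1, e2)); rewrite thetaE -linearD.
Qed.

Let theta_d y : theta (tw_d y) = op_del Y2 n (theta y).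
Proof.
case: y => x [s t]; rewrite tw_dE.
rewrite !thetaE linear0 addr0 !(linearD (op_del Y2 n)) i2_del e10E -!om_del i1_del.
by rewrite -!(linearD (j2 n)) -!(linearD (j1 n)) addrA -(linearD (j1 n)).
Qed.
Let theta_b y : theta (tw_b y) = op_delbar Y2 n (theta y).
Proof.
case: y => x [s t]; rewrite tw_bE.
rewrite !thetaE linear0 addr0 !(linearD (op_delbar Y2 n)) i2_delbar e01E -!om_delbar i1_delbar.
by rewrite -!(linearD (j2 n)) -!(linearD (j1 n)) addrA -(linearD (j1 n)).
Qed.
Let theta_phi y : phi2 n (theta y) = tw_map y.
Proof.
case: y => x [s t]; rewrite thetaE !(linearD (phi2 n)) !phi2j phi1j.
by rewrite [phi2 n (i2 n _)]phi2w [phi1 n (i1 n _)]phi1w.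
Qed.

Let step_weq : @dc_weq k (dcx_ar Y2 n) (dcx_ar P n) (phi2 n).
Proof.
apply: (@dc_weq_cancel k tw_dcx (dcx_ar Y2 n) (dcx_ar P n) theta) => //.
by apply: dc_weq_ext tw_weq => y; rewrite -[LHS]theta_phi.
Qed.

Let step_weq_lt m : (m < n)%N -> @dc_weq k (dcx_ar Y2 m) (dcx_ar P m) (phi2 m).
Proof.
move=> mn; have [J1 J1'] := @pext_low_bij k n X Y1 j1 A1 w1 inj1 surj1 m mn.
have [J2 J2'] := @pext_low_bij k n Y1 Y2 j2 A2 w2 inj2 surj2 m mn.
apply: (@dc_weq_cancel k (dcx_ar Y1 m) (dcx_ar Y2 m) (dcx_ar P m) (j2 m) (phi2 m)) => //.
  by split=> x /=; rewrite ?om_del ?om_delbar.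
apply: (@dc_weq_cancel k (dcx_ar X m) (dcx_ar Y1 m) (dcx_ar P m) (j1 m) (phi2 m \o j2 m)) => //.
  by split=> x /=; rewrite ?om_del ?om_delbar.
case: Xgood => _ _ /(_ m mn) H _; apply: dc_weq_ext H => x.
by rewrite /= phi2j phi1j.
Qed.

Let iota2 := qf_iota Y2.
Let push_weight m (x : X m) : weight_ge (gens (qf_iota X)) 2 x ->
  weight_ge (gens iota2) 2 (j2 m (j1 m x)).
Proof.
move=> wx; apply: (weight_ge_map (f := j2) (G := gens (qf_iota Y1))).
  by move=> l y [g ->]; exists (u2 l g); rewrite (pe_j pe2).
apply: (weight_ge_map (f := j1) (G := gens (qf_iota X))) => // l y [g ->].
by exists (u1 l g); rewrite (pe_j pe1).
Qed.

(** By the invariant [X] has no generators in arity [n], so each of its elements there is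
    decomposable, and stays so in the extensions. *)
Let Xn_weight (x : X n) : weight_ge (gens iota2) 2 (j2 n (j1 n x)).
Proof.
apply: push_weight; apply: (weight_ge12 Xgen X0 X1 x n2).2.
by case: Xgood => H _ _ _; apply: H; rewrite leqnn orbT.
Qed.

Let Y2_zero m : is_zero (qf_gen X m) -> m <> n -> is_zero (qf_gen Y2 m).
Proof.
move=> Xm mn; apply: (pe_gen_zero pe2); last exact: S2_conc.
by apply: (pe_gen_zero pe1) => //; exact: S1_conc.
Qed.

Lemma step_good : good n.+1 phi2.
Proof.
have Yz m : (m < 2)%N || (n < m)%N -> is_zero (qf_gen Y2 m).
  move=> Hm; apply: Y2_zero; last by move=> mn; move: n2 Hm; rewrite mn ltnn orbF; lia.
  case: Xgood => H _ _ _; apply: H.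
  by case/orP: Hm => [->|/ltnW ->] //; rewrite orbT.
split=> //.
- move=> m; rewrite ltnS leq_eqVlt => /orP[/eqP ->|]; last exact: step_weq_lt.
  exact: step_weq.
apply: (deriv2_weight_ge2 gen2 _ _ (op_del_deriv Y2) (op_delbar_deriv Y2)).
- exact: Yz.
- exact: Yz.
(* A generator is the sum of one from [X], one from [S1] and one from [S2]. The invariant handles
   the first; for the other two $\partial\bar\partial$ lies in the image of $X(n)$. *)
move=> m g; have [[g1 e2] [-> _]] := pe_sum pe2 g.
rewrite (linearD (qf_iota Y2 m)) -(pe_j pe2) (linearD (op_delbar Y2 m)) (linearD (op_del Y2 m)).
rewrite -om_delbar -om_del; apply: weight_geD.
  have [[g0 e1] [-> _]] := pe_sum pe1 g1.
  rewrite (linearD (qf_iota Y1 m)) -(pe_j pe1) (linearD (op_delbar Y1 m)) (linearD (op_del Y1 m)).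
  rewrite (linearD (j2 m)) -(om_delbar j1) -(om_del j1).
  apply: weight_geD; first by apply: push_weight; case: Xgood.
  have [mn|mn] := eqVneq m n; last first.
    by rewrite (S1_conc (elimN eqP mn) e1) !linear0; exact: weight_ge_0.
  subst m; rewrite -[qf_iota Y1 n _]/(i1 n e1) i1_delbar -om_del; exact: Xn_weight.
have [mn|mn] := eqVneq m n; last first.
  by rewrite (S2_conc (elimN eqP mn) e2) !linear0; exact: weight_ge_0.
subst m; rewrite -[qf_iota Y2 n _]/(i2 n e2) i2_delbar -om_del e01_del; exact: Xn_weight.
Qed.
End Third.

Lemma second_step : exists (Y2 : quasifree k) (j2 : opmorph Y1 Y2) (phi2 : opmorph Y2 P),
  [/\ principal_ext j2, forall m x, phi2 m (j2 m x) = phi1 m x,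
      forall m, (m < n)%N -> bijective_map (j2 m) & good n.+1 phi2].
Proof.
have [Y2 [j2 [u2 [w2 [phi2 [[pe2 gen2] phi2j phi2w inj2 surj2]]]]]] :=
  @principal_extension k n Y1 A2 P phi1 b2 n2 Y10 Y11 gen1 P1 e10_act e01_act
    e10_del e01_delbar e_mixed b2_del1 b2_delbar1.
exists Y2, j2, phi2; split=> //.
- by exists n, A2, u2, w2.
- exact: (@pext_low_bij k n Y1 Y2 j2 A2 w2 inj2 surj2).
- exact: step_good pe2 gen2 phi2j phi2w inj2 surj2.
Qed.
End Second.

Lemma both_steps : exists (Y1 : quasifree k) (j1 : opmorph X Y1) (phi1 : opmorph Y1 P)
    (Y2 : quasifree k) (j2 : opmorph Y1 Y2) (phi2 : opmorph Y2 P),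
  [/\ principal_ext j1, forall m x, phi1 m (j1 m x) = phi m x &
      forall m, (m < n)%N -> bijective_map (j1 m)] /\
  [/\ principal_ext j2, forall m x, phi2 m (j2 m x) = phi1 m x,
      forall m, (m < n)%N -> bijective_map (j2 m) & good n.+1 phi2].
Proof.
have [Y1 [j1 [u1 [w1 [phi1 [[pe1 gen1] phi1j phi1w inj1 surj1]]]]]] :=
  @principal_extension k n X A1 P phi b1 n2 X0 X1 Xgen P1 d10_act d01_act
    d10_del d01_delbar d_mixed b1_del b1_delbar.
have [Y2 [j2 [phi2 H2]]] := second_step pe1 gen1 phi1j phi1w inj1 surj1.
exists Y1, j1, phi1, Y2, j2, phi2; split=> //; split=> //.
- by exists n, A1, u1, w1.
- exact: (@pext_low_bij k n X Y1 j1 A1 w1 inj1 surj1).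
Qed.
End Twisted.
End TwoSteps.
End Step.

(** * Attaching the cone without its squares *)

Section ConeStep.
Variables (k : fieldType) (P : operad k).
Hypothesis (P1 : unit_arity1 P).

Section ArityStep.
Variables (n : nat) (X : quasifree k) (phi : opmorph X P).
Hypotheses (n2 : (2 <= n)%N) (Xgood : good n phi).

Let N := cone_sm X P.
Let d m := csm_d phi m.
Let b m := csm_b phi m.
Variable sp : splitting d b.
Let E := sp_E sp.
Let V := sp_V sp.
Let rho := sp_rho sp.

Let X0 : is_zero (qf_gen X 0%N). Proof. by case: Xgood => H _ _ _; exact: H. Qed.
Let X1 : is_zero (qf_gen X 1%N). Proof. by case: Xgood => H _ _ _; exact: H. Qed.
Let Xgen : op_generated (qf_iota X). Proof. by case: Xgood. Qed.

Let V_d m x : V m x -> d m x = 0.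
Proof. exact: (sp_dV (@csm_dd _ _ _ phi)). Qed.
Let V_b m x : V m x -> b m x = 0.
Proof. exact: (sp_bV (@csm_bb _ _ _ phi) (@csm_bd _ _ _ phi)). Qed.
Let V_E m x : V m x -> E m x.
Proof. exact: (sp_VE (@csm_dd _ _ _ phi) (@csm_bb _ _ _ phi) (@csm_bd _ _ _ phi)). Qed.

Let be m : {linear N m -> X m} := linpack (@cpr_be_lin k X P m).
Let ga m : {linear N m -> X m} := linpack (@cpr_ga_lin k X P m).
Let bb m : {linear N m -> P m} := linpack (@cpr_b_lin k X P m).
Let de m (x : N m) : X m := x.2.2.2.

Let bb_d m x : bb m (d m x) = op_del P m (bb m x) - phi m (be m x).
Proof. by case: x => ? [? [? ?]]. Qed.
Let bb_b m x : bb m (b m x) = op_delbar P m (bb m x) - phi m (ga m x).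
Proof. by case: x => ? [? [? ?]]. Qed.
Let be_d m x : be m (d m x) = - op_del X m (be m x).
Proof. by case: x => ? [? [? ?]]. Qed.
Let ga_d m x : ga m (d m x) = - de x - op_delbar X m (be m x).
Proof. by case: x => ? [? [? ?]]. Qed.
Let be_b m x : be m (b m x) = de x - op_del X m (ga m x).
Proof. by case: x => ? [? [? ?]]. Qed.
Let ga_b m x : ga m (b m x) = - op_delbar X m (ga m x).
Proof. by case: x => ? [? [? ?]]. Qed.

Let be_bideg m e x : homog e (x : N m) -> homog (e + (1, 0)) (be m x).
Proof. by case: x => ? [? [? ?]] /homog_cone[]. Qed.
Let ga_bideg m e x : homog e (x : N m) -> homog (e + (0, 1)) (ga m x).
Proof. by case: x => ? [? [? ?]] /homog_cone[]. Qed.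
Let bb_bideg m e x : homog e (x : N m) -> homog e (bb m x).
Proof. by case: x => ? [? [? ?]] /homog_cone[]. Qed.

(** The two layers: [V], on which the cone differentials vanish, then the complement of [V] in [E]
    cut out by [rho]. Both are restricted to arity [n], as attaching data demand. *)
Let W1 m : subspace (N m) := sspI (V m) (if_ssp (N m) (m = n)).
Let W2 m : subspace (N m) :=
  sspI (sspI (E m) (ker_ssp (rho m))) (if_ssp (N m) (m = n)).

Let W1_proj m e x : W1 m x -> W1 m (bg_proj (N m) e x).
Proof. by move=> [Vx nx]; split; [exact: sp_Vproj|move=> /nx ->; rewrite linear0]. Qed.
Let W1_act m (s : 'S_m) x : W1 m x -> W1 m (sm_act N s x).
Proof. by move=> [Vx nx]; split; [exact: sp_Vact|move=> /nx ->; rewrite linear0]. Qed.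
Let W2_proj m e x : W2 m x -> W2 m (bg_proj (N m) e x).
Proof.
move=> [[Ex rx] nx]; split; last by move=> /nx ->; rewrite linear0.
by split; [exact: sp_Eproj|rewrite /= /rho sp_rho_proj [sp_rho _ _ _]rx linear0].
Qed.
Let W2_act m (s : 'S_m) x : W2 m x -> W2 m (sm_act N s x).
Proof.
move=> [[Ex rx] nx]; split; last by move=> /nx ->; rewrite linear0.
by split; [exact: sp_Eact|rewrite /= /rho sp_rho_act [sp_rho _ _ _]rx linear0].
Qed.

Let S1 : bgsmod k := smsub W1_proj W1_act.
Let S2 : bgsmod k := smsub W2_proj W2_act.
Let v1 m : {linear S1 m -> N m} := ssp_valL (W1 m).
Let v2 m : {linear S2 m -> N m} := ssp_valL (W2 m).

Let v1_bideg m e (x : S1 m) : homog e x -> homog e (v1 m x).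
Proof. by move/homog_sub. Qed.
Let v2_bideg m e (x : S2 m) : homog e x -> homog e (v2 m x).
Proof. by move/homog_sub. Qed.
Let v1P m (x : S1 m) : W1 m (v1 m x). Proof. exact: ssp_valP. Qed.
Let v2P m (x : S2 m) : W2 m (v2 m x). Proof. exact: ssp_valP. Qed.
Let v1_d m (x : S1 m) : d m (v1 m x) = 0. Proof. by apply: V_d; case: (v1P x). Qed.
Let v1_b m (x : S1 m) : b m (v1 m x) = 0. Proof. by apply: V_b; case: (v1P x). Qed.

Let S1_conc m : m <> n -> is_zero (S1 m).
Proof. by move=> mn x; apply: val_inj; case: (v1P x) => _ /(_ mn). Qed.
Let S2_conc m : m <> n -> is_zero (S2 m).
Proof. by move=> mn x; apply: val_inj; case: (v2P x) => _ /(_ mn). Qed.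

(** The coordinates [be] and [ga] are the [X]-parts of the two differentials of a cone element in
    the extension [ext_dcx]; attaching along them reproduces that extension. *)
Let d10 m : {linear S1 m -> X m} := be m \o v1 m.
Let d01 m : {linear S1 m -> X m} := ga m \o v1 m.

Let S1_del m (x : S1 m) : op_del X m (d10 m x) = 0.
Proof. by apply: oppr_inj; rewrite -be_d v1_d linear0 oppr0. Qed.
Let S1_delbar m (x : S1 m) : op_delbar X m (d01 m x) = 0.
Proof. by apply: oppr_inj; rewrite -ga_b v1_b linear0 oppr0. Qed.
Let S1_mixed m (x : S1 m) : op_del X m (d01 m x) + op_delbar X m (d10 m x) = 0.
Proof.
have := be_b (v1 m x); rewrite v1_b linear0 => /esym/eqP; rewrite subr_eq0 => /eqP <-.
have := ga_d (v1 m x); rewrite v1_d linear0 => /esym/eqP.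
by rewrite -opprD oppr_eq0 => /eqP.
Qed.

Let b1_bideg m : has_bideg 0 (bb m \o v1 m : {linear S1 m -> P m}).
Proof. by move=> e x xe; rewrite addr0; exact/bb_bideg/v1_bideg. Qed.
Let b1_act m (s : 'S_m) (x : S1 m) :
  (bb m \o v1 m) (sm_act S1 s x) = sm_act P s ((bb m \o v1 m) x).
Proof. by []. Qed.
Let b1 : smmorph S1 P := SmMorph b1_bideg b1_act.
Let b2_bideg m : has_bideg 0 (bb m \o v2 m : {linear S2 m -> P m}).
Proof. by move=> e x xe; rewrite addr0; exact/bb_bideg/v2_bideg. Qed.
Let b2_act m (s : 'S_m) (x : S2 m) :
  (bb m \o v2 m) (sm_act S2 s x) = sm_act P s ((bb m \o v2 m) x).
Proof. by []. Qed.
Let b2 : smmorph S2 P := SmMorph b2_bideg b2_act.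
Let b1_del m (x : S1 m) : phi m (d10 m x) = op_del P m (b1 m x).
Proof. by have := bb_d (v1 m x); rewrite v1_d linear0 => /esym/eqP; rewrite subr_eq0 => /eqP <-. Qed.
Let b1_delbar m (x : S1 m) : phi m (d01 m x) = op_delbar P m (b1 m x).
Proof. by have := bb_b (v1 m x); rewrite v1_b linear0 => /esym/eqP; rewrite subr_eq0 => /eqP <-. Qed.

Let c10 m : {linear S2 m -> X m} := be m \o v2 m.
Let c01 m : {linear S2 m -> X m} := ga m \o v2 m.
Let W2_d m x : W2 m x -> W1 m (d m x).
Proof. by move=> [[Ex _] nx]; split; [exact: sp_dE|move=> /nx ->; rewrite linear0]. Qed.
Let W2_b m x : W2 m x -> W1 m (b m x).
Proof. by move=> [[Ex _] nx]; split; [exact: sp_bE|move=> /nx ->; rewrite linear0]. Qed.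
Let dS m : {linear S2 m -> S1 m} := ssp_restr (@W2_d m).
Let bS m : {linear S2 m -> S1 m} := ssp_restr (@W2_b m).
Let v_dS m x : v1 m (dS m x) = d m (v2 m x). Proof. by []. Qed.
Let v_bS m x : v1 m (bS m x) = b m (v2 m x). Proof. by []. Qed.

Let dS_act m (s : 'S_m) x : dS m (sm_act S2 s x) = sm_act S1 s (dS m x).
Proof. by apply: val_inj; exact: csm_d_act. Qed.
Let bS_act m (s : 'S_m) x : bS m (sm_act S2 s x) = sm_act S1 s (bS m x).
Proof. by apply: val_inj; exact: csm_b_act. Qed.
Let dS_bideg m : has_bideg (1, 0) (dS m).
Proof. by move=> e x xe; apply/homog_sub; apply: csm_d_bideg; exact: v2_bideg. Qed.
Let bS_bideg m : has_bideg (0, 1) (bS m).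
Proof. by move=> e x xe; apply/homog_sub; apply: csm_b_bideg; exact: v2_bideg. Qed.

Let c10_del m x : op_del X m (c10 m x) + d10 m (dS m x) = 0.
Proof. by rewrite -[d10 m _]/(be m (d m (v2 m x))) be_d; exact: subrr. Qed.
Let c01_delbar m x : op_delbar X m (c01 m x) + d01 m (bS m x) = 0.
Proof. by rewrite -[d01 m _]/(ga m (b m (v2 m x))) ga_b; exact: subrr. Qed.
Let c_mixed m x : (op_del X m (c01 m x) + d10 m (bS m x)) +
  (op_delbar X m (c10 m x) + d01 m (dS m x)) = 0.
Proof.
rewrite -[d10 m _]/(be m (b m (v2 m x))) -[d01 m _]/(ga m (d m (v2 m x))) be_b ga_d.
rewrite -[c01 m x]/(ga m (v2 m x)) -[c10 m x]/(be m (v2 m x)).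
move: (de _) (op_del _ _ _) (op_delbar _ _ _) => p q r.
by rewrite [q + (p - q)]addrC subrK [r + (- p - r)]addrC subrK subrr.
Qed.
Let b2_del m x : phi m (c10 m x) + b1 m (dS m x) = op_del P m (b2 m x).
Proof. by rewrite -[b1 m _]/(bb m (d m (v2 m x))) bb_d addrC; exact: subrK. Qed.
Let b2_delbar m x : phi m (c01 m x) + b1 m (bS m x) = op_delbar P m (b2 m x).
Proof. by rewrite -[b1 m _]/(bb m (b m (v2 m x))) bb_b addrC; exact: subrK. Qed.

Let ext := @ext_dcx k (dcx_ar X n) (dcx_ar P n) (phi n) (phi_morph phi n).
Let ext_dE x c : dc_d ext (x, c) = (op_del X n x + be n c, d n c). Proof. by []. Qed.
Let ext_bE x c : dc_b ext (x, c) = (op_delbar X n x + ga n c, b n c). Proof. by []. Qed.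

Let incl0 : {linear tw_sort n X S1 S2 -> (X n * N n)%type} :=
  pair_lin (fst_lin (X n) (S1 n * S2 n)%type)
    (copair (v1 n) (v2 n) \o snd_lin (X n) (S1 n * S2 n)%type).
Let incl : {linear tw_sort n X S1 S2 -> ext} := incl0.
Let inclE x s t : incl (x, (s, t)) = (x, v1 n s + v2 n t). Proof. by []. Qed.

Let rho_v1 m s : rho m (v1 m s) = v1 m s.
Proof. by apply: sp_rhoid; case: (v1P s). Qed.
Let rho_v2 m t : rho m (v2 m t) = 0.
Proof. by case: (v2P t) => -[]. Qed.

Let incl_inj : injective incl.
Proof.
move=> x y E'; apply: subr0_eq; have : incl (x - y) = 0 by rewrite linearB E' subrr.
case: (x - y) => a [s t]; rewrite inclE => H.
have a0 : a = 0 := congr1 (fun z : (X n * N n)%type => z.1) H.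
have st : v1 n s + v2 n t = 0 := congr1 (fun z : (X n * N n)%type => z.2) H.
(* [rho] fixes the first layer and kills the second, so it separates the two summands. *)
have vs0 : v1 n s = 0.
  by rewrite -rho_v1 -[LHS]addr0 -(rho_v2 t) -linearD st linear0.
have s0 : s = 0 by apply: val_inj.
have t0 : t = 0 by apply: val_inj; move: st; rewrite vs0 add0r.
by rewrite a0 s0 t0.
Qed.

Let D := tw_d n d10 c10 dS.
Let B := tw_b n d01 c01 bS.
Let incl_d y : incl (D y) = dc_d ext (incl y).
Proof.
case: y => x [s t]; rewrite /D tw_dE !inclE ext_dE linear0 addr0 v_dS.
by rewrite (linearD (be n)) (linearD (d n)) v1_d add0r addrA.
Qed.
Let incl_b y : incl (B y) = dc_b ext (incl y).
Proof.
case: y => x [s t]; rewrite /B tw_bE !inclE ext_bE linear0 addr0 v_bS.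
by rewrite (linearD (ga n)) (linearD (b n)) v1_b add0r addrA.
Qed.

(** The model embeds in [ext] compatibly with the differentials and inherits the relations from
    there. *)
Let tw_dd y : D (D y) = 0.
Proof. by apply: incl_inj; rewrite !incl_d linear0 dc_dd. Qed.
Let tw_bb y : B (B y) = 0.
Proof. by apply: incl_inj; rewrite !incl_b linear0 dc_bb. Qed.
Let tw_db y : D (B y) + B (D y) = 0.
Proof.
by apply: incl_inj; rewrite linearD incl_d incl_b incl_b incl_d linear0 dc_db.
Qed.

Let tw := tw_dcx tw_dd tw_bb tw_db.
Let incl' : {linear tw -> ext} := incl.

Let v1_E s : E n (v1 n s). Proof. by apply: V_E; case: (v1P s). Qed.
Let v2_E t : E n (v2 n t). Proof. by case: (v2P t) => -[]. Qed.

Let E_split c : E n c -> exists s t, v1 n s + v2 n t = c.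
Proof.
move=> Ec; have H1 : W1 n (rho n c) by split; [exact: sp_rhoV|].
have rE : rho n (c - rho n c) = 0.
  by rewrite linearB /rho (sp_rhoid (sp_rhoV sp c)) subrr.
have H2 : W2 n (c - rho n c).
  split; last by [].
  by split; [apply: (ssp_add Ec); apply: ssp_opp; apply: V_E; exact: sp_rhoV|].
exists (ssp_sub H1), (ssp_sub H2).
by rewrite -[v1 n _]/(rho n c) -[v2 n _]/(c - rho n c) addrC subrK.
Qed.

Let no_squares_E c : no_squares (C := cdcx phi n) (sp_pi sp n) c <-> E n c.
Proof. by split=> [[c1 c2 c3 c4]|/sp_EE[c1 c2 c3 c4]]; [apply/sp_EE|split]. Qed.

Let incl_image (y : ext) : no_squares (C := cdcx phi n) (sp_pi sp n) y.2 <-> exists x, incl' x = y.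
Proof.
split=> [/no_squares_E Ec|[[a [s t]] E']].
  have [s [t st]] := E_split Ec; exists (y.1, (s, t)).
  by rewrite /incl' inclE st; case: (y).
apply/no_squares_E; have <- : v1 n s + v2 n t = y.2 by rewrite -E'.
exact: ssp_add.
Qed.

Let snd_ext : {linear ext -> cdcx phi n} := snd_lin (X n) (cdcx phi n).

Let incl_weq' : @dc_weq k tw ext incl'.
Proof.
have M1 : @dc_morph k tw ext incl' by split; [exact: incl_d|exact: incl_b].
have M2 : @dc_morph k ext (cdcx phi n) snd_ext by split=> -[x c].
have S : forall c : cdcx phi n, exists y, snd_ext y = c by move=> c; exists (0, c).
exact: (@incl_weq k tw ext (cdcx phi n) incl' snd_ext (sp_pi sp n) M1 M2 incl_inj S
  (@sp_im _ _ _ _ sp n) (@sp_id _ _ _ _ sp n) incl_image).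
Qed.

(** The map factors as the inclusion into $P(n)\oplus J(X(n))$, an equivalence because only squares
    of the cone are left out, followed by the projection onto $P(n)$. *)
Let tw_weq : @dc_weq k tw (dcx_ar P n) (tw_map n phi b1 b2).
Proof.
apply: (@dc_weq_ext k tw (dcx_ar P n)
  (@ext_map k (dcx_ar X n) (dcx_ar P n) (phi n) \o incl')).
  move=> [x [s t]]; rewrite -[RHS]/(phi n x + b1 n s + b2 n t).
  rewrite -[LHS]/(phi n x + bb n (v1 n s + v2 n t)) (linearD (bb n)).
  exact: addrA.
apply: (@dc_weq_comp k tw ext (dcx_ar P n) incl').
- by split; [exact: incl_d|exact: incl_b].
- exact: ext_map_morph.
- exact: incl_weq'.
- exact: ext_map_weq.
Qed.

Lemma cone_arity_step : exists (Y1 : quasifree k) (j1 : opmorph X Y1) (phi1 : opmorph Y1 P)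
    (Y2 : quasifree k) (j2 : opmorph Y1 Y2) (phi2 : opmorph Y2 P),
  [/\ principal_ext j1, forall m x, phi1 m (j1 m x) = phi m x &
      forall m, (m < n)%N -> bijective_map (j1 m)] /\
  [/\ principal_ext j2, forall m x, phi2 m (j2 m x) = phi1 m x,
      forall m, (m < n)%N -> bijective_map (j2 m) & good n.+1 phi2].
Proof.
have d10_act m (s : 'S_m) x : d10 m (sm_act S1 s x) = sm_act X s (d10 m x) by [].
have d01_act m (s : 'S_m) x : d01 m (sm_act S1 s x) = sm_act X s (d01 m x) by [].
have c10_act m (s : 'S_m) x : c10 m (sm_act S2 s x) = sm_act X s (c10 m x) by [].
have c01_act m (s : 'S_m) x : c01 m (sm_act S2 s x) = sm_act X s (c01 m x) by [].
have d10_bideg m : has_bideg (1, 0) (d10 m) by move=> e x xe; exact/be_bideg/v1_bideg.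
have d01_bideg m : has_bideg (0, 1) (d01 m) by move=> e x xe; exact/ga_bideg/v1_bideg.
have c10_bideg m : has_bideg (1, 0) (c10 m) by move=> e x xe; exact/be_bideg/v2_bideg.
have c01_bideg m : has_bideg (0, 1) (c01 m) by move=> e x xe; exact/ga_bideg/v2_bideg.
exact: (@both_steps k P P1 n X phi S1 S2 d10 d01 c10 c01 dS bS b1 b2 n2 Xgood
  S1_conc S2_conc d10_bideg d01_bideg c10_bideg c01_bideg dS_bideg bS_bideg
  d10_act d01_act c10_act c01_act dS_act bS_act S1_del S1_delbar S1_mixed
  b1_del b1_delbar c10_del c01_delbar c_mixed b2_del b2_delbar
  tw_dd tw_bb tw_db tw_weq).
Qed.
End ArityStep.

Lemma arity_step (char0 : [pchar k] =i pred0) (n : nat) (X : quasifree k) (phi : opmorph X P) :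
  (2 <= n)%N -> good n phi ->
  exists (Y1 : quasifree k) (j1 : opmorph X Y1) (phi1 : opmorph Y1 P)
    (Y2 : quasifree k) (j2 : opmorph Y1 Y2) (phi2 : opmorph Y2 P),
  [/\ principal_ext j1, forall m x, phi1 m (j1 m x) = phi m x &
      forall m, (m < n)%N -> bijective_map (j1 m)] /\
  [/\ principal_ext j2, forall m x, phi2 m (j2 m x) = phi1 m x,
      forall m, (m < n)%N -> bijective_map (j2 m) & good n.+1 phi2].
Proof.
move=> n2 Xgood.
have [sp] := splitting_exists char0 (@csm_d_bideg _ _ _ phi) (@csm_b_bideg _ _ _ phi)
  (@csm_d_act _ _ _ phi) (@csm_b_act _ _ _ phi).
exact: cone_arity_step n2 Xgood sp.
Qed.
End ConeStep.

(** * Sequential colimits *)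

Section Colim.
Variables (k : fieldType) (X : nat -> operad k) (j : forall r, opmorph (X r) (X r.+1)).
Variable t : nat -> nat.
Hypothesis j_bij : forall n r, (t n <= r)%N -> bijective_map (j r n).

Definition tr_eq r s n : {linear X r n -> X s n} :=
  if r =P s is ReflectT e then
    eq_rect r (fun q => {linear X r n -> X q n}) (idfun : {linear X r n -> X r n}) s e
  else \0.

(* The transition map X r -> X s for r <= s (junk otherwise). *)
Fixpoint push r s n : {linear X r n -> X s n} :=
  match s return {linear X r n -> X s n} with
  | 0 => tr_eq r 0 n
  | s'.+1 => if r == s'.+1 then tr_eq r s'.+1 n else j s' n \o push r s' n
  end.

Lemma push_id r n (x : X r n) : push r r n x = x.
Proof.
have E : tr_eq r r n x = x by rewrite /tr_eq; case: eqP => // e; rewrite eq_axiomK.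
by case: r x E => [|r] x E //=; rewrite eqxx.
Qed.

Lemma pushS r s n (x : X r n) : (r <= s)%N -> push r s.+1 n x = j s n (push r s n x).
Proof. by move=> rs /=; rewrite ltn_eqF. Qed.

Lemma leq_from_ind r (S : nat -> Prop) : S r -> (forall s, (r <= s)%N -> S s -> S s.+1) ->
  forall s, (r <= s)%N -> S s.
Proof.
move=> Sr SS; elim=> [|s IH]; first by rewrite leqn0 => /eqP <-.
by rewrite leq_eqVlt => /orP[/eqP <-|] //; rewrite ltnS => rs; exact/SS/IH.
Qed.

Lemma push_push r s q n (x : X r n) : (r <= s)%N -> (s <= q)%N ->
  push s q n (push r s n x) = push r q n x.
Proof.
move=> rs; move: q; apply: leq_from_ind => [|q sq IH]; first by rewrite push_id.
by rewrite !pushS ?IH //; exact: leq_trans sq.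
Qed.

Section Morph.
Variables (r s : nat) (rs : (r <= s)%N).
Lemma push_bideg n : has_bideg 0 (push r s n).
Proof.
move: s rs; apply: leq_from_ind => [|q rq IH] d x xd; rewrite addr0; first by rewrite push_id.
rewrite pushS // -[d]addr0; apply: smm_bideg.
by have := IH d x xd; rewrite addr0.
Qed.
Lemma push_act n (p : 'S_n) x : push r s n (sm_act (X r) p x) = sm_act (X s) p (push r s n x).
Proof.
by move: s rs; apply: leq_from_ind => [|q rq IH]; rewrite ?push_id // !pushS // IH smm_act.
Qed.
Lemma push_og_id : push r s 1%N (og_id (X r)) = og_id (X s).
Proof.
by move: s rs; apply: leq_from_ind => [|q rq IH]; rewrite ?push_id // !pushS // IH bom_id.
Qed.
Lemma push_pcomp m n l (e : l.+1 = (m + n)%N) (i : 'I_m) x y :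
  push r s l (og_pcomp (X r) e i x y) = og_pcomp (X s) e i (push r s m x) (push r s n y).
Proof.
by move: s rs; apply: leq_from_ind => [|q rq IH]; rewrite ?push_id // !pushS // IH bom_pcomp.
Qed.
Lemma push_del n x : push r s n (op_del (X r) n x) = op_del (X s) n (push r s n x).
Proof.
by move: s rs; apply: leq_from_ind => [|q rq IH]; rewrite ?push_id // !pushS // IH om_del.
Qed.
Lemma push_delbar n x : push r s n (op_delbar (X r) n x) = op_delbar (X s) n (push r s n x).
Proof.
by move: s rs; apply: leq_from_ind => [|q rq IH]; rewrite ?push_id // !pushS // IH om_delbar.
Qed.
Lemma push_bij n : (t n <= r)%N -> bijective_map (push r s n).
Proof.
move=> tr; move: s rs; apply: leq_from_ind => [|q rq [inj surj]].
  split; first by move=> x y; rewrite !push_id.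
  by move=> y; exists y; rewrite push_id.
have [jinj jsurj] := j_bij (leq_trans tr rq); split.
  by move=> x y; rewrite !pushS // => /jinj/inj.
by move=> y; have [z <-] := jsurj y; have [x <-] := surj z; exists x; rewrite pushS.
Qed.
End Morph.

(** Arity [n] no longer changes from stage [t n] on, so the colimit is taken to be that stage in
    each arity, instead of a quotient of a union over all stages. *)
Let C n : bgvect k := X (t n) n.
Let co N n : {linear C n -> X N n} := push (t n) N n.

Let co_inj N n : (t n <= N)%N -> injective (co N n).
Proof. by move=> tN; have [] := push_bij tN (leqnn (t n)). Qed.

Let pull_ex N n (y : X N n) : exists x : C n, (t n <= N)%N -> co N n x = y.
Proof.
have [tN|_] := boolP (t n <= N)%N; last by exists 0.
by have [_ /(_ y)[x xE]] := push_bij tN (leqnn (t n)); exists x.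
Qed.
Let pull N n (y : X N n) : C n := sval (cid (pull_ex y)).
Let pullK N n (y : X N n) : (t n <= N)%N -> co N n (pull y) = y.
Proof. by rewrite /pull; case: cid. Qed.

Let co_homog N n d (x : C n) : (t n <= N)%N -> homog d (co N n x) -> homog d x.
Proof.
move=> tN; have B := proj1 (has_bideg0_proj (co N n)) (push_bideg tN (n := n)).
by rewrite /homog -B => /(co_inj tN).
Qed.
Let homog_co N n d (x : C n) : (t n <= N)%N -> homog d x -> homog d (co N n x).
Proof. by move=> tN xd; rewrite -[d]addr0; exact: push_bideg. Qed.

Let csm : bgsmod k := @BgSMod k C (fun n => @sm_act k (X (t n)) n)
  (fun n => @sm_act_bideg k (X (t n)) n) (fun n => @sm_act1 k (X (t n)) n)
  (fun n => @sm_actM k (X (t n)) n).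

Let co_act N n (s : 'S_n) x : (t n <= N)%N ->
  co N n (sm_act csm s x) = sm_act (X N) s (co N n x).
Proof. by move=> tN; exact: push_act. Qed.

Let cid_ : csm 1%N := og_id (X (t 1%N)).
Let co_id N : (t 1 <= N)%N -> co N 1%N cid_ = og_id (X N).
Proof. by move=> tN; exact: push_og_id. Qed.

(** The sum [t m + t n + t l] is simply a common bound at which the three arities are stable; by
    [co_pc] every later stage gives the same composition. *)
Let cpc m n l (e : l.+1 = (m + n)%N) (i : 'I_m) (x : csm m) (y : csm n) : csm l :=
  pull (og_pcomp (X (t m + t n + t l)%N) e i (co _ m x) (co _ n y)).

Let co_push N K n (x : C n) : (t n <= N)%N -> (N <= K)%N -> push N K n (co N n x) = co K n x.
Proof. by move=> tN NK; exact: push_push. Qed.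

Let co_pc N m n l (e : l.+1 = (m + n)%N) (i : 'I_m) x y :
  (t m + t n + t l <= N)%N ->
  co N l (cpc e i x y) = og_pcomp (X N) e i (co N m x) (co N n y).
Proof.
move=> tN; rewrite -(@co_push (t m + t n + t l)%N N l) ?leq_addl //.
rewrite /cpc pullK ?leq_addl // push_pcomp // !co_push //; lia.
Qed.

(** Each law of the colimit is checked in a single [X N], with [N] beyond the stability bounds of
    all arities involved. *)
Let ext N n (x y : C n) : (t n <= N)%N -> co N n x = co N n y -> x = y.
Proof. by move=> tN /(co_inj tN). Qed.

Let cop : bgoperad k.
Proof.
apply: (@BgOperad k csm cid_ cpc).
- move=> m n l e i y a x x'; apply: (@ext (t m + t n + t l)%N); first by lia.
  by rewrite linearP !co_pc // linearP pcompDl pcompZl.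
- move=> m n l e i x a y y'; apply: (@ext (t m + t n + t l)%N); first by lia.
  by rewrite linearP !co_pc // linearP pcompDr pcompZr.
- exact: og_id_homog.
- move=> m n l e i c d x y xc yd; apply: (@co_homog (t m + t n + t l)%N); first by lia.
  rewrite co_pc //; apply: og_pcomp_homog; apply: homog_co => //; lia.
- move=> n e i y; apply: (@ext (t 1 + t n + t n)%N); first by lia.
  by rewrite co_pc // co_id ?og_idl //; lia.
- move=> m e i x; apply: (@ext (t m + t 1 + t m)%N); first by lia.
  by rewrite co_pc // co_id ?og_idr //; lia.
- move=> m n p mn np l e e' g g' i h ih ihE x y z.
  apply: (@ext (t m + t n + t p + t mn + t np + t l)%N); first by lia.
  rewrite !co_pc; try lia.
  exact: og_seq.
- move=> m n p mn mp l e e' g g' i h i' h' ih h'E i'E c d x y z yc zd.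
  apply: (@ext (t m + t n + t p + t mn + t mp + t l)%N); first by lia.
  rewrite linearZ /= !co_pc; try lia.
  apply: (og_par e e' g g' ih h'E i'E); apply: homog_co => //; lia.
- move=> m n l e i s p r rE x y.
  apply: (@ext (t m + t n + t l)%N); first by lia.
  rewrite co_act ?co_pc ?co_act; try lia.
  exact: og_equiv.
Defined.

Let cdel n : {linear cop n -> cop n} := op_del (X (t n)) n.
Let cdelbar n : {linear cop n -> cop n} := op_delbar (X (t n)) n.
Let co_del N n x : (t n <= N)%N -> co N n (cdel n x) = op_del (X N) n (co N n x).
Proof. by move=> tN; exact: push_del. Qed.
Let co_delbar N n x : (t n <= N)%N -> co N n (cdelbar n x) = op_delbar (X N) n (co N n x).
Proof. by move=> tN; exact: push_delbar. Qed.

Definition colim : operad k.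
Proof.
apply: (@Operad k cop cdel cdelbar).
- move=> n; exact: (op_bicomplex (X (t n)) n).
- move=> n; exact: op_act_del.
- move=> n; exact: op_act_delbar.
- exact: op_id_del.
- exact: op_id_delbar.
- move=> m n l e i d x y xd; apply: (@ext (t m + t n + t l)%N); first by lia.
  rewrite linearD linearZ /= co_del ?co_pc ?co_del; try lia.
  by rewrite (op_leibniz_del e i _ (homog_co _ xd)) //; lia.
- move=> m n l e i d x y xd; apply: (@ext (t m + t n + t l)%N); first by lia.
  rewrite linearD linearZ /= co_delbar ?co_pc ?co_delbar; try lia.
  by rewrite (op_leibniz_delbar e i _ (homog_co _ xd)) //; lia.
Defined.

Let leg_fun r n (x : X r n) : C n := pull (push r (r + t n)%N n x).
Let co_leg N r n (x : X r n) : (r + t n <= N)%N -> co N n (leg_fun x) = push r N n x.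
Proof.
move=> rN; rewrite -(@co_push (r + t n)%N N n) ?leq_addl //.
by rewrite /leg_fun pullK ?leq_addl // push_push ?leq_addr.
Qed.
Let leg_linear r n : linear (@leg_fun r n).
Proof.
move=> a x y; apply: (@ext (r + t n)%N); first by lia.
by rewrite linearP !co_leg // linearP.
Qed.
Let legL r n : {linear X r n -> colim n} := linpack (@leg_linear r n).
Let co_legL N r n (x : X r n) : (r + t n <= N)%N -> co N n (legL r n x) = push r N n x.
Proof. exact: co_leg. Qed.

Let leg_bideg r n : has_bideg 0 (legL r n).
Proof.
move=> d x xd; apply: (@co_homog (r + t n)%N); first by lia.
by rewrite co_legL //; apply: push_bideg => //; lia.
Qed.
Let leg_act r n (s : 'S_n) x : legL r n (sm_act (X r) s x) = sm_act colim s (legL r n x).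
Proof.
apply: (@ext (r + t n)%N); first by lia.
by rewrite co_act ?co_legL ?push_act //; lia.
Qed.
Let leg_og_id r : legL r 1%N (og_id (X r)) = og_id colim.
Proof.
apply: (@ext (r + t 1)%N); first by lia.
by rewrite co_id ?co_legL ?push_og_id //; lia.
Qed.
Let leg_pcomp r m n l (e : l.+1 = (m + n)%N) (i : 'I_m) (x : X r m) (y : X r n) :
  legL r l (og_pcomp (X r) e i x y) = og_pcomp colim e i (legL r m x) (legL r n y).
Proof.
apply: (@ext (r + t m + t n + t l)%N); first by lia.
by rewrite co_pc ?co_legL ?push_pcomp //; lia.
Qed.
Let leg_del r n x : legL r n (op_del (X r) n x) = op_del colim n (legL r n x).
Proof.
apply: (@ext (r + t n)%N); first by lia.
by rewrite co_del ?co_legL ?push_del //; lia.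
Qed.
Let leg_delbar r n x : legL r n (op_delbar (X r) n x) = op_delbar colim n (legL r n x).
Proof.
apply: (@ext (r + t n)%N); first by lia.
by rewrite co_delbar ?co_legL ?push_delbar //; lia.
Qed.
Definition colim_leg r : opmorph (X r) colim :=
  @OpMorph k (X r) colim (@BgOpMorph k (X r) colim
    (@SmMorph k (X r) colim (legL r) (@leg_bideg r) (@leg_act r)) (leg_og_id r)
    (@leg_pcomp r)) (@leg_del r) (@leg_delbar r).

Lemma colim_legE r n x : colim_leg r n x = legL r n x. Proof. by []. Qed.

Lemma colim_leg_id n (x : colim n) : colim_leg (t n) n x = x.
Proof. by apply: (@ext (t n + t n)%N); rewrite ?colim_legE ?co_legL //; lia. Qed.

Section Univ.
Variables (D : operad k) (leg' : forall r, opmorph (X r) D).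
Hypothesis leg'C : is_cocone j leg'.
Lemma cocone_push r s n (x : X r n) : (r <= s)%N -> leg' s n (push r s n x) = leg' r n x.
Proof.
by move: s; apply: leq_from_ind => [|s rs IH]; rewrite ?push_id // pushS // leg'C.
Qed.
Let cocone_co N n (x : C n) : (t n <= N)%N -> leg' N n (co N n x) = leg' (t n) n x.
Proof. by move=> tN; exact: cocone_push. Qed.

Let f n : {linear colim n -> D n} := leg' (t n) n.
Let f_bideg n : has_bideg 0 (f n).
Proof. exact: (smm_bideg (leg' (t n)) (n := n)). Qed.
Let f_act n (s : 'S_n) x : f n (sm_act colim s x) = sm_act D s (f n x).
Proof. exact: (smm_act (leg' (t n))). Qed.
Let f_id : f 1%N (og_id colim) = og_id D.
Proof. exact: (bom_id (leg' (t 1%N))). Qed.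
Let f_pcomp m n l (e : l.+1 = (m + n)%N) (i : 'I_m) (x : colim m) (y : colim n) :
  f l (og_pcomp colim e i x y) = og_pcomp D e i (f m x) (f n y).
Proof.
by rewrite /f -(@cocone_co (t m + t n + t l)%N) ?co_pc ?bom_pcomp ?cocone_co //; lia.
Qed.
Let f_del n x : f n (op_del colim n x) = op_del D n (f n x).
Proof. exact: (om_del (leg' (t n))). Qed.
Let f_delbar n x : f n (op_delbar colim n x) = op_delbar D n (f n x).
Proof. exact: (om_delbar (leg' (t n))). Qed.
Definition colim_desc : opmorph colim D :=
  @OpMorph k colim D (@BgOpMorph k colim D
    (@SmMorph k colim D f f_bideg f_act) f_id f_pcomp) f_del f_delbar.
Lemma colim_descE n (x : colim n) : colim_desc n x = leg' (t n) n x. Proof. by []. Qed.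
Lemma colim_desc_leg r n x : colim_desc n (colim_leg r n x) = leg' r n x.
Proof.
rewrite colim_descE -(@cocone_co (r + t n)%N); last by lia.
by rewrite colim_legE co_legL // cocone_push //; lia.
Qed.
End Univ.

Lemma colim_colimit : is_colimit j colim_leg.
Proof.
split.
  move=> r n x; apply: (@ext (r.+1 + t n)%N); first by lia.
  rewrite !colim_legE !co_legL //.
  have <- : push r r.+1 n x = j r n x by rewrite pushS // push_id.
  by rewrite push_push //; lia.
move=> D leg' leg'C; split.
  by exists (colim_desc leg'C) => r n x; exact: colim_desc_leg.
move=> f g fE gE n y; by rewrite -[y]colim_leg_id fE gE.
Qed.
End Colim.

(** * The minimal model *)

Section Sequence.
Variables (k : fieldType) (char0 : [pchar k] =i pred0) (P : operad k).
Hypotheses (P0 : is_zero (P 0%N)) (P1 : unit_arity1 P).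

Section Base.
(** The zero S-module, obtained as the zero subspace of [P]; the free operad on it is the initial
    operad. *)
Let Z m : subspace (P m) := if_ssp (P m) False.
Let Z0 m x : Z m x -> x = 0. Proof. by apply. Qed.
Let Z_proj m e x : Z m x -> Z m (bg_proj (P m) e x).
Proof. by move=> /Z0-> _; rewrite linear0. Qed.
Let Z_act m (s : 'S_m) x : Z m x -> Z m (sm_act P s x).
Proof. by move=> /Z0-> _; rewrite linear0. Qed.
Let M : bgsmod k := smsub Z_proj Z_act.
Let M_zero m : is_zero (M m).
Proof. by move=> x; apply: val_inj; apply: Z0; exact: ssp_valP. Qed.
Let F : bgoperad k := free_operad M.
Let iota : smmorph M F := free_iota M.
Let Fgen : op_generated iota := @free_generated k M.

Let del n : {linear F n -> F n} := \0.
Let delE n (x : F n) : del n x = 0. Proof. by []. Qed.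
Let del_bideg c n : has_bideg c (del n).
Proof. by move=> d x _; exact: homog0. Qed.
Let del_deriv c : is_deriv c del.
Proof.
split.
- by move=> n; exact: del_bideg.
- by move=> n s x; rewrite !delE linear0.
- exact: delE.
- by move=> m n l e i x y; rewrite !delE pcomp0l pcomp0r addr0.
Qed.
Let bcF n : @is_bicomplex k (F n) (del n) (del n).
Proof. by split; try exact: del_bideg; move=> x; rewrite !delE ?addr0. Qed.
Let Q : operad k := Operad bcF (dv_act (del_deriv (1, 0))) (dv_act (del_deriv (1, 0)))
  (dv_id (del_deriv (1, 0))) (dv_id (del_deriv (1, 0)))
  (deriv_leibniz (del_deriv (1, 0))) (deriv_leibniz (del_deriv (1, 0))).
Let X : quasifree k := @QuasiFree k Q M iota (@free_is_free k M).

(** The hypotheses on $P(0)$ and $P(1)$ make the unit $\mathrm I\to P$ an isomorphism in arities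
    below two, so the induction starts at arity two. *)
Lemma initial_stage : exists (Y : quasifree k) (phi : opmorph Y P), is_initial Y /\ good 2 phi.
Proof.
have z_bideg n : @has_bideg k (M n) (P n) 0 (\0 : {linear M n -> P n}).
  by move=> d x _; exact: homog0.
have z_act n (s : 'S_n) (x : M n) :
    (\0 : {linear M n -> P n}) (sm_act M s x) = sm_act P s ((\0 : {linear M n -> P n}) x).
  by rewrite /= linear0.
have [[f fE] _] := @free_is_free k M P (SmMorph z_bideg z_act).
have fdel n x : f n (del n x) = op_del P n (f n x).
  move: n x; apply: (deriv_intertwine Fgen (del_deriv _) (op_del_deriv P)) => n x.
  by rewrite delE (M_zero x) !linear0.
have fdelbar n x : f n (del n x) = op_delbar P n (f n x).
  move: n x; apply: (deriv_intertwine Fgen (del_deriv _) (op_delbar_deriv P)) => n x.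
  by rewrite delE (M_zero x) !linear0.
pose phi : opmorph X P := @OpMorph k X P f fdel fdelbar.
have XU : unit_arity1 X := arity1 Fgen (@M_zero 0) (@M_zero 1) phi P1.
have XZ : is_zero (X 0%N) := arity0 Fgen (@M_zero 0) (@M_zero 1).
have phiZ a : phi 1%N (a *: og_id X) = a *: og_id P.
  by rewrite [LHS]linearZ (bom_id phi).
exists X, phi; split.
  split=> //; suff H n (x : F n) : n <> 1%N -> x = 0 by move=> n n1 x; exact: H.
  move: n x; apply: Fgen => //.
  - by move=> n a x y Ex Ey n1; rewrite Ex // Ey // scaler0 addr0.
  - by move=> n d x _ _; rewrite (M_zero x) linear0.
  - by move=> n s x Ex n1; rewrite Ex // linear0.
  - move=> m n l e i c d x y _ _ Ex Ey l1.
    have [m1|/eqP m1] := eqVneq m 1%N; last by rewrite Ex // pcomp0l.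
    by rewrite Ey ?pcomp0r //; lia.
split=> //.
- move=> m m2; apply: dc_weq_bij.
  + by split=> x; [exact: (om_del phi)|exact: (om_delbar phi)].
  + case: m m2 => [|[|m]] // _ x y; first by rewrite (XZ x) (XZ y).
    have [a [-> _]] := XU x; have [b [-> _]] := XU y.
    rewrite !phiZ => E'.
    have [c [_ cU]] := P1 (a *: og_id P).
    by rewrite -(cU a) // -(cU b).
  + case: m m2 => [|[|m]] // _ y; first by exists 0; rewrite linear0 (P0 y).
    have [a [-> _]] := P1 y; exists (a *: og_id X).
    exact: phiZ.
- by move=> m x; exact: weight_ge_0.
Qed.
End Base.

(** The situation between the two extensions in arity [i + 2]. The first one is useful only together
    with a second that completes it, so the existence of the latter is carried along. *)
Definition good_mid (i : nat) (X : quasifree k) (phi : opmorph X P) : Prop :=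
  exists (Y : quasifree k) (j : opmorph X Y) (psi : opmorph Y P),
  [/\ principal_ext j, forall m x, psi m (j m x) = phi m x,
      forall m, (m < i.+2)%N -> bijective_map (j m) & good i.+3 psi].

(** There are two extensions per arity, starting in arity two: stage [i.*2] is complete in arities
    below [i + 2], and the odd stage after it is halfway through arity [i + 2]. *)
Definition good_stage (r : nat) (X : quasifree k) (phi : opmorph X P) : Prop :=
  if odd r then good_mid r./2 phi else good r./2.+2 phi.

Lemma stage_step r (X : quasifree k) (phi : opmorph X P) : good_stage r phi ->
  exists (Y : quasifree k) (j : opmorph X Y) (psi : opmorph Y P),
  [/\ principal_ext j, forall m x, psi m (j m x) = phi m x,
      forall m, (m < r./2.+2)%N -> bijective_map (j m) & good_stage r.+1 psi].
Proof.
rewrite /good_stage /= uphalf_half; case: (odd r) => //=.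
move=> Xgood; have [Y1 [j1 [phi1 [Y2 [j2 [phi2 [[H1 H2 H3] H4]]]]]]] :=
  arity_step P1 char0 (isT : (1 < r./2.+2)%N) Xgood.
exists Y1, j1, phi1; split=> //; exists Y2, j2, phi2; exact: H4.
Qed.

Record stage r := Stage {
  stg_X : quasifree k;
  stg_phi : opmorph stg_X P;
  stg_good : good_stage r stg_phi }.

Lemma stage_next r (s : stage r) : exists s' : stage r.+1, exists j : opmorph (stg_X s) (stg_X s'),
  [/\ principal_ext j, forall m x, stg_phi s' m (j m x) = stg_phi s m x &
      forall m, (m < r./2.+2)%N -> bijective_map (j m)].
Proof.
have [Y [j [psi [H1 H2 H3 H4]]]] := stage_step (stg_good s).
by exists (Stage H4), j.
Qed.

Lemma stages : exists s : forall r, stage r, is_initial (stg_X (s 0%N)) /\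
  forall r, exists j : opmorph (stg_X (s r)) (stg_X (s r.+1)),
  [/\ principal_ext j, forall m x, stg_phi (s r.+1) m (j m x) = stg_phi (s r) m x &
      forall m, (m < r./2.+2)%N -> bijective_map (j m)].
Proof.
have [Y [phi [Y0 Ygood]]] := initial_stage.
pose s0 : stage 0 := @Stage 0 Y phi Ygood.
pose s := fix s r : stage r :=
  if r is r'.+1 then sval (cid (stage_next (s r'))) else s0.
exists s; split=> // r /=; by case: cid.
Qed.

Lemma minimal_model : exists (M : operad k) (f : opmorph M P), minimal M /\ operad_weq f.
Proof.
have [s [s0 sS]] := stages.
pose X r : quasifree k := stg_X (s r).
pose phi r : opmorph (X r) P := stg_phi (s r).
pose j r : opmorph (X r) (X r.+1) := sval (cid (sS r)).
have [jP jphi jbij] : [/\ forall r, principal_ext (j r),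
    forall r m x, phi r.+1 m (j r m x) = phi r m x &
    forall r m, (m < r./2.+2)%N -> bijective_map (j r m)].
  by split=> r; rewrite /j; case: cid => j' [].
have Xgood i : good i.+2 (phi i.*2).
  by have := stg_good (s i.*2); rewrite /good_stage odd_double doubleK.
clearbody j phi.
(* From stage [n.*2] on, only arities at least [n + 2] receive generators, so arity [n] is
   stable. *)
have stab n r : (n.*2 <= r)%N -> bijective_map (j r n).
  by move=> nr; apply: jbij; lia.
pose C := @colim k X j double stab.
have col : is_colimit (X := X) j (colim_leg (X := X) stab) := colim_colimit stab.
pose c : cofibrant C := @Cofibrant k C X j s0 jP (colim_leg (X := X) stab) col.
have phiC : is_cocone (X := X) j phi by move=> r n x; exact: jphi.
exists C, (colim_desc (X := X) stab phiC); split.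
  (* An element of arity [n] of the colimit is an element of stage [n.*2], where the weight bound is
     known; the leg out of that stage carries generators to generators, hence preserves the
     bound. *)
  exists c => n x.
  have [_ _ _ W] := Xgood n.
  have W2 := W n x.
  have HG m (y : X n.*2 m) : gens (qf_iota (X n.*2)) y ->
      cof_gen c (colim_leg (X := X) stab n.*2 m y).
    by move=> [g ->]; exists n.*2, g.
  have H := weight_ge_map HG W2.
  rewrite (@colim_leg_id k X j double stab n _) in H; exact: H.
move=> n; apply/weq_of_dc.
have [_ _ W _] := Xgood n.
(* In arity [n] the induced morphism is [phi n.*2] by definition, and that stage is an equivalence
   in arities below [n + 2]. *)
exact: (W n (ltnW (ltnSn _))).
Qed.
End Sequence.

Local Close Scope ring_scope.

Theorem theorem1 (k : fieldType) (char0 : [pchar k]%R =i pred0)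
    (P : operad k) (P0 : is_zero (P 0)) (P1 : unit_arity1 P) :
  exists (M : operad k) (f : opmorph M P), minimal M /\ operad_weq f.
Proof. exact: minimal_model. Qed.
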